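(* There exist universal constants $c,C>0$ such that for every integer $n\ge1$, every random vector $X$ in $\mathbb{R}^n$ with an isotropic, log-concave density, and all $0\le\varepsilon\le1$, $$\mathrm{Prob}\left\{\left|\frac{|X|}{\sqrt n}-1\right|\ge\varepsilon\right\}\le C\exp\left(-c\,\varepsilon^{3.33}n^{0.33}\right).$$
   Context: A function $f:\mathbb{R}^n\to[0,\infty)$ is log-concave if $f(\lambda x+(1-\lambda)y)\ge f(x)^\lambda f(y)^{1-\lambda}$ for all $x,y$ and $0<\lambda<1$; it is isotropic if it is the density of a random vector with zero mean and identity covariance matrix. $|\cdot|$ is the Euclidean norm. *)

(* Defs.v *)
From HB Require Import structures.
From mathcomp Require Import all_boot all_order all_algebra.
From mathcomp Require Import all_classical all_reals all_analysis.
Set Implicit Arguments. Unset Strict Implicit. Unset Printing Implicit Defensive.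
Import Order.TTheory GRing.Theory Num.Theory.
Local Open Scope classical_set_scope.
Local Open Scope ring_scope.

(* Vectors of R^n are represented as n.-tuple R (which carries the product
   sigma-algebra, generated by the coordinate maps). *)

(* Integral over R^n w.r.t. n-dimensional Lebesgue measure of a
   (nonnegative) function, computed as the iterated Lebesgue integral
   (Tonelli): iint (f) = \int dx_1 ... \int dx_n f(x_1,...,x_n). *)
Fixpoint iint (R : realType) (n : nat) : (n.-tuple R -> \bar R) -> \bar R :=
  match n with
  | 0 => fun f => f [tuple]
  | m.+1 => fun f =>
      (\int[@lebesgue_measure R]_x iint (fun t : m.-tuple R => f [tuple of x :: t]))%E
  end.

Definition enorm (R : realType) (n : nat) (x : n.-tuple R) : R :=
  Num.sqrt (\sum_(i < n) tnth x i ^+ 2).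

Definition tconv (R : realType) (n : nat) (l : R) (x y : n.-tuple R) : n.-tuple R :=
  [tuple l * tnth x i + (1 - l) * tnth y i | i < n].

Definition log_concave (R : realType) (n : nat) (f : n.-tuple R -> R) : Prop :=
  (forall x, 0 <= f x) /\
  forall (x y : n.-tuple R) (l : R), 0 < l < 1 ->
    f (tconv l x y) >= f x `^ l * f y `^ (1 - l).

(* f is the density of a random vector with zero mean and identity
   covariance.  Signed integrals are split into positive and negative parts
   so that only integrals of nonnegative functions are used. *)
Definition isotropic_density (R : realType) (n : nat) (f : n.-tuple R -> R) : Prop :=
  measurable_fun [set: n.-tuple R] f /\
  (forall x, 0 <= f x) /\
  iint (fun x => (f x)%:E) = 1%E /\
  (forall i : 'I_n,
     iint (fun x => ((Num.max (tnth x i) 0) * f x)%:E) =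
     iint (fun x => ((Num.max (- tnth x i) 0) * f x)%:E)) /\
  (forall i j : 'I_n,
     iint (fun x => ((Num.max (tnth x i * tnth x j) 0) * f x)%:E) =
     (iint (fun x => ((Num.max (- (tnth x i * tnth x j)) 0) * f x)%:E)
        + (i == j)%:R%:E)%E).

Definition prob_dens (R : realType) (n : nat) (f : n.-tuple R -> R)
  (A : set (n.-tuple R)) : \bar R :=
  iint (fun x => (\1_A x * f x)%:E).

(* Main.v *)
(** Let s = 1 + |X|^2 / n and let G be a (2k) x n standard Gaussian matrix.
    Averaging exp(- (1/2) sum_j (a - <G_j, X> / sqrt n)^2) over G and X produces
    V(a) = E (exp(- a^2 / s) / s)^k.  For a fixed G the average over X is log-concave in a
    (Prekopa-Leindler), and it changes little when G is replaced by a nearby matrix.  The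
    Prekopa-Leindler inequality for the Gaussian measure has a surplus exp(|G - G'|^2 / 4)
    which pays for this change, so that V (G being restricted to a ball) satisfies the midpoint
    inequality of log-concave functions up to a factor exp(delta), delta = O(k^3 a^6 / n).
    On the other hand (exp(- a^2 / s) / s)^k <= (exp(- 1) / a^2)^k, with near equality exactly
    when s is close to a^2, and this envelope is strictly log-convex in a.  Hence s cannot take
    two separated values both with sizable probability; it concentrates around one value, which
    is close to E s = 2.  Choosing k ~ n^0.35 gives probability at most
    exp(- eps^2 n^0.33) for deviations eps >= n^-0.1, and smaller deviations are trivial. *)
Require Import Defs.
From HB Require Import structures.
From mathcomp Require Import all_boot all_order all_algebra.
From mathcomp Require Import all_classical all_reals all_analysis.
From mathcomp Require Import measurable_realfun lra ring.
Import Order.TTheory GRing.Theory Num.Theory.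
Import numFieldTopology.Exports.
Local Open Scope classical_set_scope.
Local Open Scope ring_scope.

(** * The Prekopa-Leindler inequality *)

(** The defect: moving the matrix by squared distance d changes the logarithm of the average over X
    by at most about lam D + d Q / lam, where D = O(k a^2) bounds the quadratic exponent and Q =
    O(D^2 / n) is the second moment of a scaled unit functional under the tilted measure. The
    Gaussian surplus absorbs the second term once lam is of order Q; what remains is Q D, of order
    D^3 / n. The obstacle: this defect grows with [a], so [a] must stay below alpha = n^0.01, while
    s may be a power of n. Large s is excluded by the same inequality. Iterated along b (1 + 2^j)
    from a typical b, approximate log-concavity makes V decay like exp(- k 2^j / 2), whereas mass at
    s <= S keeps V above that mass times (exp(- 1) / S)^k. With 2^j of order n^0.01 this handles S
    polynomial in n; beyond S the exponential moments of the coordinates suffice. The gain: values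
    of s separated by eps cost exp(- c k eps^2), which must beat exp(delta); this needs eps >=
    n^-0.1 for the chosen k. *)

Lemma lebesgue_measure_affine (R : realType) (a b : R) (A : set R) : 0 < a ->
  measurable A ->
  lebesgue_measure A =
  (a%:E * lebesgue_measure ((fun x : R => (a * x + b)%R) @^-1` A))%E.
Proof.
move=> a0 mA.
pose phi := (fun x : R => a * x + b) : measurableTypeR R -> measurableTypeR R.
have mphi : measurable_fun setT phi by apply: measurable_funD => //; exact: measurable_funM.
pose m := pushforward (mscale (NngNum (ltW a0)) (@lebesgue_measure R)) phi.
rewrite -[RHS]/(m A).
apply: lebesgue_measure_unique => // _ [[p q]] _ <-.
rewrite -[RHS]/(a%:E * lebesgue_measure (phi @^-1` `]p, q]))%E.
have -> : phi @^-1` `]p, q]%classic = `](p - b) / a, (q - b) / a]%classic.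
  apply/seteqP; split => x /=; rewrite ?in_itv/= /phi => /andP[H1 H2];
  apply/andP; split.
  - by rewrite ltr_pdivrMr//; lra.
  - by rewrite ler_pdivlMr//; lra.
  - by move: H1; rewrite ltr_pdivrMr//; lra.
  - by move: H2; rewrite ler_pdivlMr//; lra.
rewrite !lebesgue_measure_itv/= !lte_fin ltr_pM2r ?invr_gt0//.
have -> : (p - b < q - b) = (p < q) by apply/idP/idP; lra.
case: ifPn => pq; last by rewrite mule0.
rewrite -!EFinD -EFinM; congr EFin; field.
by rewrite gt_eqF.
Qed.

Lemma le_measure_subset {d} {T : measurableType d} {R : realType}
    (mu : {measure set T -> \bar R}) (A B : set T) :
  measurable A -> measurable B -> A `<=` B -> (mu A <= mu B)%E.
Proof. by move=> mA mB; apply: le_measure; rewrite inE. Qed.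

Section brunn_minkowski.
Context {R : realType}.
Notation mu := (@lebesgue_measure R).

(* Glue the part of A left of a and the part of B right of b at (a + b) / 2. *)
Lemma brunn_minkowski_cut (A B C : set R) (a b : R) :
  measurable A -> measurable B -> measurable C -> A a -> B b ->
  (forall x y, A x -> B y -> C ((x + y) / 2)) ->
  (mu (A `&` `]-oo, a]) + mu (B `&` `[b, +oo[) <= 2%:E * mu C)%E.
Proof.
move=> mA mB mC Aa Bb ABC.
have mA' : measurable (A `&` `]-oo, a]) by exact: measurableI.
have mB' : measurable (B `&` `[b, +oo[) by exact: measurableI.
have mB'' : measurable (B `&` `]b, +oo[) by exact: measurableI.
have mb : measurable (B `&` [set b]) by exact: measurableI.
have mb0 : mu (B `&` [set b]) = 0%E.
  apply/eqP; rewrite -measure_le0 -(lebesgue_measure_set1 b).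
  by apply: le_measure_subset.
(* The point [b] is dropped so that the two rescaled pieces, which meet at (a + b) / 2, become
   disjoint. *)
have -> : mu (B `&` `[b, +oo[) = mu (B `&` `]b, +oo[).
  rewrite -(@setU1itv _ _ _ b false)// setIUr measureU//; first by rewrite -[RHS]add0e -mb0.
  apply/seteqP; split => // x /= [[_ ->] [_]].
  by rewrite ?in_itv/= ltxx.
rewrite (@lebesgue_measure_affine _ 2 (- b) _ _ mA')//.
rewrite (@lebesgue_measure_affine _ 2 (- a) _ _ mB'')//.
set A1 := (X in (_ * mu X + _)%E); set B1 := (X in (_ + _ * mu X)%E).
have mf (c : R) : measurable_fun setT (fun x : measurableTypeR R => 2 * x - c).
  by apply: measurable_funD => //; exact: measurable_funM.
have mA1 : measurable A1 by rewrite -[A1]setTI; apply: (mf b).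
have mB1 : measurable B1 by rewrite -[B1]setTI; apply: (mf a).
rewrite -ge0_muleDr// -measureU//; last first.
  apply/seteqP; split => // x /= [[_ +] [_ +]].
  rewrite /= !in_itv/= andbT; lra.
rewrite lee_pmul2l//; apply: le_measure_subset => //.
  exact: measurableU.
move=> x [[/= Ax _]|[/= Bx _]].
  by have := ABC _ _ Ax Bb; rewrite subrK mulrAC divff// mul1r.
by have := ABC _ _ Aa Bx; rewrite addrC subrK mulrAC divff// mul1r.
Qed.

(** The cut inequality needs an endpoint in [A], so only rays ending at points of [A] are available.
    They still exhaust [A], through the maximum if there is one, through the integers if [A] is
    unbounded above, and through sup A - 1 / (n + 1) otherwise. *)
Lemma lebesgue_measure_ray_ub (A : set R) (M : \bar R) :
  measurable A -> A !=set0 ->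
  (forall a, A a -> (mu (A `&` `]-oo, a]) <= M)%E) -> (mu A <= M)%E.
Proof.
move=> mA [a0 Aa0] AM.
have exhaust (c : R^nat) : {homo c : m n / (m <= n)%N >-> m <= n} ->
    (forall n, exists2 a, A a & c n <= a) ->
    (forall x, A x -> exists n, x <= c n) -> (mu A <= M)%E.
  move=> c_nd cA Ac.
  have mAc n : measurable (A `&` `]-oo, c n]) by exact: measurableI.
  have Acup : \bigcup_n (A `&` `]-oo, c n]) = A.
    apply/seteqP; split => [x [n _ []]//|x Ax].
    by have [n xn] := Ac x Ax; exists n => //; split => //=; rewrite ?in_itv/=.
  have Acvg : (mu \o (fun n => A `&` `]-oo, c n])) @ \oo --> mu A.
    rewrite -[X in _ --> mu X]Acup; apply: nondecreasing_cvg_mu => //.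
      by rewrite Acup.
    move=> m n mn; rewrite subsetEset => x [Ax /=]; rewrite ?in_itv/= => xm.
    by split => //=; rewrite ?in_itv/= (le_trans xm)// c_nd.
  rewrite -(cvg_lim _ Acvg)//; apply: lime_le; first by apply/cvg_ex; exists (mu A).
  apply: nearW => n /=; have [a Aa ca] := cA n.
  apply: le_trans (AM a Aa); apply: le_measure_subset => //; first exact: measurableI.
    exact: measurableI.
  move=> x [Ax /=]; rewrite ?in_itv/= => xc; split => //=.
  by rewrite ?in_itv/= (le_trans xc).
have [[m Am mmax]|nomax] := pselect (exists2 m, A m & forall x, A x -> x <= m).
  by apply: (exhaust (fun=> m)) => // [n|x Ax]; [exists m|exists 0%N; exact: mmax].
have [Aub|Aub] := pselect (has_ubound A); last first.
  apply: (exhaust (fun n => n%:R)) => [m n|n|x Ax].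
  - by rewrite ler_nat.
  - apply: contrapT => H; apply: Aub; exists n%:R => x Ax.
    by rewrite leNgt; apply/negP => nx; apply: H; exists x => //; exact: ltW.
  - by exists (Num.bound `|x|); rewrite ltW// (le_lt_trans (ler_norm x))// archi_boundP.
have supA : has_sup A by split => //; exists a0.
apply: (exhaust (fun n => sup A - n.+1%:R^-1)) => [m n mn|n|x Ax].
- by rewrite lerB// lef_pV2 ?posrE// ler_nat.
- have [||a Aa] := @sup_adherent _ A n.+1%:R^-1 => //.
  by move=> ?; exists a => //; exact: ltW.
- have xS : x < sup A.
    rewrite lt_neqAle ub_le_sup// andbT; apply/negP => /eqP xS.
    by apply: nomax; exists x => // y Ay; rewrite xS ub_le_sup.
  have d0 : 0 < sup A - x by rewrite subr_gt0.
  exists (Num.bound (sup A - x)^-1); rewrite lerBrDl -lerBrDr.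
  rewrite invf_ple ?posrE//.
  have /ltW : (sup A - x)^-1 < (Num.bound (sup A - x)^-1)%:R.
    by rewrite archi_boundP// invr_ge0 ltW.
  by move=> /le_trans; apply; rewrite ler_nat.
Qed.

Lemma lebesgue_measure_ray_lb (A : set R) (M : \bar R) :
  measurable A -> A !=set0 ->
  (forall a, A a -> (mu (A `&` `[a, +oo[) <= M)%E) -> (mu A <= M)%E.
Proof.
move=> mA [a0 Aa0] AM; rewrite -lebesgue_measureN//.
have mN (B : set R) : measurable B -> measurable (-%R @^-1` B).
  by move=> mB; rewrite -[X in measurable X]setTI; exact: oppr_measurable.
apply: (@lebesgue_measure_ray_ub (-%R @^-1` A)); first exact: mN.
  by exists (- a0); rewrite /= opprK.
move=> a /= Aa; apply: le_trans (AM _ Aa).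
rewrite -(@lebesgue_measureN _ (A `&` _)); last exact: measurableI.
apply: le_measure_subset.
- by apply: measurableI => //; exact: mN.
- by apply: mN; exact: measurableI.
- by move=> x [/= Ax]; rewrite ?in_itv/= andbT lerN2.
Qed.

(** The cut point in [A] and then the one in [B] are pushed to the ends of the sets. If mu C is
    finite, every term on the left is finite and can be moved across. *)
Lemma brunn_minkowski1 (A B C : set R) :
  measurable A -> measurable B -> measurable C -> A !=set0 -> B !=set0 ->
  (forall x y, A x -> B y -> C ((x + y) / 2)) ->
  (mu A + mu B <= 2%:E * mu C)%E.
Proof.
move=> mA mB mC A0 B0 ABC.
have [CE|Cfin] := eqVneq (mu C) +oo%E.
  by rewrite CE gt0_muley ?leey// lte_fin.
have fC : (2%:E * mu C)%E \is a fin_num.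
  by rewrite fin_numM// ge0_fin_numE// ltey.
have le_cut a b : A a -> B b -> _ := fun Aa Bb =>
  @brunn_minkowski_cut A B C a b mA mB mC Aa Bb ABC.
have fincut (x y : \bar R) : (0 <= x)%E -> (0 <= y)%E -> (x + y <= 2%:E * mu C)%E ->
    x \is a fin_num.
  move=> x0 y0 xyC; rewrite ge0_fin_numE//.
  by apply: (@le_lt_trans _ _ (x + y)%E); rewrite ?leeDl// (le_lt_trans xyC)// ltey_eq fC.
have muA : forall b, B b -> (mu A + mu (B `&` `[b, +oo[) <= 2%:E * mu C)%E.
  move=> b Bb; have [a Aa] := A0.
  have finB : mu (B `&` `[b, +oo[) \is a fin_num.
    by have := le_cut a b Aa Bb; rewrite addeC; apply: fincut.
  rewrite -leeBrDr//; apply: lebesgue_measure_ray_ub => // a' Aa'.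
  by rewrite leeBrDr//; exact: le_cut.
have [b Bb] := B0.
have finA : mu A \is a fin_num by have := muA b Bb; apply: fincut.
rewrite addeC -leeBrDr//; apply: lebesgue_measure_ray_lb => // b' Bb'.
by rewrite leeBrDr// addeC; exact: muA.
Qed.

End brunn_minkowski.

Section prekopa_leindler_dim1.
Context {R : realType}.
Notation mu := (@lebesgue_measure R).

Lemma measurable_superlevel {d} {T : measurableType d} (u : T -> R) (t : R) :
  measurable_fun setT u -> measurable [set x | t < u x].
Proof.
move=> mu_; rewrite -[X in measurable X]setTI.
have := mu_ measurableT `]t, +oo[%classic (measurable_itv _).
by rewrite preimage_itvoy.
Qed.

Lemma measurable_indic_subgraph (u : R -> R) : measurable_fun setT u ->
  measurable [set z : R * R | z.2 < u z.1].
Proof.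
move=> mu_.
have mg : measurable_fun setT (fun z : R * R => u z.1 - z.2).
  by apply: measurable_funB => //; exact: measurableT_comp.
have -> : [set z : R * R | z.2 < u z.1] = [set z | 0 < u z.1 - z.2].
  by apply/seteqP; split => z /=; rewrite subr_gt0.
exact: measurable_superlevel mg.
Qed.

(** Tonelli's theorem for the indicator of the region under the graph. *)
Lemma layer_cake (u : R -> R) : measurable_fun setT u -> (forall x, 0 <= u x) ->
  (\int[mu]_x (u x)%:E = \int[mu]_(t in `[0%R, +oo[) mu [set x | (t < u x)%R])%E.
Proof.
move=> mu_ u0.
pose D : set R := `[0, +oo[%classic.
pose S := [set z : R * R | z.2 < u z.1] `&` (setT `*` D).
have mS : measurable S.
  apply: measurableI; [exact: measurable_indic_subgraph|]. apply: measurableX => //; exact: measurable_itv.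
have mf : measurable_fun setT (fun z : R * R => (\1_S z)%:E : \bar R).
  by apply/measurable_EFinP; exact: measurable_indic.
have f0 (z : R * R) : (0 <= (\1_S z)%:E :> \bar R)%E by rewrite lee_fin.
have : (\int[mu]_x \int[mu]_y (\1_S (x, y))%:E = \int[mu]_y \int[mu]_x (\1_S (x, y))%:E)%E.
  exact: (@fubini_tonelli _ _ _ _ R mu mu (fun z => (\1_S z)%:E) mf f0).
have -> : (\int[mu]_x \int[mu]_y (\1_S (x, y))%:E = \int[mu]_x (u x)%:E)%E.
  apply: eq_integral => x _.
  have -> : (fun y => (\1_S (x, y))%:E : \bar R) = (fun y => (\1_(`[0, u x[%classic) y)%:E).
    apply/funext => y; congr EFin; rewrite !indicE; congr ((nat_of_bool _)%:R).
    apply/idP/idP; rewrite !inE /S /D /= !in_itv/= andbT.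
      by move=> [-> [_ ->]].
    by move=> /andP[-> ->].
  rewrite integral_indic//= setIT lebesgue_measure_itv/= lte_fin.
  by case: ltP (u0 x) => // [_ _|]; rewrite ?oppr0 ?adde0// => H1 H2; congr EFin; apply/eqP; rewrite eq_le H1 H2.
move=> ->.
transitivity (\int[mu]_t (((fun t => mu [set x | (t < u x)%R]) \_ D) t))%E; last by rewrite [RHS]integral_mkcond.
refine (@eq_integral _ _ R mu setT _ _ _) => t _.
rewrite patchE; case: ifPn => tD.
  rewrite -[in RHS](setIT [set x | t < u x]) -integral_indic//; last exact: measurable_superlevel.
  refine (@eq_integral _ _ R mu setT _ _ _) => x _; rewrite !indicE; congr ((nat_of_bool _)%:R%:E).
  apply/idP/idP; rewrite !inE /S /=; first by case.
  by move=> H; split => //; split => //; move: tD; rewrite inE.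
transitivity (0 : \bar R)%E => //.
apply: integral0_eq => x _; rewrite indicE memNset//= => -[_ [_ /= Dt]].
by move: tD; rewrite notin_setE; apply.
Qed.

Lemma measurable_measure_superlevel (u : R -> R) : measurable_fun setT u ->
  measurable_fun setT (fun t : R => mu [set x | t < u x]).
Proof.
move=> mu_.
pose S := [set z : R * R | z.2 < u z.1].
have mS : measurable S by exact: measurable_indic_subgraph.
have mf : measurable_fun setT (fun z : R * R => (\1_S z)%:E : \bar R).
  by apply/measurable_EFinP; exact: measurable_indic.
have f0 (z : R * R) : (0 <= (\1_S z)%:E :> \bar R)%E by rewrite lee_fin.
have := @measurable_fun_fubini_tonelli_G _ _ _ _ R mu (fun z => (\1_S z)%:E) mf f0.
congr (measurable_fun _ _); apply/funext => t; rewrite /fubini_G.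
rewrite -[RHS]/(mu [set x | t < u x]) -(setIT [set x | t < u x]) -integral_indic//; last exact: measurable_superlevel.
Qed.

(** Since both suprema are 1, the level sets of [u] and [v] are nonempty at each t < 1, and their
    midpoints lie in the level set of [w]. Brunn-Minkowski is integrated over t; levels t >= 1
    contribute nothing on the left. *)
Lemma prekopa_leindler_normalized (u v w : R -> R) :
  measurable_fun setT u -> measurable_fun setT v -> measurable_fun setT w ->
  (forall x, 0 <= u x <= 1) -> (forall x, 0 <= v x <= 1) -> (forall x, 0 <= w x) ->
  (forall t, t < 1 -> exists x, t < u x) -> (forall t, t < 1 -> exists x, t < v x) ->
  (forall x y, u x * v y <= w ((x + y) / 2) ^+ 2) ->
  (\int[mu]_x (u x)%:E + \int[mu]_x (v x)%:E <= 2%:E * \int[mu]_x (w x)%:E)%E.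
Proof.
move=> mu_ mv mw u01 v01 w0 us vs uvw.
have u0 x : 0 <= u x by have /andP[] := u01 x.
have v0 x : 0 <= v x by have /andP[] := v01 x.
have mT (h : R -> R) : measurable_fun setT h ->
    measurable_fun (`[0, +oo[%classic : set R) (fun t => mu [set x | t < h x]).
  by move=> mh; apply: measurable_funTS; exact: measurable_measure_superlevel.
rewrite !layer_cake// -ge0_integralZl//; [|exact: mT].
rewrite -ge0_integralD//; [|exact: mT|exact: mT].
apply: ge0_le_integral => //.
- by move=> x _; rewrite adde_ge0.
- exact: (emeasurable_funD (mT _ mu_) (mT _ mv)).
- exact: (measurable_funeM 2%:E (mT _ mw)).
move=> t; rewrite /= in_itv/= andbT => t0.
have [t1|t1] := ltP t 1; last first.
  have E (h : R -> R) : (forall x, 0 <= h x <= 1) -> [set x | t < h x] = set0.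
    move=> h01; apply/seteqP; split => // x /= tx.
    by have /andP[_ h1] := h01 x; move: (lt_le_trans tx h1); rewrite ltNge t1.
  by rewrite (E u)// (E v)// measure0 adde0 mule_ge0.
apply: brunn_minkowski1; try exact: measurable_superlevel.
- by have [x] := us t t1; exists x.
- by have [x] := vs t t1; exists x.
move=> x y /= tx ty.
have : t ^+ 2 < w ((x + y) / 2) ^+ 2.
  by apply: lt_le_trans (uvw x y); rewrite expr2; exact: ltr_pM.
by rewrite ltr_pXn2r// nnegrE.
Qed.

(** Dividing [u], [v], [w] by their scales a, b and sqrt(a b), with a and b the suprema, preserves
    the midpoint hypothesis. The arithmetic inequality p + q <= 2 r for the normalized integrals
    then gives p q <= r^2. *)
Lemma prekopa_leindler_bounded (u v w : R -> R) (K : R) :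
  measurable_fun setT u -> measurable_fun setT v -> measurable_fun setT w ->
  (forall x, 0 <= u x <= K) -> (forall x, 0 <= v x <= K) -> (forall x, 0 <= w x) ->
  (forall x y, u x * v y <= w ((x + y) / 2) ^+ 2) ->
  (\int[mu]_x (u x)%:E * \int[mu]_x (v x)%:E <=
   \int[mu]_x (w x)%:E * \int[mu]_x (w x)%:E)%E.
Proof.
move=> mu_ mv mw uK vK w0 uvw.
have I0 (h : R -> R) : (forall x, 0 <= h x) -> (0 <= \int[mu]_x (h x)%:E)%E.
  by move=> h0; apply: integral_ge0 => x _; rewrite lee_fin.
have supP (h : R -> R) : (forall x, 0 <= h x <= K) ->
    (\int[mu]_x (h x)%:E = 0)%E \/
    exists2 s, 0 < s & (forall x, h x <= s) /\ (forall t, t < s -> exists x, t < h x).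
  move=> hK.
  have [hpos|hz] := pselect (exists x, 0 < h x); last first.
    left; apply: integral0_eq => x _; congr EFin.
    have /andP[h0 _] := hK x; apply/eqP; rewrite eq_le h0 andbT leNgt.
    by apply/negP => ?; apply: hz; exists x.
  right; have [x0 hx0] := hpos.
  have hs : has_sup (range h).
    by split; [exists (h x0), x0|exists K => _ [x _ <-]; have /andP[] := hK x].
  have hle x : h x <= sup (range h) by apply: ub_le_sup; [exact: hs.2|exists x].
  exists (sup (range h)); first exact: lt_le_trans (hle x0).
  split => // t ts; have [|_ [x _ <-]] := @sup_adherent _ (range h) (sup (range h) - t) _ hs.
    by rewrite subr_gt0.
  by rewrite subKr => ?; exists x.
have u0 x : 0 <= u x by have /andP[] := uK x.
have v0 x : 0 <= v x by have /andP[] := vK x.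
have [->|[a a0 [ua us]]] := supP u uK; first by rewrite mul0e mule_ge0// I0.
have [->|[b b0 [vb vs]]] := supP v vK; first by rewrite mule0 mule_ge0// I0.
pose c := Num.sqrt (a * b).
have c0 : 0 < c by rewrite sqrtr_gt0 mulr_gt0.
have c2 : c ^+ 2 = a * b by rewrite sqr_sqrtr// mulr_ge0// ltW.
have sc (h : R -> R) (d : R) : measurable_fun setT h -> (forall x, 0 <= h x) -> 0 < d ->
    (\int[mu]_x (d^-1 * h x)%:E = d^-1%:E * \int[mu]_x (h x)%:E)%E.
  move=> mh h0 d0; under eq_integral do rewrite EFinM.
  rewrite ge0_integralZl//; first exact/measurable_EFinP.
    by move=> x _; rewrite lee_fin.
  by rewrite lee_fin invr_ge0 ltW.
have mZ (h : R -> R) (d : R) : measurable_fun setT h -> measurable_fun setT (fun x => d * h x).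
  by move=> mh; exact: measurable_funM.
have in01 (h : R -> R) (d : R) : (forall x, 0 <= h x) -> 0 < d -> (forall x, h x <= d) ->
    forall x, 0 <= d^-1 * h x <= 1.
  move=> h0 d0 hd x; apply/andP; split; last by rewrite ler_pdivrMl// mulr1.
  by rewrite mulr_ge0// invr_ge0 ltW.
have near1 (h : R -> R) (d : R) : 0 < d -> (forall t, t < d -> exists x, t < h x) ->
    forall t, t < 1 -> exists x, t < d^-1 * h x.
  move=> d0 hd t t1; have [|x] := hd (d * t); first by rewrite gtr_pMr.
  by move=> dx; exists x; rewrite ltr_pdivlMl.
have uvw' x y : a^-1 * u x * (b^-1 * v y) <= (c^-1 * w ((x + y) / 2)) ^+ 2.
  rewrite exprMn exprVn c2 invfM mulrACA ler_wpM2l ?uvw//.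
  by rewrite mulr_ge0 ?invr_ge0// ltW.
have w0' x : 0 <= c^-1 * w x by rewrite mulr_ge0// invr_ge0 ltW.
have := @prekopa_leindler_normalized (fun x => a^-1 * u x) (fun x => b^-1 * v x) (fun x => c^-1 * w x)
  (mZ _ _ mu_) (mZ _ _ mv) (mZ _ _ mw) (in01 _ _ u0 a0 ua) (in01 _ _ v0 b0 vb) w0'
  (near1 _ _ a0 us) (near1 _ _ b0 vs) uvw'.
rewrite !sc//.
move: (I0 u u0) (I0 v v0) (I0 w w0).
move: (\int[mu]_x (u x)%:E)%E (\int[mu]_x (v x)%:E)%E (\int[mu]_x (w x)%:E)%E => U V W U0 V0 W0.
case: W W0 => [W| |] // W0; last by rewrite mulyy leey.
have vfin : (V < +oo)%E \/ (V = +oo)%E by case: V V0 => [r| |] // _; [left; rewrite ltry|right].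
case: U U0 => [U| |] // U0; case: V V0 vfin => [V| |] // V0 _.
- rewrite -!EFinM -EFinD !lee_fin => H.
  rewrite !lee_fin in U0 V0 W0.
  have p0 : 0 <= a^-1 * U by rewrite mulr_ge0// invr_ge0 ltW.
  have q0 : 0 <= b^-1 * V by rewrite mulr_ge0// invr_ge0 ltW.
  have H2 : (a^-1 * U) * (b^-1 * V) <= (c^-1 * W) ^+ 2.
    move: p0 q0 H; move: (a^-1 * U) (b^-1 * V) (c^-1 * W) => p q r p0 q0 H.
    have : (p + q) ^+ 2 <= (2 * r) ^+ 2 by rewrite ler_pXn2r// nnegrE ?addr_ge0//; lra.
    have := sqr_ge0 (p - q); rewrite !expr2; nra.
  have : (a * b) * ((a^-1 * U) * (b^-1 * V)) <= (a * b) * ((c^-1 * W) ^+ 2).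
    by rewrite ler_pM2l// mulr_gt0.
  rewrite exprMn exprVn c2 mulVKf ?gt_eqF ?mulr_gt0// expr2.
  by rewrite mulrACA mulVKf ?gt_eqF// mulVKf ?gt_eqF.
- by rewrite -EFinM [(_ * +oo)%E]gt0_muley ?lte_fin ?invr_gt0// addey// leye_eq.
- by rewrite -EFinM [(_ * +oo)%E]gt0_muley ?lte_fin ?invr_gt0// addye// leye_eq.
- by rewrite -EFinM !gt0_muley ?lte_fin ?invr_gt0// addye// leye_eq.
Qed.

End prekopa_leindler_dim1.

Section prekopa_leindler_dim1_ereal.
Context {R : realType}.
Notation mu := (@lebesgue_measure R).
Local Open Scope ereal_scope.

(** Truncation preserves the midpoint hypothesis: if c >= N both factors on the left are at most N,
    and otherwise c is left unchanged. *)
Lemma mine_mule_le (a b c N : \bar R) : 0 <= a -> 0 <= b -> 0 <= c -> 0 <= N ->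
  a * b <= c * c -> mine a N * mine b N <= mine c N * mine c N.
Proof.
move=> a0 b0 c0 N0 abc.
have aN : 0 <= mine a N by rewrite le_min a0.
have bN : 0 <= mine b N by rewrite le_min b0.
have [Nc|cN] := leP N c.
  by apply: lee_pmul => //; rewrite ge_min lexx orbT.
by apply: le_trans abc; apply: lee_pmul => //; rewrite ge_min lexx.
Qed.

Lemma cvg_mine_nat (e : \bar R) : mine e n%:R%:E @[n --> \oo] --> e.
Proof.
case: e => [r| |].
- apply: cvg_near_cst.
  near=> n; apply/min_idPl; rewrite lee_fin.
  near: n; exact: nbhs_infty_ger.
- under eq_fun do rewrite minye.
  exact/cvgeryP/cvgr_idn.
- by under eq_fun do rewrite minNye; exact: cvg_cst.
Unshelve. all: by end_near. Qed.

(** Extended values are needed because, in higher dimension, the integral of a section may be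
    infinite. Truncations at height n reduce to the bounded case, and monotone convergence removes
    them. *)
Lemma prekopa_leindler1 (u v w : R -> \bar R) :
  measurable_fun setT u -> measurable_fun setT v -> measurable_fun setT w ->
  (forall x, 0 <= u x) -> (forall x, 0 <= v x) -> (forall x, 0 <= w x) ->
  (forall x y, u x * v y <= w ((x + y) / 2)%R * w ((x + y) / 2)%R) ->
  \int[mu]_x u x * \int[mu]_x v x <= \int[mu]_x w x * \int[mu]_x w x.
Proof.
move=> mu_ mv mw u0 v0 w0 uvw.
pose tr (h : R -> \bar R) (n : nat) (x : R) := fine (mine (h x) n%:R%:E).
have trE (h : R -> \bar R) n x : (0 <= h x) -> (tr h n x)%:E = mine (h x) n%:R%:E.
  move=> h0; rewrite /tr fineK// ge0_fin_numE ?le_min ?h0 ?lee_fin ?ler0n//.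
  by apply: (@le_lt_trans _ _ n%:R%:E); rewrite ?ltry// ge_min lexx orbT.
have tr0 : forall g n x, 0 <= g x -> (0 <= tr g n x <= n%:R)%R.
  by move=> g n x g0; rewrite -!lee_fin trE// le_min g0 lee_fin ler0n ge_min lexx orbT.
have mtr (h : R -> \bar R) n : measurable_fun setT h -> measurable_fun setT (tr h n).
  move=> mh; apply: (measurableT_comp (fine_measurable measurableT)).
  exact: measurable_mine.
have mtrE : forall h n, measurable_fun setT h -> measurable_fun setT (fun x => (tr h n x)%:E).
  by move=> h n mh; apply/measurable_EFinP; exact: mtr.
have cvtr (h : R -> \bar R) : measurable_fun setT h -> (forall x, 0 <= h x) ->
    \int[mu]_x (tr h n x)%:E @[n --> \oo] --> \int[mu]_x h x.
  move=> mh h0.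
  have -> : \int[mu]_x h x = \int[mu]_x (limn (fun n => (tr h n x)%:E)).
    apply: eq_integral => x _; apply/esym/cvg_lim => //.
    by under eq_fun do rewrite trE//; exact: cvg_mine_nat.
  apply: cvg_monotone_convergence => //.
  - by move=> n; apply/measurable_EFinP; exact: mtr.
  - by move=> n x _; rewrite lee_fin; have /andP[] := tr0 h n x (h0 x).
  - move=> x _ m n mn; rewrite !trE// le_min !ge_min lexx/=.
    by rewrite lee_fin ler_nat mn orbT.
have key n : \int[mu]_x (tr u n x)%:E * \int[mu]_x (tr v n x)%:E <=
    \int[mu]_x (tr w n x)%:E * \int[mu]_x (tr w n x)%:E.
  apply: (@prekopa_leindler_bounded _ _ _ _ n%:R (mtr _ _ mu_) (mtr _ _ mv) (mtr _ _ mw)).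
  - by move=> x; apply: tr0.
  - by move=> x; apply: tr0.
  - by move=> x; have /andP[] := tr0 w n x (w0 x).
  - move=> x y; rewrite -lee_fin expr2 !EFinM !trE//.
    exact: mine_mule_le.
have I0 (h : R -> \bar R) : (forall x, 0 <= h x) -> 0 <= \int[mu]_x h x.
  by move=> h0; apply: integral_ge0.
(* Zero integrals are set apart, since multiplication is not continuous at 0 times infinity. *)
have [->|U0] := eqVneq (\int[mu]_x u x) 0; first by rewrite mul0e mule_ge0// I0.
have [->|V0] := eqVneq (\int[mu]_x v x) 0; first by rewrite mule0 mule_ge0// I0.
have le_w n : \int[mu]_x (tr w n x)%:E <= \int[mu]_x w x.
  apply: ge0_le_integral => //.
  - by move=> x _; rewrite lee_fin; have /andP[] := tr0 w n x (w0 x).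
  - exact: (mtrE _ _ mw).
  - by move=> x _; rewrite trE// ge_min lexx.
have md : (\int[mu]_x u x) *? (\int[mu]_x v x).
  move: (I0 u u0) (I0 v v0) U0 V0.
  by case: (\int[mu]_x u x) => [?| |]; case: (\int[mu]_x v x) => [?| |].
have cv : \int[mu]_x (tr u n x)%:E * \int[mu]_x (tr v n x)%:E @[n --> \oo] -->
    (\int[mu]_x u x) * (\int[mu]_x v x) by apply: cvgeM => //; exact: cvtr.
rewrite -(cvg_lim _ cv)//.
apply: lime_le; first by apply/cvg_ex; eexists; apply: cv.
apply: nearW => n; apply: le_trans (key n) _; apply: lee_pmul => //;
  apply: I0 => x; rewrite lee_fin; have /andP[] := tr0 w n x (w0 x) => //.
Qed.

End prekopa_leindler_dim1_ereal.

Section sigma_finite_copy.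
Context {d : measure_display} {T : measurableType d} {R : realType}
  (m : {measure set T -> \bar R}) (H : sigma_finite setT m).

(** An alias of [m] indexed by the proof of sigma-finiteness, to which the corresponding structure
    can be attached. *)
Definition sigma_finite_copy of sigma_finite setT m := (m : set T -> \bar R).
HB.instance Definition _ := Measure.copy (sigma_finite_copy H) m.
HB.instance Definition _ :=
  Measure_isSigmaFinite.Build _ _ _ (sigma_finite_copy H) H.

End sigma_finite_copy.

Lemma sigma_finite_product d1 d2 (T1 : measurableType d1) (T2 : measurableType d2)
    (R : realType) (m1 : {sigma_finite_measure set T1 -> \bar R})
    (m2 : {sigma_finite_measure set T2 -> \bar R}) :
  sigma_finite setT (m1 \x m2)%E.
Proof.
have /sigma_finiteP[F [TF ndF Foo]] := sigma_finiteT m1.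
have /sigma_finiteP[G [TG ndG Goo]] := sigma_finiteT m2.
exists (fun n => F n `*` G n).
  apply/seteqP; split => // -[x y] _.
  have : setT x by []. have : setT y by [].
  rewrite TF TG => -[k _ Gk] [n _ Fn]; exists (maxn n k) => //; split => /=.
    by move: x Fn; apply/subsetPset/ndF/leq_maxl.
  by move: y Gk; apply/subsetPset/ndG/leq_maxr.
move=> k; have [? ?] := Foo k; have [? ?] := Goo k.
split; first exact: measurableX.
by rewrite product_measure1E// lte_mul_pinfty// ge0_fin_numE.
Qed.

Section iterated_integral.
Context {R : realType}.

Lemma measurable_tuple_cons n :
  measurable_fun setT (fun z : R * n.-tuple R => [tuple of z.1 :: z.2]).
Proof. exact: (@measurable_cons _ _ _ _ fst n snd). Qed.

Lemma measurable_tuple_split n :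
  measurable_fun setT (fun t : n.+1.-tuple R => (thead t, [tuple of behead t])).
Proof.
apply/measurable_fun_pair; last exact: measurable_behead.
exact: measurable_tnth.
Qed.

Lemma measurable_section_cons n (f : n.+1.-tuple R -> \bar R) (x : R) :
  measurable_fun setT f -> measurable_fun setT (fun t : n.-tuple R => f [tuple of x :: t]).
Proof.
move=> mf; apply: (measurableT_comp mf).
by apply: (@measurable_cons _ _ _ _ (cst x) n id).
Qed.

(** Turns the iterated integral into an integral against one measure, so that linearity, Tonelli and
    densities become available. The inductive step pushes the product with Lebesgue measure forward
    along [cons]; sigma-finiteness is carried along because Tonelli requires it. *)
Lemma iint_measure n : exists mu : {sigma_finite_measure set (n.-tuple R) -> \bar R},
  forall f : n.-tuple R -> \bar R, measurable_fun setT f -> (forall x, (0 <= f x)%E) ->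
    (\int[mu]_x f x)%E = iint f.
Proof.
elim: n => [|n [mu IH]].
  exists (\d_([tuple] : 0.-tuple R)) => f mf f0.
  by rewrite integral_dirac// diracT mul1e.
pose phi (z : measurableTypeR R * n.-tuple R) : n.+1.-tuple R := [tuple of z.1 :: z.2].
have mphi : measurable_fun setT phi by exact: measurable_tuple_cons.
pose psi (t : n.+1.-tuple R) : measurableTypeR R * n.-tuple R := (thead t, [tuple of behead t]).
have mpsi : measurable_fun setT psi by exact: measurable_tuple_split.
have phiK : cancel phi psi.
  by move=> [x t]; rewrite /psi /phi/= theadE; congr pair; apply: val_inj.
pose pm : {measure set (measurableTypeR R * n.-tuple R)%type -> \bar R} :=
  lebesgue_integral_fubini_product_measure1__canonical__measure_function_Measure (@lebesgue_measure R) mu.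
pose m : {measure set (n.+1.-tuple R) -> \bar R} :=
  measure_function_pushforward__canonical__measure_function_Measure pm mphi.
have sfm : sigma_finite setT m.
  have [F FT F_fin] := @sigma_finite_product _ _ _ _ _ (@lebesgue_measure R) mu.
  exists (fun i => psi @^-1` F i).
    by apply/seteqP; split => // t _; have : setT (psi t) by []; rewrite FT => -[i _ Fi]; exists i.
  move=> i; have [mF Foo] := F_fin i; split.
    by rewrite -[X in measurable X]setTI; exact: mpsi.
  rewrite /m/= /pushforward; congr (_ < _)%E: Foo; congr (pm _).
  by apply/seteqP; split => z /=; rewrite phiK.
exists (sigma_finite_copy m sfm) => f mf f0.
transitivity (\int[pushforward pm phi]_y f y)%E; first by [].
rewrite ge0_integral_pushforward//.
rewrite preimage_setT.
have mfphi : measurable_fun setT (f \o phi) by exact: measurableT_comp.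
rewrite (fubini_tonelli1 _ mfphi)//=.
apply: eq_integral => x _; rewrite /fubini_F -IH//.
exact: measurable_section_cons.
Qed.

Definition lebn n := projT1 (cid (iint_measure n)).

Lemma iintE n (f : n.-tuple R -> \bar R) : measurable_fun setT f ->
  (forall x, (0 <= f x)%E) -> iint f = (\int[lebn n]_x f x)%E.
Proof. by move=> mf f0; rewrite /lebn; case: cid => mu /= ->. Qed.

Lemma measurable_iint_cons n (f : n.+1.-tuple R -> \bar R) : measurable_fun setT f ->
  (forall x, (0 <= f x)%E) ->
  measurable_fun setT (fun x : R => iint (fun t => f [tuple of x :: t])).
Proof.
move=> mf f0.
have mfc : measurable_fun setT (fun z : R * n.-tuple R => f [tuple of z.1 :: z.2]).
  exact: (measurableT_comp mf (measurable_tuple_cons n)).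
have := @measurable_fun_fubini_tonelli_F _ _ _ _ _ (lebn n) _ mfc (fun z => f0 _).
congr (measurable_fun _ _); apply/funext => x; rewrite iintE//.
exact: measurable_section_cons.
Qed.

Lemma iint_ge0 n (f : n.-tuple R -> \bar R) : (forall x, (0 <= f x)%E) -> (0 <= iint f)%E.
Proof.
elim: n f => [|n IH] f f0 /=; first exact: f0.
by apply: integral_ge0 => x _; exact: IH.
Qed.

Definition tmid {n} (x y : n.-tuple R) : n.-tuple R :=
  [tuple (tnth x i + tnth y i) / 2 | i < n].

Lemma tmid_cons n (a b : R) (x y : n.-tuple R) :
  tmid [tuple of a :: x] [tuple of b :: y] = [tuple of (a + b) / 2 :: tmid x y].
Proof.
apply: eq_from_tnth => i; rewrite tnth_mktuple.
by case: (unliftP ord0 i) => [j ->|->]; rewrite ?tnthS ?tnth0 ?tnth_mktuple.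
Qed.

(** Tensorization: for fixed first coordinates x and y, the induction hypothesis for the sections at
    x, y and (x + y) / 2 is exactly the one-dimensional hypothesis for the inner integrals. *)
Theorem prekopa_leindler n (u v w : n.-tuple R -> \bar R) :
  measurable_fun setT u -> measurable_fun setT v -> measurable_fun setT w ->
  (forall x, 0 <= u x)%E -> (forall x, 0 <= v x)%E -> (forall x, 0 <= w x)%E ->
  (forall x y, u x * v y <= w (tmid x y) * w (tmid x y))%E ->
  (iint u * iint v <= iint w * iint w)%E.
Proof.
elim: n u v w => [|n IH] u v w mu mv mw u0 v0 w0 uvw /=.
  by have := uvw [tuple] [tuple]; rewrite (tuple0 (tmid _ _)).
apply: prekopa_leindler1; try exact: measurable_iint_cons; try by move=> x; exact: iint_ge0.
move=> x y; apply: IH => //; try exact: measurable_section_cons.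
by move=> s t; rewrite -tmid_cons.
Qed.

End iterated_integral.

(** * Isotropic log-concave probabilities *)

Section density.
Import HBNNSimple.
Context {d : measure_display} {T : measurableType d} {R : realType}
  (mu : {measure set T -> \bar R}) (f : T -> R)
  (mf : measurable_fun setT f) (f0 : forall x, 0 <= f x).
Local Open Scope ereal_scope.

Definition with_density of measurable_fun setT f & (forall x, (0 <= f x)%R) :=
  fun A : set T => \int[mu]_(x in A) (f x)%:E.
Local Notation nu := (with_density mf f0).

Let nu0 : nu set0 = 0. Proof. exact: integral_set0. Qed.

Let nu_ge0 A : 0 <= nu A.
Proof. by apply: integral_ge0 => x _; rewrite lee_fin. Qed.

Let nu_sigma_additive : semi_sigma_additive nu.
Proof.
move=> A mA tA mUA; rewrite /with_density ge0_integral_bigcup//.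
- by apply: is_cvg_ereal_nneg_natsum_cond => n _ _; exact: nu_ge0.
- by apply/measurable_EFinP; exact: measurable_funTS.
- by move=> x _; rewrite lee_fin.
Qed.

HB.instance Definition _ := isMeasure.Build _ _ _ nu nu0 nu_ge0 nu_sigma_additive.

Lemma integral_with_density (g : T -> \bar R) : measurable_fun setT g ->
  (forall x, 0 <= g x) -> \int[nu]_x g x = \int[mu]_x (g x * (f x)%:E).
Proof.
move=> mg g0; pose h := nnsfun_approx measurableT mg.
have gE x : g x = lim ((EFin \o h n) x @[n --> \oo]).
  by apply/esym/cvg_lim => //; exact: cvg_nnsfun_approx.
have mfE : measurable_fun setT (EFin \o f) by exact/measurable_EFinP.
have mh n : measurable_fun setT (EFin \o h n) by exact/measurable_EFinP.
have -> : \int[nu]_x g x = lim (\int[nu]_x (EFin \o h n) x @[n --> \oo]).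
  under eq_integral do rewrite gE.
  apply: monotone_convergence => //.
  - by move=> n x _; rewrite lee_fin.
  - by move=> x _ a b ab; rewrite lee_fin; exact/lefP/nd_nnsfun_approx.
have -> : \int[mu]_x (g x * (f x)%:E) =
    lim (\int[mu]_x ((EFin \o h n) x * (f x)%:E) @[n --> \oo]).
  have gfE x : g x * (f x)%:E = lim ((EFin \o h n) x * (f x)%:E @[n --> \oo]).
    apply/esym/cvg_lim => //; apply: cvgeZr => //.
    exact: cvg_nnsfun_approx.
  under eq_integral do rewrite gfE.
  apply: monotone_convergence => //.
  - by move=> n; exact: emeasurable_funM.
  - by move=> n x _; rewrite mule_ge0 ?lee_fin.
  - move=> x _ a b ab; rewrite lee_wpmul2r ?lee_fin//.
    exact/lefP/nd_nnsfun_approx.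
congr (lim (_ @ \oo)); apply/funext => n.
have mI r : measurable (h n @^-1` [set r]) by exact: measurable_sfunP.
have m1 r : measurable_fun setT (fun x => (r * \1_(h n @^-1` [set r]) x)%:E).
  by apply/measurable_EFinP; apply: measurable_funM => //; exact: measurable_indic.
transitivity (\int[nu]_x (\sum_(y \in range (h n)) (y * \1_(h n @^-1` [set y]) x)%:E)).
  by apply: eq_integral => t _; rewrite /= fimfunE -fsumEFin.
rewrite ge0_integral_fsum//; last by move=> r x _; exact: nnfun_muleindic_ge0.
transitivity (\int[mu]_x (\sum_(y \in range (h n)) ((y * \1_(h n @^-1` [set y]) x)%:E * (f x)%:E))); last first.
  apply: eq_integral => x _; rewrite -ge0_mule_fsuml; last first.
    by move=> r; exact: nnfun_muleindic_ge0.
  by rewrite fsumEFin// -fimfunE.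
rewrite ge0_integral_fsum//; last 2 first.
  - by move=> r; exact: emeasurable_funM.
  - by move=> r x _; rewrite mule_ge0 ?lee_fin// -lee_fin nnfun_muleindic_ge0.
apply: eq_fsbigr => r; rewrite inE => -[t _ <-].
have r0 : (0 <= h n t)%R by [].
move: (h n t) r0 => {t}r r0.
under eq_integral do rewrite EFinM.
rewrite ge0_integralZl//; last exact/measurable_EFinP/measurable_indic.
rewrite integral_indic// setIT.
under [RHS]eq_integral do rewrite EFinM -muleA.
rewrite ge0_integralZl//; last 2 first.
  - by apply: emeasurable_funM => //; exact/measurable_EFinP/measurable_indic.
  - by move=> x _; rewrite mule_ge0 ?lee_fin.
congr (_ * _); rewrite -[LHS]/(nu _) /with_density [LHS]integral_mkcond; apply: eq_integral => x _.
rewrite patchE indicE; case: ifPn => xA; first by rewrite mul1e.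
by rewrite mul0e.
Qed.

End density.

Lemma density_probability {d : measure_display} {T : measurableType d} {R : realType}
    (mu : {measure set T -> \bar R}) (f : T -> R) :
  measurable_fun setT f -> (forall x, 0 <= f x) -> (\int[mu]_x (f x)%:E = 1)%E ->
  exists P : probability T R, forall g, measurable_fun setT g -> (forall x, 0 <= g x)%E ->
    (\int[P]_x g x = \int[mu]_x (g x * (f x)%:E))%E.
Proof.
move=> mf f0 f1.
pose X := Measure_isProbability.Build _ _ _ (with_density mu f mf f0) f1.
pose P : probability T R := HB.pack (with_density mu f mf f0) X.
by exists P => g mg g0; exact: integral_with_density.
Qed.

Section expectation.
Context {d : measure_display} {T : measurableType d} {R : realType} (P : probability T R).
Implicit Types f g : T -> R.
Local Open Scope ereal_scope.

(** Extended-valued, so that linearity and monotonicity on nonnegative functions carry no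
    integrability condition. *)
Definition Ex f : \bar R := \int[P]_x (f x)%:E.

Lemma Ex_ge0 {f} : (forall x, (0 <= f x)%R) -> 0 <= Ex f.
Proof. by move=> f0; apply: integral_ge0 => x _; rewrite lee_fin. Qed.

Lemma Ex_le {f g} : measurable_fun setT f -> measurable_fun setT g ->
  (forall x, (0 <= f x)%R) -> (forall x, (f x <= g x)%R) -> Ex f <= Ex g.
Proof.
move=> mf mg f0 fg; apply: ge0_le_integral => //; try (by move=> x _; rewrite lee_fin);
exact/measurable_EFinP.
Qed.

Lemma ExD {f g} : measurable_fun setT f -> measurable_fun setT g ->
  (forall x, (0 <= f x)%R) -> (forall x, (0 <= g x)%R) ->
  Ex (fun x => f x + g x)%R = Ex f + Ex g.
Proof.
move=> mf mg f0 g0; rewrite -ge0_integralD//; try (by move=> x _; rewrite lee_fin);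
exact/measurable_EFinP.
Qed.

Lemma ExZ {k f} : measurable_fun setT f -> (forall x, (0 <= f x)%R) -> (0 <= k)%R ->
  Ex (fun x => k * f x)%R = k%:E * Ex f.
Proof.
move=> mf f0 k0; rewrite -ge0_integralZl//; try (by move=> x _; rewrite lee_fin);
exact/measurable_EFinP.
Qed.

Lemma Ex_cst k : Ex (cst k) = k%:E.
Proof. by rewrite -[LHS]/(\int[P]_x (cst k%:E x)) integral_cst//= probability_setT mule1. Qed.

Lemma Ex_sum {I : finType} {f : I -> T -> R} : (forall i, measurable_fun setT (f i)) ->
  (forall i x, (0 <= f i x)%R) -> Ex (fun x => \sum_(i : I) f i x)%R = \sum_(i : I) Ex (f i).
Proof.
move=> mf f0; rewrite -ge0_integral_sum//.
- by apply: eq_integral => x _; rewrite sumEFin.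
- by move=> i; exact/measurable_EFinP.
- by move=> i x _; rewrite lee_fin.
Qed.

Lemma Ex_indic {A} : measurable A -> Ex (\1_A) = P A.
Proof. by move=> mA; rewrite /Ex integral_indic// setIT. Qed.

End expectation.

Section isotropic_log_concave.
Context {R : realType}.

Definition dot {n} (v : 'I_n -> R) (x : n.-tuple R) : R := \sum_(i < n) v i * tnth x i.

Lemma measurable_tnth_prod n (i j : 'I_n) :
  measurable_fun setT (fun x : n.-tuple R => tnth x i * tnth x j).
Proof. by apply: measurable_funM; exact: measurable_tnth. Qed.

Lemma measurable_dot n (v : 'I_n -> R) : measurable_fun setT (dot v).
Proof.
rewrite /dot; apply: measurable_sum => i.
by apply: measurable_funM => //; exact: measurable_tnth.
Qed.

(* Measures obtained this way carry the Prekopa-Leindler inequality of their log-concave density. *)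
Definition log_concave_prob {n} (P : probability (n.-tuple R) R) :=
  forall u v w : n.-tuple R -> R,
    measurable_fun setT u -> measurable_fun setT v -> measurable_fun setT w ->
    (forall x, 0 <= u x) -> (forall x, 0 <= v x) -> (forall x, 0 <= w x) ->
    (forall x y, u x * v y <= w (tmid x y) ^+ 2) ->
    (Ex P u * Ex P v <= Ex P w * Ex P w)%E.

Definition isotropic_prob {n} (P : probability (n.-tuple R) R) :=
  forall v : 'I_n -> R, Ex P (fun x => dot v x ^+ 2) = (\sum_(i < n) v i ^+ 2)%:E.

(** Log-concavity at 1/2 reads f(x) f(y) <= f((x + y) / 2)^2, so multiplying [u], [v], [w] by [f]
    preserves the midpoint hypothesis. *)
Lemma log_concave_prob_density n (f : n.-tuple R -> R) (P : probability (n.-tuple R) R) :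
  measurable_fun setT f -> log_concave f ->
  (forall g : n.-tuple R -> R, measurable_fun setT g -> (forall x, 0 <= g x) ->
    Ex P g = iint (fun x => (g x * f x)%:E)) -> log_concave_prob P.
Proof.
move=> mf [f0 fc] EP u v w mu mv mw u0 v0 w0 uvw; rewrite !EP//.
have mM (h : n.-tuple R -> R) : measurable_fun setT h -> measurable_fun setT (fun x => (h x * f x)%:E).
  by move=> mh; apply/measurable_EFinP; exact: measurable_funM.
have ge0M (h : n.-tuple R -> R) : (forall x, 0 <= h x) -> forall x, (0 <= (h x * f x)%:E)%E.
  by move=> h0 x; rewrite lee_fin mulr_ge0.
apply: prekopa_leindler; try exact: mM; try exact: ge0M.
move=> x y; rewrite -!EFinM lee_fin.
have half : 0 < (2^-1 : R) < 1 by lra.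
have := fc x y 2^-1 half.
have -> : tconv 2^-1 x y = tmid x y.
  by apply: eq_from_tnth => i; rewrite !tnth_mktuple; lra.
have -> : 1 - 2^-1 = 2^-1 :> R by lra.
rewrite !powR12_sqrt// => fm.
have fxy : f x * f y <= f (tmid x y) ^+ 2.
  have : (Num.sqrt (f x) * Num.sqrt (f y)) ^+ 2 <= f (tmid x y) ^+ 2.
    by rewrite ler_pXn2r// nnegrE// mulr_ge0// sqrtr_ge0.
  by rewrite exprMn !sqr_sqrtr.
have -> : u x * f x * (v y * f y) = (u x * v y) * (f x * f y) by ring.
have -> : w (tmid x y) * f (tmid x y) * (w (tmid x y) * f (tmid x y)) =
   w (tmid x y) ^+ 2 * f (tmid x y) ^+ 2 by ring.
by apply: ler_pM => //; exact: mulr_ge0.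
Qed.

(** The covariance condition compares two extended integrals, which may be subtracted only once the
    negative part is finite. This follows from |x_i x_j| <= x_i^2 + x_j^2 and the diagonal case,
    where the negative part vanishes. *)
Lemma isotropic_prob_density n (f : n.-tuple R -> R) (P : probability (n.-tuple R) R) :
  isotropic_density f ->
  (forall g : n.-tuple R -> R, measurable_fun setT g -> (forall x, 0 <= g x) ->
    Ex P g = iint (fun x => (g x * f x)%:E)) -> isotropic_prob P.
Proof.
move=> [mf [f0 [f1 [_ cov]]]] EP v.
pose m i j (x : n.-tuple R) := tnth x i * tnth x j.
have mm i j : measurable_fun setT (m i j) by exact: measurable_tnth_prod.
have mp i j : measurable_fun setT (fun x => Num.max (m i j x) 0) by exact: measurable_maxr.
have mn i j : measurable_fun setT (fun x => Num.max (- m i j x) 0).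
  by apply: measurable_maxr => //; exact: measurable_funN.
have p0 i j x : 0 <= Num.max (m i j x) 0 by rewrite le_max lexx orbT.
have n0 i j x : 0 <= Num.max (- m i j x) 0 by rewrite le_max lexx orbT.
have covE i j : Ex P (fun x => Num.max (m i j x) 0) =
    (Ex P (fun x => Num.max (- m i j x) 0)%R + (i == j)%:R%:E)%E.
  by rewrite !EP//; exact: cov.
have sq i : Ex P (fun x => tnth x i ^+ 2) = 1%E.
  have := covE i i; rewrite eqxx.
  have -> : (fun x => Num.max (m i i x) 0) = (fun x => tnth x i ^+ 2).
    by apply/funext => x; rewrite /m -expr2; apply/max_idPl; exact: sqr_ge0.
  have -> : (fun x => Num.max (- m i i x) 0) = cst 0.
    by apply/funext => x; rewrite /m -expr2; apply/max_idPr; rewrite oppr_le0 sqr_ge0.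
  by rewrite Ex_cst add0e.
have msq i : measurable_fun setT (fun x : n.-tuple R => tnth x i ^+ 2).
  by apply: measurable_funX; exact: measurable_tnth.
have nfin i j : Ex P (fun x => Num.max (- m i j x) 0) \is a fin_num.
  rewrite ge0_fin_numE ?Ex_ge0//.
  apply: (@le_lt_trans _ _ (Ex P (fun x => tnth x i ^+ 2 + tnth x j ^+ 2))).
    apply: Ex_le => //; first exact: measurable_funD.
    move=> x; rewrite ge_max addr_ge0 ?sqr_ge0// andbT /m.
    have := sqr_ge0 (tnth x i + tnth x j); have := sqr_ge0 (tnth x i); have := sqr_ge0 (tnth x j).
    rewrite !expr2; nra.
  rewrite ExD ?sq ?ltry// => x; exact: sqr_ge0.
have posE i j : (EFin \o m i j)^\+%E = (fun x : n.-tuple R => (Num.max (m i j x) 0)%:E) :> (_ -> \bar R).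
  by apply/funext => x; rewrite funeposE/= EFin_max.
have negE i j : (EFin \o m i j)^\-%E = (fun x : n.-tuple R => (Num.max (- m i j x) 0)%:E) :> (_ -> \bar R).
  by apply/funext => x; rewrite funenegE/= EFin_max EFinN.
have intm i j : (\int[P]_x (m i j x)%:E = (i == j)%:R%:E)%E.
  rewrite integralE posE negE -/(Ex P (fun x => Num.max (m i j x) 0)) covE.
  by rewrite -/(Ex P (fun x => Num.max (- m i j x) 0)) addeAC subee// add0e.
have im i j : P.-integrable setT (fun x => (m i j x)%:E).
  apply/integrableP; split; first exact/measurable_EFinP.
  apply/abse_integralP => //; first exact/measurable_EFinP.
  by rewrite intm /= ltry.
have -> : Ex P (fun x => dot v x ^+ 2) =
    (\int[P]_x \sum_(i < n) \sum_(j < n) ((v i * v j)%:E * (m i j x)%:E))%E.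
  apply: eq_integral => x _; rewrite expr2 /dot mulr_suml -sumEFin.
  apply: eq_bigr => i _; rewrite mulr_sumr -sumEFin.
  by apply: eq_bigr => j _; rewrite -EFinM /m; congr EFin; ring.
have im' i j : P.-integrable setT (fun x => ((v i * v j)%:E * (m i j x)%:E)%E).
  exact: integrableZl.
rewrite integral_sum//; last first.
  by move=> i; apply: integrable_sum => //= j _; exact: im'.
rewrite -sumEFin; apply: eq_bigr => i _.
rewrite integral_sum//.
rewrite (bigD1 i)//= big1 ?adde0 => [|j ji]; rewrite integralZl// intm.
  by rewrite eqxx mule1 expr2.
by rewrite eq_sym (negbTE ji) mule0.
Qed.

End isotropic_log_concave.

(** * Exponential moments of linear functionals *)

Section exponential_moment.
Context {R : realType} {n : nat} (P : probability (n.-tuple R) R).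
Hypotheses (Plc : log_concave_prob P) (Piso : isotropic_prob P).

Let tail (v : 'I_n -> R) (t : R) : set (n.-tuple R) := [set x | t < dot v x].

Let mtail v t : measurable (tail v t).
Proof. exact: (measurable_superlevel _ t (measurable_dot _ v)). Qed.

Lemma dot_tmid (v : 'I_n -> R) x y : dot v (tmid x y) = (dot v x + dot v y) / 2.
Proof.
rewrite /dot -big_split/= mulr_suml; apply: eq_bigr => i _.
by rewrite tnth_mktuple; ring.
Qed.

Lemma tail_midpoint (v : 'I_n -> R) (s t : R) :
  fine (P (tail v s)) * fine (P (tail v t)) <= fine (P (tail v ((s + t) / 2))) ^+ 2.
Proof.
have mi r : measurable_fun setT (\1_(tail v r) : _ -> R) by exact: measurable_indic.
have := Plc (\1_(tail v s)) (\1_(tail v t)) (\1_(tail v ((s + t) / 2)))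
  (mi _) (mi _) (mi _) _ _ _.
have fE r : P (tail v r) = (fine (P (tail v r)))%:E by rewrite fineK// fin_num_measure.
rewrite !Ex_indic// (fE s) (fE t) (fE ((s + t) / 2)) -!EFinM lee_fin -expr2.
apply => // x y; rewrite !indicE.
have [xs|] := boolP (x \in tail v s); last by rewrite mul0r sqr_ge0.
have [yt|] := boolP (y \in tail v t); last by rewrite mulr0 sqr_ge0.
rewrite mem_set ?mulr1 ?expr1n//.
by move: xs yt; rewrite !inE /tail/= dot_tmid => *; rewrite ltr_pM2r//; lra.
Qed.

(** At the thresholds -2, 2, 6, ... the tail probabilities form a log-concave sequence, so their
    successive ratios decrease. By Chebyshev the first term is at least 3/4 and the second at most
    1/4, hence every ratio is at most 1/3. *)
Lemma tail_geometric (v : 'I_n -> R) (j : nat) : \sum_(i < n) v i ^+ 2 <= 1 ->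
  fine (P (tail v (4 * j%:R + 2))) <= (1 / 3) ^+ j.+1.
Proof.
move=> v1.
pose a (j : nat) := fine (P (tail v (4 * j%:R - 2))).
have a_ge0 i : 0 <= a i by rewrite fine_ge0.
have a_le i : a i.+1 <= a i.
  apply: fine_le; rewrite ?fin_num_measure//.
  apply: le_measure_subset => // x; rewrite /tail/= -natr1; lra.
have a_mid i : a i * a i.+2 <= a i.+1 ^+ 2.
  rewrite /a (_ : 4 * i.+1%:R - 2 = (4 * i%:R - 2 + (4 * i.+2%:R - 2)) / 2).
    exact: tail_midpoint.
  by rewrite -[i.+2%:R]natr1 -[i.+1%:R]natr1; field.
have mD2 : measurable_fun setT (fun x => 4^-1 * dot v x ^+ 2).
  by apply: measurable_funM => //; apply: measurable_funX; exact: measurable_dot.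
have D20 x : 0 <= 4^-1 * dot v x ^+ 2 by rewrite mulr_ge0// ?invr_ge0// sqr_ge0.
have ED2 : (Ex P (fun x => 4^-1 * dot v x ^+ 2)%R <= (4^-1)%:E)%E.
  have mD : measurable_fun setT (fun x : n.-tuple R => dot v x ^+ 2).
    by apply: measurable_funX; exact: measurable_dot.
  have p4 : (0 : R) <= 4^-1 by lra.
  rewrite (ExZ P mD (fun x => sqr_ge0 _) p4) Piso -EFinM lee_fin; lra.
have mi r : measurable_fun setT (\1_(tail v r) : _ -> R) by exact: measurable_indic.
have a1 : a 1%N <= 4^-1.
  rewrite -lee_fin fineK ?fin_num_measure//; apply: le_trans ED2.
  rewrite -Ex_indic//; apply: Ex_le => // x.
  rewrite indicE; case: (boolP (_ \in _)) => //; rewrite inE /tail/= => vx.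
  rewrite mulr1n expr2; nra.
have a0 : 3 / 4 <= a 0%N.
  have : (1 <= P (tail v (4 * 0%:R - 2)) + (4^-1)%:E)%E.
    apply: le_trans (leeD2l _ ED2).
    rewrite -Ex_indic// -ExD// -[leLHS](Ex_cst P) //.
    apply: Ex_le => // [|x]; first exact: measurable_funD.
    rewrite indicE/=; case: (boolP (_ \in _)) => vx; first by rewrite lerDl.
    move: vx; rewrite notin_setE /tail/= => /negP; rewrite -leNgt => vx.
    rewrite mulr0n add0r expr2; nra.
  rewrite -(@fineK _ (P _)) ?fin_num_measure// -EFinD lee_fin -/(a 0%N); lra.
have a_ratio i : a i.+1 <= a i / 3.
  elim: i => [|i IH]; first lra.
  have [ai0|ai0] := eqVneq (a i) 0.
    have := a_le i.+1; have := a_ge0 i.+1; have := a_ge0 i.+2; rewrite ai0 in IH; lra.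
  have aip : 0 < a i by rewrite lt_neqAle eq_sym ai0 a_ge0.
  have : a i * a i.+2 <= a i * (a i.+1 / 3).
    apply: le_trans (a_mid i) _; rewrite expr2.
    by have := ler_wpM2l (a_ge0 i.+1) IH; lra.
  by rewrite ler_pM2l.
have a_pow i : a i <= (1 / 3) ^+ i.
  elim: i => [|i IH]; last by rewrite exprS; have := a_ratio i; lra.
  by rewrite expr0 -lee_fin fineK ?fin_num_measure// probability_le1.
apply: le_trans (a_pow j.+1).
by rewrite /a (_ : 4 * j.+1%:R - 2 = 4 * j%:R + 2)// -natr1; ring.
Qed.

Let expR_half : expR (1 / 2 : R) <= 2.
Proof.
have := expR_ge1Dx (- (1 / 2) : R); rewrite expRN => H.
have e0 := expR_gt0 (1 / 2 : R).
rewrite -[leLHS]invrK invf_ple ?posrE ?invr_gt0//; lra.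
Qed.

Let expR_quarter : expR (1 / 4 : R) <= 4 / 3.
Proof.
have := expR_ge1Dx (- (1 / 4) : R); rewrite expRN => H.
have e0 := expR_gt0 (1 / 4 : R).
rewrite -[leLHS]invrK invf_ple ?posrE ?invr_gt0//; lra.
Qed.

(** A staircase: each threshold 4 j + 2 below y contributes the value of the exponential at the next
    threshold 4 j + 6, and 4/3 bounds exp(1/4), its value at the first one. *)
Lemma expR_trunc_le (y : R) (N : nat) :
  expR (Num.min y (4 * N%:R + 2) / 8) <=
  4 / 3 + \sum_(j < N) expR ((4 * j%:R + 6) / 8) * (4 * j%:R + 2 < y)%R%:R.
Proof.
elim: N => [|N IH].
  rewrite big_ord0 addr0; apply: le_trans expR_quarter; rewrite ler_expR.
  have : Num.min y (4 * 0%:R + 2) <= 4 * 0%:R + 2 by rewrite ge_min lexx orbT.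
  lra.
rewrite big_ord_recr/= [leRHS]addrA.
have [yN|yN] := ltP (4 * N%:R + 2) y.
  rewrite mulr1 -[leLHS]add0r lerD//.
    by rewrite addr_ge0 ?sumr_ge0// => j _; rewrite mulr_ge0 ?expR_ge0.
  rewrite ler_expR.
  have : Num.min y (4 * N.+1%:R + 2) <= 4 * N.+1%:R + 2 by rewrite ge_min lexx orbT.
  rewrite -natr1; lra.
rewrite mulr0 addr0; apply: le_trans IH; rewrite ler_expR.
have -> : Num.min y (4 * N%:R + 2) = y by apply/min_idPl.
have : Num.min y (4 * N.+1%:R + 2) <= y by rewrite ge_min lexx.
lra.
Qed.

(** The rate 1/8 is chosen so that step j grows like (4/3) 2^(j+1), because exp(1/2) <= 2, against
    tails 3^-(j+1). The geometric series adds up to 8/3, and 4/3 + 8/3 = 4. *)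
Lemma exp_moment1 (v : 'I_n -> R) : \sum_(i < n) v i ^+ 2 <= 1 ->
  (Ex P (fun x => expR (dot v x / 8))%R <= 4%:E)%E.
Proof.
move=> v1.
pose h (N : nat) (x : n.-tuple R) := expR (Num.min (dot v x) (4 * N%:R + 2) / 8).
have mh N : measurable_fun setT (h N).
  apply: (measurableT_comp (@measurable_expR R)); apply: measurable_funM => //.
  by apply: measurable_minr => //; exact: measurable_dot.
have hle N : (Ex P (h N) <= 4%:E)%E.
  pose g (j : 'I_N) (x : n.-tuple R) : R := expR ((4 * j%:R + 6) / 8) * \1_(tail v (4 * j%:R + 2)) x.
  have mg j : measurable_fun setT (g j).
    by apply: measurable_funM => //; exact: measurable_indic.
  have g0 j x : 0 <= g j x by rewrite mulr_ge0 ?expR_ge0.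
  apply: (@le_trans _ _ (Ex P (fun x => cst (4 / 3) x + \sum_(j < N) g j x))).
    apply: Ex_le => // [|x|x].
    - by apply: measurable_funD => //; apply: measurable_sum.
    - exact: expR_ge0.
    - apply: le_trans (expR_trunc_le _ _) _; rewrite lerD2l; apply: ler_sum => j _.
      rewrite /g indicE ler_wpM2l ?expR_ge0// ler_nat.
      by case: ltP => //= H; rewrite mem_set.
  have msum : measurable_fun setT (fun x => \sum_(j < N) g j x) by apply: measurable_sum.
  have sum0 x : 0 <= \sum_(j < N) g j x by exact: sumr_ge0.
  rewrite ExD//; last by move=> x; rewrite /cst; lra.
  rewrite Ex_cst Ex_sum//.
  have gE j : (Ex P (g j) <= (4 / 3 * (2 / 3) ^+ j.+1)%:E)%E.
    have mi t : measurable_fun setT (\1_(tail v t) : _ -> R) by exact: measurable_indic.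
    have i0 t x : 0 <= (\1_(tail v t) x : R) by [].
    rewrite (ExZ P (mi _) (i0 _) (expR_ge0 _)) Ex_indic// -(@fineK _ (P _)) ?fin_num_measure// -EFinM lee_fin.
    have -> : 4 / 3 * (2 / 3) ^+ j.+1 = (4 / 3 * 2 ^+ j.+1) * (1 / 3) ^+ j.+1 :> R.
      by rewrite -[RHS]mulrA -exprMn; congr (_ * _ ^+ _); field.
    apply: ler_pM; rewrite ?expR_ge0 ?fine_ge0//; last exact: tail_geometric.
    have -> : (4 * j%:R + 6) / 8 = 1 / 4 + (1 / 2) * j.+1%:R :> R by rewrite -natr1; field.
    rewrite expRD; apply: ler_pM; rewrite ?expR_ge0//.
    by rewrite expRM_natr lerXn2r// nnegrE ?expR_ge0.
  apply: (@le_trans _ _ ((4 / 3)%:E + \sum_(j < N) (4 / 3 * (2 / 3) ^+ j.+1)%:E)%E).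
    by apply: leeD2l; apply: lee_sum => j _; exact: gE.
  rewrite sumEFin -EFinD lee_fin.
  have -> : \sum_(j < N) (4 / 3 * (2 / 3) ^+ j.+1) = 8 / 3 * (1 - (2 / 3) ^+ N) :> R.
    elim: N {g mg g0 gE msum sum0} => [|N IH]; first by rewrite big_ord0 expr0 subrr mulr0.
    by rewrite big_ord_recr/= IH !exprS; field.
  have : 0 <= (2 / 3 : R) ^+ N by rewrite exprn_ge0//; lra.
  lra.
have -> : Ex P (fun x => expR (dot v x / 8)) = (\int[P]_x limn (fun N => (h N x)%:E))%E.
  apply: eq_integral => x _; apply/esym/cvg_lim => //.
  apply: cvg_near_cst; near=> N; rewrite /h.
  suff -> : Num.min (dot v x) (4 * N%:R + 2) = dot v x by [].
  apply/min_idPl.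
  have : dot v x <= N%:R by near: N; exact: nbhs_infty_ger.
  have : (0 : R) <= N%:R by rewrite ler0n.
  lra.
rewrite monotone_convergence//; last 3 first.
- by move=> N; apply/measurable_EFinP.
- by move=> N x _; rewrite lee_fin expR_ge0.
- move=> x _ a b ab; rewrite lee_fin ler_expR ler_pM2r// le_min ge_min lexx/=.
  rewrite ge_min lerD2r ler_pM2l// ler_nat ab orbT//.
apply: lime_le; last by apply: nearW => N; exact: hle.
apply: ereal_nondecreasing_is_cvgn => a b ab; apply: Ex_le => // x; first exact: expR_ge0.
rewrite ler_expR ler_pM2r// le_min ge_min lexx/=.
by rewrite ge_min lerD2r ler_pM2l// ler_nat ab orbT.
Unshelve. all: by end_near. Qed.

Lemma exp_moment (v : 'I_n -> R) : \sum_(i < n) v i ^+ 2 <= 1 ->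
  (Ex P (fun x => expR (`|dot v x| / 8))%R <= 8%:E)%E.
Proof.
move=> v1.
have v1' : \sum_(i < n) (- v i) ^+ 2 <= 1.
  by rewrite (eq_bigr (fun i => v i ^+ 2))// => i _; rewrite sqrrN.
have dN x : dot (fun i => - v i) x = - dot v x.
  by rewrite /dot -sumrN; apply: eq_bigr => i _; rewrite mulNr.
have me w : measurable_fun setT (fun x : n.-tuple R => expR (dot w x / 8)).
  apply: (measurableT_comp (@measurable_expR R)); apply: measurable_funM => //.
  exact: measurable_dot.
apply: (@le_trans _ _ (Ex P (fun x => expR (dot v x / 8) + expR (dot (fun i => - v i) x / 8)))).
  apply: Ex_le => [||x|x].
  - apply: (measurableT_comp (@measurable_expR R)); apply: measurable_funM => //.
    by apply: measurableT_comp => //; exact: measurable_dot.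
  - exact: measurable_funD.
  - exact: expR_ge0.
  - rewrite dN; have [H|H] := ger0P (dot v x).
      by rewrite lerDl expR_ge0.
    by rewrite lerDr expR_ge0.
rewrite ExD//; try by move=> x; exact: expR_ge0.
have -> : (8%:E = 4%:E + 4%:E :> \bar R)%E by rewrite -EFinD; congr EFin; lra.
by apply: leeD; exact: exp_moment1.
Qed.

End exponential_moment.

(** * Smoothing by a Gaussian matrix *)

Section gaussian_smoothing.
Context {R : realType} {n l : nat} (P : probability (n.-tuple R) R).
Hypotheses (Plc : log_concave_prob P) (Piso : isotropic_prob P).
Implicit Types (M : 'I_l -> 'I_n -> R) (a b : R) (x : n.-tuple R).

Definition sqnorm {m} (v : 'I_m -> R) : R := \sum_(i < m) v i ^+ 2.

Definition quad M a x : R := 1 / 2 * \sum_(j < l) (a - dot (M j) x) ^+ 2.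

Definition smoothed M a : R := fine (Ex P (fun x => expR (- quad M a x))).

Lemma sqnorm_ge0 m (v : 'I_m -> R) : 0 <= sqnorm v.
Proof. by apply: sumr_ge0 => i _; exact: sqr_ge0. Qed.

Lemma quad_ge0 M a x : 0 <= quad M a x.
Proof.
apply: mulr_ge0; first lra.
by apply: sumr_ge0 => j _; exact: sqr_ge0.
Qed.

Lemma measurable_quad M a : measurable_fun setT (quad M a).
Proof.
apply: measurable_funM => //; apply: measurable_sum => j.
by apply: measurable_funX; apply: measurable_funB => //; exact: measurable_dot.
Qed.

Lemma measurable_exp_quad M a : measurable_fun setT (fun x => expR (- quad M a x)).
Proof.
by apply: (measurableT_comp (@measurable_expR R)); apply: measurable_funN; exact: measurable_quad.
Qed.

Lemma exp_quad_le1 M a x : expR (- quad M a x) <= 1.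
Proof. by rewrite -expR0 ler_expR oppr_le0 quad_ge0. Qed.

Lemma smoothedE M a : Ex P (fun x => expR (- quad M a x)) = (smoothed M a)%:E.
Proof.
rewrite /smoothed fineK// ge0_fin_numE; last by apply: Ex_ge0 => x; exact: expR_ge0.
apply: (@le_lt_trans _ _ (Ex P (cst 1))); last by rewrite Ex_cst ltry.
by apply: Ex_le => // [|x]; [exact: measurable_exp_quad|exact: exp_quad_le1].
Qed.

Lemma smoothed_ge0 M a : 0 <= smoothed M a.
Proof. by rewrite -lee_fin -smoothedE; apply: Ex_ge0 => x; exact: expR_ge0. Qed.

Lemma smoothed_le1 M a : smoothed M a <= 1.
Proof.
rewrite -lee_fin -smoothedE -(Ex_cst P 1).
by apply: Ex_le => // [|x]; [exact: measurable_exp_quad|exact: exp_quad_le1].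
Qed.

(** [quad] is jointly convex in [a] and [x], so the exponentials satisfy the midpoint hypothesis of
    Prekopa-Leindler. *)
Lemma smoothed_midpoint M a b :
  smoothed M a * smoothed M b <= smoothed M ((a + b) / 2) ^+ 2.
Proof.
rewrite -lee_fin expr2 [leLHS]EFinM [leRHS]EFinM -(smoothedE M a) -(smoothedE M b) -(smoothedE M ((a + b) / 2)).
apply: Plc; try exact: measurable_exp_quad; try by move=> x; exact: expR_ge0.
move=> x y; rewrite -expRD expr2 -expRD ler_expR.
suff : 2 * quad M ((a + b) / 2) (tmid x y) <= quad M a x + quad M b y by lra.
rewrite /quad -mulrDr -big_split/= mulrCA ler_pM2l// mulr_sumr.
apply: ler_sum => j _; rewrite dot_tmid.
set s := dot _ x; set t := dot _ y.
have := sqr_ge0 ((a - s) - (b - t)).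
rewrite !expr2; lra.
Qed.

Lemma Ex_quad_le M a :
  (Ex P (quad M a) <= (l%:R * a ^+ 2 + \sum_(j < l) sqnorm (M j))%:E)%E.
Proof.
have mD v : measurable_fun setT (fun x => dot v x ^+ 2).
  by apply: measurable_funX; exact: measurable_dot.
have mS : measurable_fun setT (fun x => \sum_(j < l) dot (M j) x ^+ 2) by apply: measurable_sum.
have S0 x : 0 <= \sum_(j < l) dot (M j) x ^+ 2 by apply: sumr_ge0 => j _; exact: sqr_ge0.
have a0 x : 0 <= cst (l%:R * a ^+ 2) x :> R by rewrite /cst mulr_ge0// sqr_ge0.
apply: (@le_trans _ _ (Ex P (fun x => cst (l%:R * a ^+ 2) x + \sum_(j < l) dot (M j) x ^+ 2))).
  apply: Ex_le => [|||x].
  - exact: measurable_quad.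
  - exact: measurable_funD.
  - exact: quad_ge0.
  - rewrite /quad /cst mulr_sumr.
    have -> : l%:R * a ^+ 2 = \sum_(j < l) a ^+ 2 by rewrite sumr_const card_ord mulr_natl.
    rewrite -big_split/=; apply: ler_sum => j _.
    by have := sqr_ge0 (a + dot (M j) x); rewrite !expr2; lra.
rewrite ExD// Ex_cst Ex_sum//; last by move=> j x; exact: sqr_ge0.
by rewrite EFinD -sumEFin; under eq_bigr do rewrite Piso.
Qed.

Variables (M : 'I_l -> 'I_n -> R) (a D : R).
Hypothesis (D_ge : l%:R * a ^+ 2 + \sum_(j < l) sqnorm (M j) <= D).

Let D_ge0 : 0 <= D.
Proof.
apply: le_trans D_ge; apply: addr_ge0; first by rewrite mulr_ge0// sqr_ge0.
by apply: sumr_ge0 => j _; exact: sqnorm_ge0.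
Qed.

Let EqD : (Ex P (quad M a) <= D%:E)%E.
Proof. by apply: le_trans (Ex_quad_le M a) _; rewrite lee_fin. Qed.

Let mq := measurable_quad M a.
Let me := measurable_exp_quad M a.
Let q0 := quad_ge0 M a.
Let e0 x : 0 <= expR (- quad M a x). Proof. exact: expR_ge0. Qed.

(* Jensen's inequality, through the tangent line of exp at -D. *)
Lemma smoothed_lower : expR (- D) <= smoothed M a.
Proof.
have : ((expR (- D) * (1 + D))%:E <= (smoothed M a)%:E + (expR (- D) * D)%:E)%E.
  apply: (@le_trans _ _ ((smoothed M a)%:E + (expR (- D))%:E * Ex P (quad M a))%E); last first.
    by rewrite leeD2l// EFinM lee_pmul2l// lte_fin expR_gt0.
  rewrite -smoothedE -ExZ ?expR_ge0// -ExD//; try exact: measurable_funM;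
    try by move=> x; rewrite mulr_ge0 ?expR_ge0.
  rewrite -(Ex_cst P); apply: Ex_le => // [|x|x].
  - by apply: measurable_funD => //; exact: measurable_funM.
  - by rewrite mulr_ge0 ?expR_ge0// addr_ge0.
  - rewrite /cst.
    have := expR_ge1Dx (D - quad M a x).
    rewrite -(ler_pM2l (expR_gt0 (- D))) -expRD.
    by rewrite (_ : - D + (D - quad M a x) = - quad M a x); [|ring]; lra.
rewrite -EFinD lee_fin; lra.
Qed.

(** The tilt by exp(- q), with q = [quad M a], keeps the mean of q of order D: multiplying 1 + q - D
    <= exp(q - D) by exp(- q) leaves the error exp(- D), which [smoothed_lower] absorbs. *)
Lemma smoothed_quad_le :
  (Ex P (fun x => expR (- quad M a x) * quad M a x)%R <= ((D + 1) * smoothed M a)%:E)%E.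
Proof.
apply: (@le_trans _ _ (Ex P (fun x => D * expR (- quad M a x) + cst (expR (- D)) x)%R)).
  apply: Ex_le => [|||x].
  - exact: measurable_funM.
  - by apply: measurable_funD => //; exact: measurable_funM.
  - by move=> x; exact: mulr_ge0.
  - have := expR_ge1Dx (quad M a x - D).
    rewrite -(ler_pM2l (expR_gt0 (- quad M a x))) -expRD.
    rewrite (_ : - quad M a x + (quad M a x - D) = - D); [|ring].
    by have := e0 x; rewrite /cst; lra.
rewrite ExD//; [|exact: measurable_funM|by move=> x; exact: mulr_ge0|by move=> x; exact: expR_ge0].
rewrite ExZ// smoothedE Ex_cst -EFinM -EFinD lee_fin mulrDl mul1r lerD2l.
exact: smoothed_lower.
Qed.

(** Obtained from u^2 <= 2 D^2 + 8 exp(u - D) at u = |<v, x>| / 8, multiplied by 64: 128 = 64 * 2,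
    and 4096 = 64 * 8 * 8, the last factor being the bound of [exp_moment]. *)
Definition weighted_moment_cst (D : R) : R := 128 * D ^+ 2 + 4096.

Let sq_le_exp (u : R) : 0 <= u -> u ^+ 2 <= 2 * D ^+ 2 + 8 * expR (u - D).
Proof.
move=> u0; have [uD|Du] := leP u D.
  have := expR_ge0 (u - D); have : u ^+ 2 <= D ^+ 2 by rewrite ler_pXn2r// nnegrE.
  have := sqr_ge0 D; lra.
have t0 : 0 <= u - D by lra.
have := expR_ge1Dx ((u - D) / 2).
have e2 : expR (u - D) = expR ((u - D) / 2) ^+ 2.
  by rewrite -expRM_natl; congr expR; field.
rewrite e2; move: (expR _) => e; move: t0; have -> : u = (u - D) + D by ring.
rewrite addrK; move: (u - D) => t t0 et.
have := sqr_ge0 (t - D); rewrite !expr2; nra.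
Qed.

(** The normalized tilt has density at most exp(D) with respect to P. Since <v, x> has exponential
    tails, this can enlarge it only to order D, hence a second moment of order D^2 instead of a loss
    exponential in D. *)
Lemma smoothed_dot_le1 (v : 'I_n -> R) : sqnorm v <= 1 ->
  (Ex P (fun x => expR (- quad M a x) * dot v x ^+ 2)%R <=
    (weighted_moment_cst D * smoothed M a)%:E)%E.
Proof.
move=> v1.
have mx : measurable_fun setT (fun x => expR (`|dot v x| / 8)).
  apply: (measurableT_comp (@measurable_expR R)); apply: measurable_funM => //.
  by apply: measurableT_comp => //; exact: measurable_dot.
have mx' : measurable_fun setT (fun x => 512 * expR (- D) * expR (`|dot v x| / 8)).
  exact: measurable_funM.
have me' : measurable_fun setT (fun x => 128 * D ^+ 2 * expR (- quad M a x)).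
  exact: measurable_funM.
have p1 : 0 <= 128 * D ^+ 2 by have := sqr_ge0 D; lra.
have p2 : 0 <= 512 * expR (- D) by have := expR_ge0 (- D); lra.
apply: (@le_trans _ _ (Ex P (fun x => 128 * D ^+ 2 * expR (- quad M a x) +
    512 * expR (- D) * expR (`|dot v x| / 8))%R)).
  apply: Ex_le => [|||x].
  - apply: measurable_funM => //.
    by apply: measurable_funX; exact: measurable_dot.
  - exact: measurable_funD.
  - by move=> x; rewrite mulr_ge0// sqr_ge0.
  - have u0 : 0 <= `|dot v x| / 8 by rewrite divr_ge0.
    have := sq_le_exp _ u0; rewrite expRD exprMn -normrX ger0_norm ?sqr_ge0//.
    have := e0 x; have := exp_quad_le1 M a x.
    move: (expR (- quad M a x)) => w w1 w0 H.
    have pe : 0 <= expR (`|dot v x| / 8) * expR (- D) by rewrite mulr_ge0 ?expR_ge0.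
    have H1 := ler_wpM2l w0 H.
    have H2 : w * (expR (`|dot v x| / 8) * expR (- D)) <= expR (`|dot v x| / 8) * expR (- D).
      by rewrite ler_piMl.
    have e8 : (8^-1 : R) ^+ 2 = 1 / 64 by field.
    rewrite e8 in H1; lra.
have mx0 x : 0 <= expR (`|dot v x| / 8) by exact: expR_ge0.
rewrite (ExD P me' mx' (fun x => mulr_ge0 p1 (e0 x)) (fun x => mulr_ge0 p2 (mx0 x))).
rewrite (ExZ P me e0 p1) (ExZ P mx mx0 p2) smoothedE.
apply: (@le_trans _ _ ((128 * D ^+ 2 * smoothed M a)%:E + (512 * expR (- D))%:E * 8%:E)%E).
  by rewrite leeD2l// lee_wpmul2l ?lee_fin//; exact: exp_moment.
rewrite -EFinM -EFinD lee_fin /weighted_moment_cst.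
have := smoothed_lower; lra.
Qed.

Lemma smoothed_dot_le (v : 'I_n -> R) :
  (Ex P (fun x => expR (- quad M a x) * dot v x ^+ 2)%R <=
    (sqnorm v * weighted_moment_cst D * smoothed M a)%:E)%E.
Proof.
have [v0|v0] := eqVneq (sqnorm v) 0.
  have vi i : v i = 0.
    apply/eqP; rewrite -sqrf_eq0; move/eqP: v0; rewrite psumr_eq0//.
      by move=> /allP/(_ i); rewrite mem_index_enum => /(_ isT).
    by move=> j _; exact: sqr_ge0.
  have -> : (fun x => expR (- quad M a x) * dot v x ^+ 2) = cst 0.
    apply/funext => x; rewrite /dot big1 ?expr0n ?mulr0// => i _.
    by rewrite vi mul0r.
  by rewrite Ex_cst v0 !mul0r.
have vp : 0 < sqnorm v by rewrite lt_neqAle eq_sym v0 sqnorm_ge0.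
pose s := Num.sqrt (sqnorm v).
have sp : 0 < s by rewrite sqrtr_gt0.
have s2 : s ^+ 2 = sqnorm v by rewrite sqr_sqrtr// ltW.
pose v' i := v i / s.
have v'1 : sqnorm v' <= 1.
  have -> : sqnorm v' = sqnorm v / s ^+ 2.
    by rewrite /sqnorm mulr_suml; apply: eq_bigr => i _; rewrite exprMn exprVn.
  by rewrite s2 divff.
have dE x : dot v x ^+ 2 = s ^+ 2 * dot v' x ^+ 2.
  rewrite -exprMn; congr (_ ^+ 2); rewrite /dot mulr_sumr; apply: eq_bigr => i _.
  by rewrite /v'; field; rewrite gt_eqF.
have -> : Ex P (fun x => expR (- quad M a x) * dot v x ^+ 2) =
    ((s ^+ 2)%:E * Ex P (fun x => expR (- quad M a x) * dot v' x ^+ 2)%R)%E.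
  rewrite -ExZ ?sqr_ge0//.
  - by congr Ex; apply/funext => x; rewrite dE; ring.
  - by apply: measurable_funM => //; apply: measurable_funX; exact: measurable_dot.
  - by move=> x; rewrite mulr_ge0// sqr_ge0.
rewrite -s2 -mulrA [leRHS]EFinM lee_pmul2l// ?lte_fin ?exprn_gt0//.
exact: smoothed_dot_le1.
Qed.

(** Young's inequality gives quad N <= (1 + lam) quad M + mu S, with S the sum of the squares of
    <M_j - N_j, x>. Jensen's inequality under the tilt by exp(- quad M) replaces lam quad M + mu S
    by a bound xi of its tilted mean. *)
Lemma smoothed_perturb (N : 'I_l -> 'I_n -> R) (lam : R) : 0 < lam ->
  smoothed M a * expR (- (lam * (D + 1) +
    (1 / (2 * lam) + 1 / 2) * (\sum_(j < l) sqnorm (fun i => M j i - N j i)) * weighted_moment_cst D))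
  <= smoothed N a.
Proof.
move=> lam0.
pose d j i := M j i - N j i.
pose mu := 1 / (2 * lam) + 1 / 2.
have mu0 : 0 <= mu by rewrite addr_ge0// divr_ge0// mulr_ge0// ltW.
set xi := (X in expR (- X)).
pose S x := \sum_(j < l) dot (d j) x ^+ 2.
have mdd j : measurable_fun setT (fun x => dot (d j) x ^+ 2).
  by apply: measurable_funX; exact: measurable_dot.
have mS : measurable_fun setT S by apply: measurable_sum.
have S0 x : 0 <= S x by apply: sumr_ge0 => j _; exact: sqr_ge0.
have dotd j x : dot (d j) x = dot (M j) x - dot (N j) x.
  by rewrite /dot -sumrB; apply: eq_bigr => i _; rewrite mulrBl.
have qN x : quad N a x <= quad M a x + (lam * quad M a x + mu * S x).
  rewrite /quad /S !mulr_sumr -!big_split/=; apply: ler_sum => j _.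
  have -> : dot (N j) x = dot (M j) x - dot (d j) x by rewrite dotd; ring.
  move: (dot (M j) x) (dot (d j) x) => s t; rewrite /mu.
  have : 0 <= (lam * (a - s) - t) ^+ 2 / (2 * lam).
    by rewrite divr_ge0 ?sqr_ge0// mulr_ge0// ltW.
  have -> : (lam * (a - s) - t) ^+ 2 / (2 * lam) =
    lam * (1 / 2 * (a - s) ^+ 2) - (a - s) * t + 1 / (2 * lam) * t ^+ 2.
    by field; rewrite gt_eqF.
  rewrite !expr2; lra.
have eS : (Ex P (fun x => expR (- quad M a x) * S x)%R <=
    ((\sum_(j < l) sqnorm (d j)) * weighted_moment_cst D * smoothed M a)%:E)%E.
  have -> : Ex P (fun x => expR (- quad M a x) * S x) =
      (\sum_(j < l) Ex P (fun x => expR (- quad M a x) * dot (d j) x ^+ 2)%R)%E.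
    rewrite -Ex_sum//.
    - by congr Ex; apply/funext => x; rewrite mulr_sumr.
    - by move=> j; exact: measurable_funM.
    - by move=> j x; rewrite mulr_ge0// sqr_ge0.
  rewrite !mulr_suml -sumEFin; apply: lee_sum => j _; exact: smoothed_dot_le.
have mqe : measurable_fun setT (fun x => expR (- quad M a x) * quad M a x).
  exact: measurable_funM.
have mSe : measurable_fun setT (fun x => expR (- quad M a x) * S x).
  exact: measurable_funM.
pose y x := lam * (expR (- quad M a x) * quad M a x) + mu * (expR (- quad M a x) * S x).
have my : measurable_fun setT y by apply: measurable_funD; exact: measurable_funM.
have lam0' : 0 <= lam by exact: ltW.
have Q0 x : 0 <= expR (- quad M a x) * quad M a x by exact: mulr_ge0.
have eS0 x : 0 <= expR (- quad M a x) * S x by exact: mulr_ge0.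
have y0 x : 0 <= y x by apply: addr_ge0; exact: mulr_ge0.
have Ey : (Ex P y <= (xi * smoothed M a)%:E)%E.
  rewrite /y ExD; [|exact: measurable_funM|exact: measurable_funM
    |by move=> x; exact: mulr_ge0|by move=> x; exact: mulr_ge0].
  rewrite (ExZ P mqe Q0 lam0') (ExZ P mSe eS0 mu0).
  have -> : xi * smoothed M a = lam * ((D + 1) * smoothed M a) +
      mu * ((\sum_(j < l) sqnorm (d j)) * weighted_moment_cst D * smoothed M a).
    by rewrite /xi -/(mu); ring.
  apply: le_trans (leeD (lee_wpmul2l _ smoothed_quad_le) (lee_wpmul2l _ eS)) _; rewrite ?lee_fin//.
have xi0 : 0 <= xi.
  apply: addr_ge0; first by rewrite mulr_ge0// addr_ge0.
  apply: mulr_ge0; last by rewrite /weighted_moment_cst; have := sqr_ge0 D; lra.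
  by apply: mulr_ge0 => //; apply: sumr_ge0 => j _; exact: sqnorm_ge0.
have c1 : 0 <= expR (- xi) by exact: expR_ge0.
have c0 : 0 <= expR (- xi) * (1 + xi) := mulr_ge0 c1 (addr_ge0 ler01 xi0).
have me' : measurable_fun setT (fun x => expR (- xi) * (1 + xi) * expR (- quad M a x)).
  exact: measurable_funM.
have my' : measurable_fun setT (fun x => expR (- xi) * y x) by exact: measurable_funM.
have mN := measurable_exp_quad N a.
have eN0 x : 0 <= expR (- quad N a x) by exact: expR_ge0.
have : expR (- xi) * (1 + xi) * smoothed M a <= smoothed N a + expR (- xi) * (xi * smoothed M a).
  rewrite -lee_fin [leRHS]EFinD.
  apply: (@le_trans _ _ ((smoothed N a)%:E + (expR (- xi))%:E * Ex P y)%E); last first.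
    by rewrite leeD2l// EFinM lee_pmul2l// lte_fin expR_gt0.
  rewrite [leLHS]EFinM -(smoothedE M a) -(smoothedE N a) -(ExZ P me e0 c0) -(ExZ P my y0 c1).
  rewrite -(ExD P mN my' eN0 (fun x => mulr_ge0 c1 (y0 x))).
  apply: (Ex_le P me' (measurable_funD mN my') (fun x => mulr_ge0 c0 (e0 x))) => x.
  have H : expR (- quad M a x) * expR (- (lam * quad M a x + mu * S x)) <= expR (- quad N a x).
    by rewrite -expRD ler_expR; have := qN x; lra.
  apply: (@le_trans _ _ (expR (- quad M a x) * expR (- (lam * quad M a x + mu * S x)) + expR (- xi) * y x)); last first.
    by rewrite lerD2r.
  (* Jensen again by the tangent line of the exponential, this time at - xi. *)
  have T := expR_ge1Dx (xi - (lam * quad M a x + mu * S x)).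
  have T1 : expR (- xi) * (1 + xi - (lam * quad M a x + mu * S x)) <= expR (- (lam * quad M a x + mu * S x)).
    rewrite (_ : - (lam * _ + _) = - xi + (xi - (lam * quad M a x + mu * S x))); last by ring.
    rewrite expRD ler_pM2l ?expR_gt0//; lra.
  have T2 := ler_wpM2l (e0 x) T1.
  rewrite /y; lra.
by move: (smoothed M a) (smoothed N a) (expR (- xi)) => A B C; lra.
Qed.

End gaussian_smoothing.

(** * Gaussian integrals in one and in several dimensions *)

Section gaussian_dim1.
Context {R : realType}.
Notation mu := (@lebesgue_measure R).
Notation pdf := (@normal_pdf R 0 1).

Lemma normal_pdf_neq0 (m s y : R) : s != 0 ->
  normal_pdf m s y = normal_peak s * expR (- (y - m) ^+ 2 / (s ^+ 2 *+ 2)).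
Proof. by move=> s0; rewrite /normal_pdf (negbTE s0). Qed.

Lemma std_normal_pdfE (y : R) : pdf y = normal_peak 1 * expR (- (y ^+ 2 / 2)).
Proof.
rewrite normal_pdf_neq0 ?oner_eq0// subr0 expr1n; congr (_ * expR _).
by rewrite mulNr; congr (- (_ / _)).
Qed.

Lemma normal_peakE (s : R) : 0 < s -> normal_peak s = normal_peak 1 / s.
Proof.
move=> s0; rewrite /normal_peak expr1n mul1r -mulrnAr sqrtrM ?sqr_ge0//.
by rewrite sqrtr_sqr ger0_norm ?ltW// invfM mulrC.
Qed.

Lemma integral_normal_pdfZ (K m s : R) (f : R -> R) : 0 <= K ->
  (forall y, f y = K * normal_pdf m s y) -> (\int[mu]_y (f y)%:E = K%:E)%E.
Proof.
move=> K0 fE; under eq_integral do rewrite fE EFinM.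
rewrite ge0_integralZl//; last 2 first.
- by apply/measurable_EFinP; exact: measurable_normal_pdf.
- by move=> y _; rewrite lee_fin normal_pdf_ge0.
by rewrite integral_normal_pdf mule1.
Qed.

(** Completing the square: the integrand is a multiple of the normal density of mean a b / (tau +
    b^2) and variance tau / (tau + b^2). *)
Lemma gaussian_convolution (a b tau : R) : 0 < tau ->
  (\int[mu]_y (pdf y * expR (- ((a - b * y) ^+ 2 / (2 * tau))))%:E =
   (Num.sqrt (tau / (tau + b ^+ 2)) * expR (- (a ^+ 2 / (2 * (tau + b ^+ 2)))))%:E)%E.
Proof.
move=> tau0; have tb0 : 0 < tau + b ^+ 2 by rewrite ltr_pwDl// sqr_ge0.
set s := Num.sqrt _.
have s0 : 0 < s by rewrite sqrtr_gt0 divr_gt0.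
have s2 : s ^+ 2 = tau / (tau + b ^+ 2) by rewrite sqr_sqrtr// ltW// divr_gt0.
apply: (@integral_normal_pdfZ _ (a * b / (tau + b ^+ 2)) s).
  by rewrite mulr_ge0 ?expR_ge0// ltW.
move=> y; rewrite std_normal_pdfE normal_pdf_neq0 ?gt_eqF//.
rewrite (normal_peakE _ s0) -[LHS]mulrA -expRD.
have cancel_s (p e e' : R) : s * e * (p / s * e') = p * (e * e').
  by field; rewrite gt_eqF.
rewrite cancel_s -expRD s2; congr (_ * expR _); field.
by rewrite !gt_eqF// mulr_gt0.
Qed.

Lemma gaussian_exp_square : (\int[mu]_y (pdf y * expR (y ^+ 2 / 4))%:E = (Num.sqrt 2)%:E)%E.
Proof.
have s0 : 0 < Num.sqrt 2 :> R by rewrite sqrtr_gt0.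
have s2 : Num.sqrt 2 ^+ 2 = 2 :> R by rewrite sqr_sqrtr.
apply: (@integral_normal_pdfZ _ 0 (Num.sqrt 2)); first exact: ltW.
move=> y; rewrite std_normal_pdfE normal_pdf_neq0 ?gt_eqF//.
rewrite (normal_peakE _ s0) s2 subr0 -[LHS]mulrA -expRD.
have cancel_s (s p e : R) : 0 < s -> s * (p / s * e) = p * e.
  by move=> ?; field; rewrite gt_eqF.
by rewrite cancel_s//; congr (_ * expR _); field.
Qed.

(** The parallelogram identity x^2 + y^2 = 2 ((x + y) / 2)^2 + (x - y)^2 / 2, and the origin of the
    Gaussian surplus. *)
Lemma pdf_midpoint (x y : R) :
  pdf x * pdf y = pdf ((x + y) / 2) ^+ 2 * expR (- ((x - y) ^+ 2 / 4)).
Proof.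
rewrite !std_normal_pdfE; set p := normal_peak 1.
have sq (e e' : R) : (p * e) ^+ 2 * e' = p * p * (e * e * e') by ring.
by rewrite sq mulrACA -!expRD; congr (_ * expR _); field.
Qed.

End gaussian_dim1.

Section iterated_product.
Context {R : realType}.
Local Open Scope ereal_scope.

Lemma iint_eq n (f g : n.-tuple R -> \bar R) : (forall x, f x = g x) -> iint f = iint g.
Proof. by move=> fg; congr iint; apply/funext. Qed.

Lemma iintZ n (f : n.-tuple R -> R) (k : R) : measurable_fun setT f -> (forall x, (0 <= f x)%R) ->
  (0 <= k)%R -> iint (fun x => (k * f x)%:E) = k%:E * iint (fun x => (f x)%:E).
Proof.
move=> mf f0 k0.
have m1 : measurable_fun setT (fun x => (f x)%:E) by exact/measurable_EFinP.
have m2 : measurable_fun setT (fun x => (k * f x)%:E).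
  by apply/measurable_EFinP; exact: measurable_funM.
have p1 x : 0 <= (f x)%:E by rewrite lee_fin.
have p2 x : 0 <= (k * f x)%:E by rewrite lee_fin mulr_ge0.
rewrite (iintE _ _ m1 p1) (iintE _ _ m2 p2).
under eq_integral do rewrite EFinM.
by rewrite ge0_integralZl.
Qed.

(** The factors are functions of sequences, so that [take] and [drop] need no casts between tuple
    types. *)
Lemma iint_cat p q (f g : seq R -> R) :
  measurable_fun setT (fun t : p.-tuple R => f t) ->
  measurable_fun setT (fun t : q.-tuple R => g t) ->
  (forall s, (0 <= f s)%R) -> (forall s, (0 <= g s)%R) ->
  iint (fun t : (p + q).-tuple R => (f (take p t) * g (drop p t))%:E) =
  iint (fun t : p.-tuple R => (f t)%:E) * iint (fun t : q.-tuple R => (g t)%:E).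
Proof.
move=> + mg + g0; elim: p f => [|p IH] f mf f0.
  rewrite /= -(@iintZ _ (fun t : q.-tuple R => g t))//.
  by apply: iint_eq => t; rewrite take0 drop0.
rewrite -[LHS]/(\int[lebesgue_measure]_y iint (fun t : (p + q).-tuple R => (f (y :: take p t) * g (drop p t))%:E)).
have mfc : measurable_fun setT (fun t : p.+1.-tuple R => (f t)%:E) by exact/measurable_EFinP.
have mfy y : measurable_fun setT (fun t : p.-tuple R => f (y :: t)).
  have := @measurable_section_cons _ _ _ y mfc.
  by move/measurable_EFinP.
under eq_integral do rewrite (IH (fun s => f (_ :: s)))//.
rewrite ge0_integralZr//.
- by have := @measurable_iint_cons _ _ _ mfc; apply => x; rewrite lee_fin.
- by move=> y _; apply: iint_ge0 => t; rewrite lee_fin.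
- by apply: iint_ge0 => t; rewrite lee_fin.
Qed.

End iterated_product.

Section gaussian_measure.
Context {R : realType}.
Notation pdf := (@normal_pdf R 0 1).

Definition gdens (s : seq R) : R := \prod_(y <- s) pdf y.

Lemma pdf_ge0 y : 0 <= pdf y. Proof. exact: normal_pdf_ge0. Qed.

Lemma gdens_ge0 s : 0 <= gdens s.
Proof. by apply: prodr_ge0 => y _; exact: pdf_ge0. Qed.

Lemma measurable_tuple_prod n (h : R -> R) : measurable_fun setT h ->
  measurable_fun setT (fun t : n.-tuple R => \prod_(y <- t) h y).
Proof.
move=> mh; rewrite (_ : (fun _ => _) = (fun t : n.-tuple R => \prod_(i < n) h (tnth t i))); last first.
  by apply/funext => t; rewrite big_tuple.
by apply: measurable_prod => i _; apply: (measurableT_comp mh); exact: measurable_tnth.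
Qed.

Lemma measurable_gdens n : measurable_fun setT (fun t : n.-tuple R => gdens t).
Proof. by apply: measurable_tuple_prod; exact: measurable_normal_pdf. Qed.

Lemma iint_prod n (h : R -> R) (c : R) : measurable_fun setT h -> (forall y, 0 <= h y) ->
  (\int[@lebesgue_measure R]_y (h y)%:E = c%:E)%E ->
  iint (fun t : n.-tuple R => (\prod_(y <- t) h y)%:E) = (c ^+ n)%:E.
Proof.
move=> mh h0 hc.
have c0 : 0 <= c by rewrite -lee_fin -hc; apply: integral_ge0 => y _; rewrite lee_fin.
elim: n => [|n IH]; first by rewrite /= big_nil expr0.
rewrite /=.
transitivity (\int[@lebesgue_measure R]_y ((h y)%:E * (c ^+ n)%:E))%E.
  apply: eq_integral => y _; rewrite -IH -(iintZ _ _ _ (measurable_tuple_prod n _ mh))//.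
    by apply: iint_eq => t; rewrite big_cons.
  by move=> t; apply: prodr_ge0.
rewrite ge0_integralZr//; last 3 first.
- exact/measurable_EFinP.
- by move=> y _; rewrite lee_fin.
- by rewrite lee_fin exprn_ge0.
by rewrite hc -EFinM exprS.
Qed.

Lemma gauss_prob_exists n : exists G : probability (n.-tuple R) R,
  forall g : n.-tuple R -> R, measurable_fun setT g -> (forall x, 0 <= g x) ->
    Ex G g = iint (fun x => (g x * gdens x)%:E).
Proof.
have mg := measurable_gdens n.
have [|G HG] := @density_probability _ _ _ (lebn n) _ mg (fun x => gdens_ge0 _).
  rewrite -iintE; [|exact/measurable_EFinP|by move=> x; rewrite lee_fin gdens_ge0].
  rewrite (@iint_prod n pdf 1) ?expr1n//.
  - exact: measurable_normal_pdf.
  - exact: pdf_ge0.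
  - exact: integral_normal_pdf.
exists G => g mg' g0; rewrite /Ex HG; [|exact/measurable_EFinP|by move=> x; rewrite lee_fin].
rewrite iintE//; first by apply/measurable_EFinP; exact: measurable_funM.
by move=> x; rewrite lee_fin mulr_ge0// gdens_ge0.
Qed.

Definition gauss n := projT1 (cid (gauss_prob_exists n)).

Lemma gaussE n (g : n.-tuple R -> R) : measurable_fun setT g -> (forall x, 0 <= g x) ->
  Ex (gauss n) g = iint (fun x => (g x * gdens x)%:E).
Proof. by rewrite /gauss; case: cid => G /=; apply. Qed.

Definition sqdist n (x y : n.-tuple R) : R := \sum_(i < n) (tnth x i - tnth y i) ^+ 2.

Lemma gdens_midpoint n (x y : n.-tuple R) :
  gdens x * gdens y = gdens (tmid x y) ^+ 2 * expR (- (sqdist _ x y / 4)).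
Proof.
rewrite /gdens !big_tuple -big_split/= -prodrXl/= /sqdist mulr_suml -sumrN expR_sum -big_split/=.
by apply: eq_bigr => i _; rewrite pdf_midpoint tnth_mktuple.
Qed.

(* The Gaussian weight gains exp(|x - y|^2 / 4) over a merely log-concave one. *)
Lemma gauss_prekopa_leindler n (u v w : n.-tuple R -> R) :
  measurable_fun setT u -> measurable_fun setT v -> measurable_fun setT w ->
  (forall x, 0 <= u x) -> (forall x, 0 <= v x) -> (forall x, 0 <= w x) ->
  (forall x y, u x * v y <= w (tmid x y) ^+ 2 * expR (sqdist _ x y / 4)) ->
  (Ex (gauss n) u * Ex (gauss n) v <= Ex (gauss n) w * Ex (gauss n) w)%E.
Proof.
move=> mu mv mw u0 v0 w0 uvw; rewrite !gaussE//.
have mM (h : n.-tuple R -> R) : measurable_fun setT h -> measurable_fun setT (fun x => (h x * gdens x)%:E).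
  by move=> mh; apply/measurable_EFinP; apply: measurable_funM => //; exact: measurable_gdens.
have ge0M (h : n.-tuple R -> R) : (forall x, 0 <= h x) -> forall x, (0 <= (h x * gdens x)%:E)%E.
  by move=> h0 x; rewrite lee_fin mulr_ge0// gdens_ge0.
apply: prekopa_leindler; try exact: mM; try exact: ge0M.
move=> x y; rewrite -!EFinM lee_fin mulrACA gdens_midpoint.
set g := gdens _; set z := tmid x y.
have -> : w z * g * (w z * g) = (w z ^+ 2 * expR (sqdist _ x y / 4)) * (g ^+ 2 * expR (- (sqdist _ x y / 4))).
  rewrite [RHS]mulrACA -expRD subrr expR0 mulr1; ring.
by apply: ler_wpM2r; rewrite ?uvw// mulr_ge0 ?expR_ge0// sqr_ge0.
Qed.

Lemma measurable_nth_tuple n (i : nat) : measurable_fun setT (fun t : n.-tuple R => nth 0 t i).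
Proof.
have [ni|ni] := ltnP i n.
  rewrite (_ : (fun _ => _) = (fun t => tnth t (Ordinal ni))); first exact: measurable_tnth.
  by apply/funext => t; rewrite (tnth_nth 0).
rewrite (_ : (fun _ => _) = cst 0)//.
by apply/funext => t; rewrite nth_default// size_tuple.
Qed.

(** Integrating out one coordinate replaces tau by tau + b_i^2; a general tau is what makes the
    induction go through. *)
Lemma iint_row n (b : nat -> R) (a tau : R) : 0 < tau ->
  iint (fun t : n.-tuple R =>
    (gdens t * expR (- ((a - \sum_(i < n) b i * nth 0 t i) ^+ 2 / (2 * tau))))%:E) =
  (Num.sqrt (tau / (tau + \sum_(i < n) b i ^+ 2)) *
     expR (- (a ^+ 2 / (2 * (tau + \sum_(i < n) b i ^+ 2)))))%:E.
Proof.
elim: n b a => [|n IH] b a tau0.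
  by rewrite /= /gdens big_nil !big_ord0 subr0 addr0 divff ?gt_eqF// sqrtr1.
have s0 : 0 <= \sum_(i < n) b i.+1 ^+ 2 by apply: sumr_ge0 => i _; exact: sqr_ge0.
have ts0 : 0 < tau + \sum_(i < n) b i.+1 ^+ 2 by rewrite ltr_pwDl.
rewrite /=.
transitivity (\int[@lebesgue_measure R]_y ((Num.sqrt (tau / (tau + \sum_(i < n) b i.+1 ^+ 2)))%:E *
   (pdf y * expR (- ((a - b 0%N * y) ^+ 2 / (2 * (tau + \sum_(i < n) b i.+1 ^+ 2)))))%:E))%E.
  apply: eq_integral => y _.
  transitivity (iint (fun t : n.-tuple R => (pdf y * (gdens t *
      expR (- ((a - b 0%N * y - \sum_(i < n) b i.+1 * nth 0 t i) ^+ 2 / (2 * tau)))))%:E)).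
    apply: iint_eq => t; rewrite /gdens big_cons -mulrA big_ord_recl/=.
    by rewrite opprD addrA.
  rewrite iintZ; last 3 first.
  - apply: measurable_funM; first exact: measurable_gdens.
    apply: (measurableT_comp (@measurable_expR R)); apply: measurable_funN.
    apply: measurable_funM => //; apply: measurable_funX; apply: measurable_funB => //.
    apply: measurable_sum => i; apply: measurable_funM => //; exact: measurable_nth_tuple.
  - by move=> t; rewrite mulr_ge0 ?expR_ge0// gdens_ge0.
  - exact: pdf_ge0.
  by rewrite (IH (b \o S)) //= -!EFinM mulrCA.
have mG : measurable_fun setT (fun y => (pdf y *
    expR (- ((a - b 0%N * y) ^+ 2 / (2 * (tau + \sum_(i < n) b i.+1 ^+ 2)))))%:E).
  apply/measurable_EFinP; apply: measurable_funM; first exact: measurable_normal_pdf.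
  apply: (measurableT_comp (@measurable_expR R)); apply: measurable_funN.
  apply: measurable_funM => //; apply: measurable_funX; apply: measurable_funB => //.
have G0 y : (0 <= (pdf y *
    expR (- ((a - b 0%N * y) ^+ 2 / (2 * (tau + \sum_(i < n) b i.+1 ^+ 2)))))%:E)%E.
  by rewrite lee_fin mulr_ge0 ?expR_ge0// pdf_ge0.
rewrite ge0_integralZl//.
rewrite gaussian_convolution// -EFinM mulrA -sqrtrM; last first.
  by rewrite divr_ge0// ltW.
rewrite big_ord_recl/= [b 0%N ^+ 2 + _]addrC addrA.
have t1 : 0 < tau + \sum_(i < n) b i.+1 ^+ 2 + b 0%N ^+ 2 by rewrite ltr_pwDl// sqr_ge0.
congr (Num.sqrt _ * _)%:E; rewrite /bump/=.
by field; rewrite !gt_eqF.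
Qed.

Lemma iint_rows n l (b : nat -> R) (a : R) :
  iint (fun t : (l * n).-tuple R => (gdens t *
    expR (- (1 / 2 * \sum_(j < l) (a - \sum_(i < n) b i * nth 0 t (j * n + i)) ^+ 2)))%:E) =
  ((Num.sqrt (1 / (1 + \sum_(i < n) b i ^+ 2)) *
     expR (- (a ^+ 2 / (2 * (1 + \sum_(i < n) b i ^+ 2))))) ^+ l)%:E.
Proof.
elim: l => [|l IH].
  by rewrite /= /gdens big_nil big_ord0 mulr0 oppr0 expR0 mulr1 expr0.
pose f (s : seq R) := gdens s * expR (- ((a - \sum_(i < n) b i * nth 0 s i) ^+ 2 / (2 * 1))).
pose g (s : seq R) := gdens s *
  expR (- (1 / 2 * \sum_(j < l) (a - \sum_(i < n) b i * nth 0 s (j * n + i)) ^+ 2)).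
have mf : measurable_fun setT (fun t : n.-tuple R => f t).
  apply: measurable_funM; first exact: measurable_gdens.
  apply: (measurableT_comp (@measurable_expR R)); apply: measurable_funN.
  apply: measurable_funM => //; apply: measurable_funX; apply: measurable_funB => //.
  by apply: measurable_sum => i; apply: measurable_funM => //; exact: measurable_nth_tuple.
have mg : measurable_fun setT (fun t : (l * n).-tuple R => g t).
  apply: measurable_funM; first exact: measurable_gdens.
  apply: (measurableT_comp (@measurable_expR R)); apply: measurable_funN.
  apply: measurable_funM => //; apply: measurable_sum => j.
  apply: measurable_funX; apply: measurable_funB => //.
  by apply: measurable_sum => i; apply: measurable_funM => //; exact: measurable_nth_tuple.
have f0 s : 0 <= f s by rewrite mulr_ge0 ?expR_ge0// gdens_ge0.
have g0 s : 0 <= g s by rewrite mulr_ge0 ?expR_ge0// gdens_ge0.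
have := @iint_cat R n (l * n) f g mf mg f0 g0.
rewrite IH (iint_row _ _ _ _ ltr01) -EFinM -exprS => <-.
rewrite -[LHS]/(iint (fun t : (n + l * n).-tuple R => (gdens t *
    expR (- (1 / 2 * \sum_(j < l.+1) (a - \sum_(i < n) b i * nth 0 t (j * n + i)) ^+ 2)))%:E)).
apply: iint_eq => t; rewrite /f /g mulrACA -expRD; congr (_ * expR _)%:E.
  by rewrite /gdens -big_cat cat_take_drop.
rewrite big_ord_recl/= mulrDr opprD; congr (- _ - _).
  rewrite mulr1 mul1r mulrC; congr ((_ - _) ^+ 2 / _).
  by apply: eq_bigr => i _; rewrite mul0n add0n nth_take.
congr (_ * _); apply: eq_bigr => j _; congr ((_ - _) ^+ 2).
apply: eq_bigr => i _; rewrite nth_drop; congr (_ * nth _ _ _).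
by rewrite /bump/= add1n mulSn addnA.
Qed.

End gaussian_measure.

(** * The averaged profile, its truncation and its approximate log-concavity *)

Section radial_profile.
Context {R : realType} {n l : nat} (P : probability (n.-tuple R) R).
Hypotheses (n_gt0 : (0 < n)%N) (Plc : log_concave_prob P) (Piso : isotropic_prob P).
Notation N := (l * n)%N.
Let c : R := (Num.sqrt n%:R)^-1.

(* Row j, scaled by 1 / sqrt n, of the l x n matrix stored row by row in s. *)
Definition rows (s : seq R) : 'I_l -> 'I_n -> R := fun j i => c * nth 0 s (j * n + i).

(* The variance of g + <G, x> / sqrt n, for a standard Gaussian vector G of R^n and an
   independent standard Gaussian g. *)
Definition noisy_sqnorm (x : n.-tuple R) : R := 1 + (\sum_(i < n) tnth x i ^+ 2) / n%:R.

(* E exp(- (a - Y)^2 / 2) for a centered Gaussian Y of variance s - 1. *)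
Definition profile_kernel (a s : R) : R := Num.sqrt (1 / s) * expR (- (a ^+ 2 / (2 * s))).

Definition profile (a : R) : R := fine (Ex P (fun x => profile_kernel a (noisy_sqnorm x) ^+ l)).

Let n0 : 0 < n%:R :> R. Proof. by rewrite ltr0n. Qed.

Let c2 : c ^+ 2 = n%:R^-1. Proof. by rewrite /c exprVn sqr_sqrtr. Qed.

Lemma noisy_sqnorm_ge1 x : 1 <= noisy_sqnorm x.
Proof. by rewrite lerDl divr_ge0// sumr_ge0// => i _; exact: sqr_ge0. Qed.

Lemma measurable_noisy_sqnorm : measurable_fun setT noisy_sqnorm.
Proof.
apply: measurable_funD => //; apply: measurable_funM => //.
by apply: measurable_sum => i; apply: measurable_funX; exact: measurable_tnth.
Qed.

Lemma profile_kernel_ge0 a s : 0 <= profile_kernel a s.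
Proof. by rewrite mulr_ge0 ?expR_ge0// sqrtr_ge0. Qed.

Lemma profile_kernel_le1 a s : 1 <= s -> profile_kernel a s <= 1.
Proof.
move=> s1; have s0 : 0 < s by exact: lt_le_trans s1.
apply: mulr_ile1; rewrite ?sqrtr_ge0 ?expR_ge0//.
  by rewrite -[leRHS]sqrtr1 ler_sqrt// ler_pdivrMr// mul1r.
by rewrite -expR0 ler_expR oppr_le0 divr_ge0 ?sqr_ge0// mulr_ge0// ltW.
Qed.

Lemma measurable_profile_kernel a :
  measurable_fun setT (fun x => profile_kernel a (noisy_sqnorm x) ^+ l).
Proof.
have mi : measurable_fun setT (fun x => (noisy_sqnorm x)^-1).
  rewrite (_ : (fun _ => _) = (fun x => noisy_sqnorm x `^ (-1))); last first.
    by apply/funext => x; rewrite powR_inv1// (le_trans _ (noisy_sqnorm_ge1 x)).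
  by apply: (measurableT_comp (@measurable_powR R (-1))); exact: measurable_noisy_sqnorm.
apply: measurable_funX; apply: measurable_funM.
  rewrite (_ : (fun _ => _) = (fun x => (noisy_sqnorm x)^-1 `^ 2^-1)).
    exact: (measurableT_comp (@measurable_powR R _)).
  apply/funext => x; rewrite mul1r powR12_sqrt// invr_ge0.
  by rewrite (le_trans _ (noisy_sqnorm_ge1 x)).
apply: (measurableT_comp (@measurable_expR R)); apply: measurable_funN.
rewrite (_ : (fun _ => _) = (fun x => (a ^+ 2 / 2) * (noisy_sqnorm x)^-1)).
  exact: measurable_funM.
by apply/funext => x; rewrite invfM mulrA.
Qed.

Lemma profileE a :
  Ex P (fun x => profile_kernel a (noisy_sqnorm x) ^+ l) = (profile a)%:E.
Proof.
have k0 x : 0 <= profile_kernel a (noisy_sqnorm x) ^+ l.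
  by rewrite exprn_ge0// profile_kernel_ge0.
rewrite /profile fineK// ge0_fin_numE ?Ex_ge0//.
apply: (@le_lt_trans _ _ (Ex P (cst 1))); last by rewrite Ex_cst ltry.
apply: Ex_le => // [|x]; first exact: measurable_profile_kernel.
by apply: exprn_ile1; [exact: profile_kernel_ge0|exact/profile_kernel_le1/noisy_sqnorm_ge1].
Qed.

Lemma measurable_exp_quad_rows a : measurable_fun setT
  (fun z : N.-tuple R * n.-tuple R => expR (- quad (rows z.1) a z.2)).
Proof.
apply: (measurableT_comp (@measurable_expR R)); apply: measurable_funN.
apply: measurable_funM => //; apply: measurable_sum => j.
apply: measurable_funX; apply: measurable_funB => //; apply: measurable_sum => i.
apply: measurable_funM.
  apply: measurable_funM => //.
  exact: (measurableT_comp (measurable_nth_tuple _ _) (@measurable_fst _ _ _ _)).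
exact: (measurableT_comp (measurable_tnth _) (@measurable_snd _ _ _ _)).
Qed.

Lemma measurable_smoothed_rows a :
  measurable_fun setT (fun t : N.-tuple R => smoothed P (rows t) a).
Proof.
apply: (measurableT_comp (fine_measurable measurableT)).
have mf : measurable_fun setT (fun z : N.-tuple R * n.-tuple R => (expR (- quad (rows z.1) a z.2))%:E).
  by apply/measurable_EFinP; exact: measurable_exp_quad_rows.
have := @measurable_fun_fubini_tonelli_F _ _ _ _ R P _ mf.
by apply => z; rewrite lee_fin expR_ge0.
Qed.

(** Tonelli exchanges the two averages. For fixed x the rows give independent centered Gaussians of
    variance |x|^2 / n, hence an l-th power of one kernel. *)
Lemma Ex_gauss_smoothed a :
  Ex (gauss N) (fun t => smoothed P (rows t) a) = (profile a)%:E.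
Proof.
have mf : measurable_fun setT (fun z : N.-tuple R * n.-tuple R => (expR (- quad (rows z.1) a z.2))%:E).
  by apply/measurable_EFinP; exact: measurable_exp_quad_rows.
have f0 (z : N.-tuple R * n.-tuple R) : (0 <= (expR (- quad (rows z.1) a z.2))%:E)%E.
  by rewrite lee_fin expR_ge0.
have := @fubini_tonelli _ _ _ _ R (gauss N) P _ mf f0 => /= FT.
transitivity (\int[gauss N]_t \int[P]_x (expR (- quad (rows t) a x))%:E)%E.
  by apply: eq_integral => t _; rewrite -smoothedE.
rewrite FT -profileE; apply: eq_integral => x _.
have mx : measurable_fun setT (fun t : N.-tuple R => expR (- quad (rows t) a x)).
  exact: (measurableT_comp (measurable_exp_quad_rows a) (pair2_measurable x)).
have := gaussE N _ mx (fun t => expR_ge0 _).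
rewrite /Ex => ->.
have := @iint_rows R n l (fun i => c * nth 0 x i) a.
have -> : 1 + \sum_(i < n) (c * nth 0 x i) ^+ 2 = noisy_sqnorm x.
  rewrite /noisy_sqnorm mulr_suml; congr (_ + _); apply: eq_bigr => i _.
  by rewrite exprMn c2 (tnth_nth 0) mulrC.
move=> <-; apply: iint_eq => t; rewrite mulrC; congr (_ * expR (- (_ * _)))%:E.
apply: eq_bigr => j _; congr ((_ - _) ^+ 2); apply: eq_bigr => i _.
by rewrite /rows (tnth_nth 0) mulrAC.
Qed.

Lemma sum_rows (phi : nat -> R) :
  \sum_(j < l) \sum_(i < n) phi (j * n + i)%N = \sum_(k < N) phi k.
Proof.
rewrite -(big_mkord xpredT phi) big_nat_mul big_mkord; apply: eq_bigr => j _.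
have := @big_addn _ 0 +%R 0 (j.+1 * n) (j * n) xpredT phi.
rewrite add0n => ->; rewrite mulSn addnK big_mkord.
by apply: eq_bigr => i _; rewrite addnC.
Qed.

Definition tsq m (t : m.-tuple R) : R := \sum_(i < m) tnth t i ^+ 2.

Lemma sum_sqnorm_rows (t : N.-tuple R) : \sum_(j < l) sqnorm (rows t j) = tsq N t / n%:R.
Proof.
rewrite /tsq mulr_suml.
under [RHS]eq_bigr => k _ do rewrite (tnth_nth 0).
rewrite -(sum_rows (fun k => nth 0 t k ^+ 2 / n%:R)); apply: eq_bigr => j _.
by apply: eq_bigr => i _; rewrite exprMn c2 mulrC.
Qed.

Lemma sum_sqnorm_rowsB (s t : N.-tuple R) :
  \sum_(j < l) sqnorm (fun i => rows s j i - rows t j i) = sqdist N s t / n%:R.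
Proof.
rewrite /sqdist mulr_suml.
under [RHS]eq_bigr => k _ do rewrite !(tnth_nth 0).
rewrite -(sum_rows (fun k => (nth 0 s k - nth 0 t k) ^+ 2 / n%:R)); apply: eq_bigr => j _.
by apply: eq_bigr => i _; rewrite /rows -mulrBr exprMn c2 mulrC.
Qed.

Lemma measurable_tsq m : measurable_fun setT (@tsq m).
Proof. by apply: measurable_sum => i; apply: measurable_funX; exact: measurable_tnth. Qed.

Let ball_set : set (N.-tuple R) := [set t | tsq N t <= 8 * N%:R].

Let mball : measurable ball_set.
Proof.
have -> : ball_set = ~` [set t | 8 * N%:R < tsq N t].
  by apply/seteqP; split => t; rewrite /ball_set/= leNgt => /negP.
by apply: measurableC; apply: measurable_superlevel; exact: measurable_tsq.
Qed.

Let mB : measurable_fun setT (\1_ball_set : _ -> R). Proof. exact: measurable_indic. Qed.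

(** Markov's inequality for exp(|t|^2 / 4): its mean is 2^(N/2) <= exp(N), and outside the ball it
    exceeds exp(2 N), which explains the radius 8 N. *)
Lemma gauss_large_norm : (Ex (gauss N) (fun t => 1 - \1_ball_set t)%R <= (expR (- N%:R))%:E)%E.
Proof.
pose h (y : R) := normal_pdf 0 1 y * expR (y ^+ 2 / 4).
have mh : measurable_fun setT h.
  apply: measurable_funM; first exact: measurable_normal_pdf.
  by apply: (measurableT_comp (@measurable_expR R)); apply: measurable_funM => //.
have h0 y : 0 <= h y by rewrite mulr_ge0 ?expR_ge0// normal_pdf_ge0.
have EH := @iint_prod R N h _ mh h0 gaussian_exp_square.
pose g (t : N.-tuple R) := expR (- (2 * N%:R)) * \prod_(y <- t) expR (y ^+ 2 / 4).
have mp : measurable_fun setT (fun t : N.-tuple R => \prod_(y <- t) expR (y ^+ 2 / 4)).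
  apply: (@measurable_tuple_prod R N (fun y => expR (y ^+ 2 / 4))).
  by apply: (measurableT_comp (@measurable_expR R)); apply: measurable_funM => //.
have p0 (t : N.-tuple R) : 0 <= \prod_(y <- t) expR (y ^+ 2 / 4).
  by apply: prodr_ge0 => y _; exact: expR_ge0.
apply: (@le_trans _ _ (Ex (gauss N) g)).
  apply: Ex_le => [|||t].
  - exact: measurable_funB.
  - exact: measurable_funM.
  - by move=> t; rewrite indicE; case: (_ \in _); rewrite ?subrr ?subr0.
  - rewrite indicE; case: (boolP (_ \in _)) => tB; first by rewrite subrr mulr_ge0 ?expR_ge0.
    rewrite subr0 /g -expR_sum -expRD -[leLHS]expR0 ler_expR.
    move: tB; rewrite notin_setE /ball_set/= => /negP; rewrite -ltNge => tB.
    rewrite -mulr_suml big_tuple -/(tsq N t); lra.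
rewrite ExZ ?expR_ge0// gaussE//.
have -> : iint (fun t : N.-tuple R => (\prod_(y <- t) expR (y ^+ 2 / 4) * gdens t)%:E) = (Num.sqrt 2 ^+ N)%:E.
  by rewrite -EH; apply: iint_eq => t; rewrite mulrC /gdens -big_split.
rewrite -EFinM lee_fin.
have -> : - N%:R = - (2 * N%:R) + N%:R :> R by ring.
rewrite expRD ler_pM2l ?expR_gt0// -[X in _ <= expR X]mul1r expRM_natr lerXn2r ?nnegrE ?sqrtr_ge0 ?expR_ge0//.
apply: (@le_trans _ _ 2); last by have := expR_ge1Dx (1 : R); lra.
by rewrite -(@ler_pXn2r _ 2) ?nnegrE ?sqrtr_ge0// sqr_sqrtr// expr2; lra.
Qed.

(** On the ball the scaled rows have total squared norm at most 8 l, so one [D] serves all matrices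
    in [smoothed_perturb]. The ball is convex, hence stable under midpoints. *)
Definition truncated_profile a : R := fine (Ex (gauss N) (fun t => \1_ball_set t * smoothed P (rows t) a)).

Let mtr a : measurable_fun setT (fun t : N.-tuple R => \1_ball_set t * smoothed P (rows t) a).
Proof. by apply: measurable_funM => //; exact: measurable_smoothed_rows. Qed.

Let tr0 a t : 0 <= \1_ball_set t * smoothed P (rows t) a.
Proof. by rewrite mulr_ge0// smoothed_ge0. Qed.

Lemma truncated_profileE a :
  Ex (gauss N) (fun t => \1_ball_set t * smoothed P (rows t) a) = (truncated_profile a)%:E.
Proof.
rewrite /truncated_profile fineK// ge0_fin_numE ?Ex_ge0//.
apply: (@le_lt_trans _ _ (Ex (gauss N) (cst 1))); last by rewrite Ex_cst ltry.
apply: Ex_le => // t; rewrite /cst mulr_ile1 ?smoothed_ge0 ?smoothed_le1//.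
Qed.

Lemma truncated_profile_le a : truncated_profile a <= profile a.
Proof.
rewrite -lee_fin -truncated_profileE -Ex_gauss_smoothed; apply: Ex_le => // [|t].
  exact: measurable_smoothed_rows.
by rewrite ler_piMl ?smoothed_ge0// indicE; case: (_ \in _).
Qed.

Lemma truncated_profile_ge a : profile a - expR (- N%:R) <= truncated_profile a.
Proof.
rewrite lerBlDr -lee_fin EFinD -truncated_profileE -Ex_gauss_smoothed.
apply: le_trans (leeD2l _ gauss_large_norm).
have mC : measurable_fun setT (fun t : N.-tuple R => 1 - \1_ball_set t : R).
  exact: measurable_funB.
have C0 t : 0 <= 1 - \1_ball_set t :> R.
  by rewrite indicE; case: (_ \in _); rewrite ?subrr ?subr0.
rewrite -ExD//; apply: Ex_le => // [|||t].
- exact: measurable_smoothed_rows.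
- exact: measurable_funD.
- by move=> t; exact: smoothed_ge0.
- have := smoothed_le1 P (rows t) a; rewrite indicE; case: (_ \in _); rewrite /=; lra.
Qed.

(** For lam = 2 q the distance terms have coefficient (1 / (4 q) + 1/2) q = 1/4 + q/2 <= 1/2. Two
    moves of squared length d/4 then cost together at most d/4, precisely the Gaussian surplus. *)
Let perturbation_exponent (T q d : R) : 0 < q -> q <= 1 / 2 -> 0 <= d ->
  T + (1 / (2 * (2 * q)) + 1 / 2) * (d / 4) * q +
    (T + (1 / (2 * (2 * q)) + 1 / 2) * (d / 4) * q) <= T + T + d / 4.
Proof.
move=> q0 q1 d0.
have -> : (1 / (2 * (2 * q)) + 1 / 2) * (d / 4) * q = (1 / 4 + q / 2) * (d / 4).
  by field; rewrite gt_eqF.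
have : (1 / 4 + q / 2) * (d / 4) <= 1 / 2 * (d / 4) by rewrite ler_wpM2r//; lra.
lra.
Qed.

Let combine_bounds (i j k Fs Ft Fa Fb Fm X e E : R) : i = 1 -> j = 1 -> k = 1 ->
  0 <= Fs -> 0 <= Ft -> 0 <= Fa -> 0 <= Fb -> 0 <= X ->
  Fs <= Fa * X -> Ft <= Fb * X -> Fa * Fb <= Fm ^+ 2 -> X * X <= e ^+ 2 * E ->
  i * Fs * (j * Ft) <= (e * (k * Fm)) ^+ 2 * E.
Proof.
move=> -> -> -> Fs0 Ft0 Fa0 Fb0 X0 HFs HFt HF HX; rewrite !mul1r.
apply: le_trans (ler_pM Fs0 Ft0 HFs HFt) _.
rewrite mulrACA [leRHS](_ : _ = Fm ^+ 2 * (e ^+ 2 * E)); last by ring.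
by apply: ler_pM => //; exact: mulr_ge0.
Qed.

Variables (alpha : R).
Let D : R := l%:R * alpha ^+ 2 + 8 * l%:R.
Let Q : R := weighted_moment_cst D / n%:R.
Hypothesis Q_le : Q <= 1 / 2.

(** Both matrices s and t are moved to their midpoint by [smoothed_perturb] with lam = 2 Q, and
    there [smoothed_midpoint] applies. The surplus pays for |s - t|^2; the two remaining terms 2 Q
    (D + 1) form the defect. *)
Lemma truncated_profile_midpoint a b : 0 <= a <= alpha -> 0 <= b <= alpha ->
  truncated_profile a * truncated_profile b <=
  expR (4 * Q * (D + 1)) * truncated_profile ((a + b) / 2) ^+ 2.
Proof.
move=> a_al b_al.
have D0 : 0 <= D by apply: addr_ge0; rewrite mulr_ge0// sqr_ge0.
have K0 : 0 < weighted_moment_cst D by rewrite /weighted_moment_cst; have := sqr_ge0 D; lra.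
have Q0 : 0 < Q by rewrite divr_gt0.
have lD (t : N.-tuple R) r : ball_set t -> 0 <= r <= alpha ->
    l%:R * r ^+ 2 + \sum_(j < l) sqnorm (rows t j) <= D.
  rewrite /ball_set/= => tB /andP[r0 ra].
  rewrite sum_sqnorm_rows; apply: lerD.
    by rewrite ler_wpM2l// ler_pXn2r// nnegrE// (le_trans r0).
  by rewrite ler_pdivrMr// (le_trans tB)// natrM mulrA.
have perturb (s t : N.-tuple R) r : ball_set s -> 0 <= r <= alpha ->
    smoothed P (rows s) r <= smoothed P (rows t) r *
      expR (2 * Q * (D + 1) + (1 / (2 * (2 * Q)) + 1 / 2) * sqdist N s t * Q).
  move=> sB ral.
  have Q20 : 0 < 2 * Q by rewrite mulr_gt0.
  have := @smoothed_perturb R n l P Plc Piso (rows s) r D (lD s r sB ral) (rows t) (2 * Q) Q20.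
  rewrite sum_sqnorm_rowsB.
  have -> : (1 / (2 * (2 * Q)) + 1 / 2) * (sqdist N s t / n%:R) * weighted_moment_cst D =
    (1 / (2 * (2 * Q)) + 1 / 2) * sqdist N s t * Q by rewrite /Q; ring.
  by rewrite expRN ler_pdivrMr ?expR_gt0.
have tsq_mid (s t : N.-tuple R) : ball_set s -> ball_set t -> ball_set (tmid s t).
  rewrite /ball_set/= => sB tB.
  have : tsq N (tmid s t) <= (tsq N s + tsq N t) / 2.
    rewrite /tsq -big_split/= mulr_suml; apply: ler_sum => i _; rewrite tnth_mktuple.
    have := sqr_ge0 (tnth s i - tnth t i); rewrite !expr2; lra.
  lra.
have dist_mid (s t : N.-tuple R) : sqdist N s (tmid s t) = sqdist N s t / 4 /\
    sqdist N t (tmid s t) = sqdist N s t / 4.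
  by split; rewrite /sqdist mulr_suml; apply: eq_bigr => i _; rewrite tnth_mktuple; field.
have [e eE] : {e | e = expR (2 * Q * (D + 1))} by eexists.
have e0 : 0 <= e by rewrite eE expR_ge0.
have -> : expR (4 * Q * (D + 1)) = e ^+ 2.
  by rewrite eE -expRM_natl; congr expR; ring.
pose w (t : N.-tuple R) := e * (\1_ball_set t * smoothed P (rows t) ((a + b) / 2)).
have mw : measurable_fun setT w by apply: measurable_funM => //; exact: mtr.
have w0 t : 0 <= w t by rewrite mulr_ge0.
have Ew : Ex (gauss N) w = (e * truncated_profile ((a + b) / 2))%:E.
  by rewrite /w (ExZ _ (mtr _) (tr0 _) e0) truncated_profileE -EFinM.
suff H : forall s t : N.-tuple R, \1_ball_set s * smoothed P (rows s) a *
    (\1_ball_set t * smoothed P (rows t) b) <= w (tmid s t) ^+ 2 * expR (sqdist N s t / 4).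
  have := @gauss_prekopa_leindler R N _ _ w (mtr a) (mtr b) mw (tr0 a) (tr0 b) w0 H.
  rewrite (truncated_profileE a) (truncated_profileE b) Ew -!EFinM lee_fin.
  by rewrite -expr2 exprMn.
rewrite /w {w mw w0 Ew}.
have ind1 t : ball_set t -> \1_ball_set t = 1 :> R by move=> tB; rewrite indicE mem_set.
have ind0 t : ~ ball_set t -> \1_ball_set t = 0 :> R by move=> tB; rewrite indicE memNset.
move=> s t.
have rhs0 : 0 <= (e * (\1_ball_set (tmid s t) * smoothed P (rows (tmid s t)) ((a + b) / 2))) ^+ 2 *
    expR (sqdist N s t / 4) by rewrite mulr_ge0 ?expR_ge0// sqr_ge0.
have [sB|/ind0 sB] := pselect (ball_set s); last by rewrite sB mul0r mul0r.
have [tB|/ind0 tB] := pselect (ball_set t); last by rewrite tB mul0r mulr0.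
have [ds dt] := dist_mid s t.
have Hs := perturb s (tmid s t) a sB a_al; have Ht := perturb t (tmid s t) b tB b_al.
rewrite ds in Hs; rewrite dt in Ht.
set X := expR (_ + _) in Hs Ht.
have XX : X * X <= e ^+ 2 * expR (sqdist N s t / 4).
  rewrite /X expr2 eE -!expRD ler_expR; apply: perturbation_exponent => //.
  by apply: sumr_ge0 => i _; exact: sqr_ge0.
have X0 : 0 <= X by exact: expR_ge0.
clearbody X.
exact: (combine_bounds _ _ _ _ _ _ _ _ _ _ _ (ind1 s sB) (ind1 t tB) (ind1 _ (tsq_mid s t sB tB))
  (smoothed_ge0 _ _ _) (smoothed_ge0 _ _ _) (smoothed_ge0 _ _ _) (smoothed_ge0 _ _ _)
  X0 Hs Ht (smoothed_midpoint P Plc _ a b) XX).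
Qed.

End radial_profile.

(** * Concentration from approximate log-concavity *)

Section kernel_bounds.
Context {R : realType}.

(** The reason for an even number 2 k of rows: squaring removes the square root of the Gaussian
    normalization. *)
Lemma profile_kernel_sqr (a s : R) : 0 < s ->
  profile_kernel a s ^+ 2 = expR (- (a ^+ 2 / s)) / s.
Proof.
move=> s0; rewrite exprMn sqr_sqrtr; last by rewrite divr_ge0// ltW.
rewrite -expRM_natl mulrC mul1r; congr (expR _ * _).
by field; rewrite gt_eqF.
Qed.

Lemma peak_bound_upper (a s : R) : 0 < a -> 0 < s ->
  expR (- (a ^+ 2 / s)) / s <= expR (- 1) / a ^+ 2.
Proof.
move=> a0 s0; have a20 : 0 < a ^+ 2 by rewrite exprn_gt0.
set rho := a ^+ 2 / s.
have r0 : 0 < rho by rewrite divr_gt0.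
have -> : s^-1 = rho / a ^+ 2 by rewrite /rho; field; rewrite !gt_eqF.
rewrite mulrA ler_pM2r ?invr_gt0//.
have := expR_ge1Dx (rho - 1); rewrite addrC subrK => H.
rewrite (_ : - 1 = - rho + (rho - 1)); last by ring.
by rewrite expRD ler_pM2l ?expR_gt0.
Qed.

(** The maximum of rho exp(- rho) at 1 is flat: (1 + u) exp(- u) >= exp(- 2 u^2) for u >= -1/2. A
    relative error theta therefore costs only theta^2. *)
Lemma peak_bound_lower (a s theta : R) : 0 < a -> 0 < s -> theta <= 1 / 2 ->
  `|a ^+ 2 / s - 1| <= theta ->
  expR (- 1) / a ^+ 2 * expR (- (2 * theta ^+ 2)) <= expR (- (a ^+ 2 / s)) / s.
Proof.
move=> a0 s0 th; have a20 : 0 < a ^+ 2 by rewrite exprn_gt0.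
have sE : s^-1 = (a ^+ 2 / s) / a ^+ 2 by field; rewrite !gt_eqF.
rewrite [expR (- (a ^+ 2 / s)) / s](_ : _ = expR (- (a ^+ 2 / s)) * (a ^+ 2 / s / a ^+ 2)); last by rewrite -sE.
move: (a ^+ 2 / s) => rho; have [u uE] : {u | u = rho - 1} by eexists.
rewrite -uE => uth; have -> : rho = 1 + u by rewrite uE; ring.
have /andP[u1 u2] : - theta <= u <= theta by rewrite -ler_norml.
have u2th : u ^+ 2 <= theta ^+ 2.
  by rewrite -[u ^+ 2]real_normK ?num_real// ler_pXn2r// nnegrE// (le_trans _ uth).
have key : expR (- (2 * u ^+ 2)) <= (1 + u) * expR (- u).
  have := expR_ge1Dx (2 * u ^+ 2 - u).
  rewrite -(ler_pM2l (expR_gt0 (- (2 * u ^+ 2)))) -expRD.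
  rewrite (_ : - (2 * u ^+ 2) + (2 * u ^+ 2 - u) = - u); last by ring.
  have p1 : 0 <= 1 + u by lra.
  move=> /(ler_wpM2l p1); apply: le_trans.
  rewrite [leRHS]mulrCA ler_peMr ?expR_ge0//.
  have : 0 <= u ^+ 2 * (1 + 2 * u) by rewrite mulr_ge0 ?sqr_ge0//; lra.
  rewrite !expr2; lra.
rewrite mulrAC mulrA ler_pM2r ?invr_gt0//.
rewrite opprD expRD -[leRHS]mulrA ler_pM2l ?expR_gt0// [leRHS]mulrC.
apply: le_trans key; rewrite ler_expR; lra.
Qed.

(* The maximum over s of profile_kernel a s ^+ (2 * k), attained at s = a ^+ 2. *)
Definition peak (k : nat) (a : R) : R := (expR (- 1) / a ^+ 2) ^+ k.

Lemma peak_gt0 k a : 0 < a -> 0 < peak k a.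
Proof. by move=> a0; rewrite exprn_gt0// divr_gt0 ?expR_gt0// exprn_gt0. Qed.

(** Quantitative log-convexity of a^-2: with u = (a - b) / (a + b), a b = ((a + b) / 2)^2 (1 - u^2),
    and 1 - u^2 <= exp(- u^2). *)
Lemma peak_midpoint k (a b : R) : 0 < a -> 0 < b ->
  peak k ((a + b) / 2) ^+ 2 <=
  peak k a * peak k b * expR (- (k%:R * (2 * ((a - b) / (a + b)) ^+ 2))).
Proof.
move=> a0 b0.
rewrite /peak -exprM mulnC exprM -exprMn.
have -> : expR (- (k%:R * (2 * ((a - b) / (a + b)) ^+ 2))) = expR (- (2 * ((a - b) / (a + b)) ^+ 2)) ^+ k.
  by rewrite -expRM_natl mulrN.
rewrite -exprMn; apply: lerXn2r; rewrite ?nnegrE; last first.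
- set u := (a - b) / (a + b).
  have ab0 : 0 < a + b by rewrite addr_gt0.
  have E : (expR (- 1) / ((a + b) / 2) ^+ 2) ^+ 2 =
     expR (- 1) / a ^+ 2 * (expR (- 1) / b ^+ 2) * ((1 - u ^+ 2) ^+ 2).
    by rewrite /u; field; rewrite !gt_eqF.
  rewrite E ler_pM2l; last by rewrite mulr_gt0// divr_gt0 ?expR_gt0// exprn_gt0.
  rewrite (_ : expR (- (2 * u ^+ 2)) = expR (- u ^+ 2) ^+ 2); last by rewrite -expRM_natl mulrN.
  apply: lerXn2r; rewrite ?nnegrE ?expR_ge0//.
    rewrite subr_ge0 /u expr_div_n ler_pdivrMr ?exprn_gt0// mul1r !expr2; nra.
  exact: expR_ge1Dx.
- by rewrite !mulr_ge0 ?expR_ge0// invr_ge0 exprn_ge0// ltW.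
- by rewrite exprn_ge0// divr_ge0 ?expR_ge0// exprn_ge0// divr_ge0// addr_ge0// ltW.
Qed.

Lemma peak_double k (b : R) : 0 < b -> peak k (2 * b) = peak k b * (1 / 4) ^+ k.
Proof. by move=> b0; rewrite /peak -exprMn; congr (_ ^+ k); field; rewrite gt_eqF. Qed.

End kernel_bounds.

Section concentration.
Context {d : measure_display} {T : measurableType d} {R : realType} (P : probability T R).
(** In the application [s] is [noisy_sqnorm], [V] is [profile] and [W] is [truncated_profile]; [tau]
    is the mass lost by truncating the Gaussian and [delta] the midpoint defect. *)
Variables (s : T -> R) (k : nat) (V W : R -> R) (tau delta alpha : R).
Hypotheses (ms : measurable_fun setT s) (s_ge1 : forall x, 1 <= s x) (Es : Ex P s = 2%:E).
Hypothesis mk : forall a, measurable_fun setT (fun x => profile_kernel a (s x) ^+ (2 * k)).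
Hypothesis VE : forall a, Ex P (fun x => profile_kernel a (s x) ^+ (2 * k)) = (V a)%:E.
Hypotheses (W_ge0 : forall a, 0 <= W a) (W_le : forall a, W a <= V a)
  (W_ge : forall a, V a - tau <= W a).
Hypothesis W_mid : forall a b, 0 <= a <= alpha -> 0 <= b <= alpha ->
  W a * W b <= expR delta * W ((a + b) / 2) ^+ 2.
Hypothesis delta_ge0 : 0 <= delta.

Local Notation p A := (fine (P A)).

Let s_gt0 x : 0 < s x. Proof. exact: lt_le_trans (s_ge1 x). Qed.

Let pE A : measurable A -> P A = (p A)%:E.
Proof. by move=> mA; rewrite fineK// fin_num_measure. Qed.

Let p_ge0 A : 0 <= p A. Proof. by rewrite fine_ge0. Qed.

Lemma V_le_peak a : 0 < a -> V a <= peak k a.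
Proof.
move=> a0; rewrite -lee_fin -VE -(Ex_cst P); apply: Ex_le => // x.
  by rewrite exprn_ge0// profile_kernel_ge0.
rewrite exprM profile_kernel_sqr// /cst /peak; apply: lerXn2r; rewrite ?nnegrE.
- by rewrite divr_ge0 ?expR_ge0// ltW.
- by rewrite divr_ge0 ?expR_ge0// exprn_ge0// ltW.
- exact: peak_bound_upper.
Qed.

Lemma V_ge (a g : R) (A : set T) : measurable A -> 0 <= g ->
  (forall x, A x -> g ^+ k <= profile_kernel a (s x) ^+ (2 * k)) -> p A * g ^+ k <= V a.
Proof.
move=> mA g0 H; have mI : measurable_fun setT (\1_A : T -> R) by exact: measurable_indic.
rewrite -lee_fin -VE mulrC EFinM -(pE _ mA) -Ex_indic// -ExZ ?exprn_ge0//.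
apply: Ex_le => // [|x|x]; first exact: measurable_funM.
  by rewrite mulr_ge0// exprn_ge0.
rewrite indicE; case: (boolP (x \in A)) => [/[!inE] Ax|_]; first by rewrite mulr1 H.
by rewrite mulr0 exprn_ge0// profile_kernel_ge0.
Qed.

Lemma V_ge_cell (a theta : R) (A : set T) : measurable A -> 0 < a -> theta <= 1 / 2 ->
  (forall x, A x -> `|a ^+ 2 / s x - 1| <= theta) ->
  p A * (peak k a * expR (- (k%:R * (2 * theta ^+ 2)))) <= V a.
Proof.
move=> mA a0 th H.
rewrite /peak -mulrN expRM_natl -exprMn; apply: V_ge => // [|x Ax].
  by rewrite mulr_ge0 ?expR_ge0// divr_ge0 ?expR_ge0// exprn_ge0// ltW.
rewrite exprM profile_kernel_sqr//; apply: lerXn2r; rewrite ?nnegrE.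
- by rewrite mulr_ge0 ?expR_ge0// divr_ge0 ?expR_ge0// exprn_ge0// ltW.
- by rewrite divr_ge0 ?expR_ge0// ltW.
- by apply: peak_bound_lower => //; exact: H.
Qed.

(** For a^2 <= s the exponential stays above exp(- 1), so a value s far beyond the peak costs only
    the power S^-k. *)
Lemma V_ge_far (a S : R) (A : set T) : measurable A -> 0 < S ->
  (forall x, A x -> a ^+ 2 <= s x <= S) -> p A * (expR (- 1) / S) ^+ k <= V a.
Proof.
move=> mA S0 H; apply: V_ge => // [|x Ax]; first by rewrite divr_ge0 ?expR_ge0// ltW.
have /andP[as_ sS] := H x Ax.
rewrite exprM profile_kernel_sqr//; apply: lerXn2r; rewrite ?nnegrE.
- by rewrite divr_ge0 ?expR_ge0// ltW.
- by rewrite divr_ge0 ?expR_ge0// ltW.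
- apply: ler_pM; rewrite ?expR_ge0 ?invr_ge0 ?(ltW S0)//.
    by rewrite ler_expR lerN2 ler_pdivrMr// mul1r.
  by rewrite lef_pV2// posrE.
Qed.

Lemma W_ge_cell (a theta : R) (A : set T) : measurable A -> 0 < a -> theta <= 1 / 2 ->
  (forall x, A x -> `|a ^+ 2 / s x - 1| <= theta) ->
  2 * tau <= p A * (peak k a * expR (- (k%:R * (2 * theta ^+ 2)))) ->
  p A * (peak k a * expR (- (k%:R * (2 * theta ^+ 2)))) / 2 <= W a.
Proof.
move=> mA a0 th H tA; have := V_ge_cell _ _ _ mA a0 th H; have := W_ge a; lra.
Qed.

(* W is almost log-concave, but lies below the strictly log-convex envelope peak, which it
   nearly touches at a cell of large probability: two such cells cannot be far apart. *)
Lemma far_cells (a b theta kappa q : R) (A : set T) : measurable A ->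
  0 < a <= alpha -> 0 < b <= alpha -> theta <= 1 / 2 -> 0 < q ->
  (forall x, A x -> `|a ^+ 2 / s x - 1| <= theta) ->
  q * (peak k b * expR (- (k%:R * (2 * theta ^+ 2)))) / 2 <= W b ->
  kappa <= ((a - b) / (a + b)) ^+ 2 ->
  2 * tau <= p A * (peak k a * expR (- (k%:R * (2 * theta ^+ 2)))) ->
  p A * q <= 4 * expR (delta + k%:R * (4 * theta ^+ 2 - 2 * kappa)).
Proof.
move=> mA /andP[a0 aal] /andP[b0 bal] th q0 H WB kap tA.
have WA := W_ge_cell _ _ _ mA a0 th H tA.
have ga := peak_gt0 k a a0; have gb := peak_gt0 k b b0.
set E := expR (- (k%:R * (2 * theta ^+ 2))) in WA WB tA.
have E0 : 0 < E by exact: expR_gt0.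
have m0 : 0 < (a + b) / 2 by rewrite divr_gt0// addr_gt0.
have W1 : W a * W b <= expR delta * (peak k a * peak k b * expR (- (k%:R * (2 * kappa)))).
  apply: le_trans (W_mid a b _ _) _; [by rewrite aal ltW|by rewrite bal ltW|].
  rewrite ler_pM2l ?expR_gt0//.
  apply: (@le_trans _ _ (peak k ((a + b) / 2) ^+ 2)).
    by apply: lerXn2r; rewrite ?nnegrE ?(ltW (peak_gt0 k _ m0))//; apply: le_trans (V_le_peak _ m0).
  apply: le_trans (peak_midpoint k _ _ a0 b0) _.
  by rewrite ler_pM2l ?mulr_gt0// ler_expR lerN2 ler_wpM2l//; lra.
have W2 : (p A * (peak k a * E) / 2) * (q * (peak k b * E) / 2) <= W a * W b.
  by apply: ler_pM => //; rewrite !mulr_ge0 ?invr_ge0// ltW.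
have W3 := le_trans W2 W1.
have gab : 0 < peak k a * peak k b by rewrite mulr_gt0.
rewrite -(ler_pM2l gab) -(ler_pM2r (mulr_gt0 E0 E0)).
have -> : expR (delta + k%:R * (4 * theta ^+ 2 - 2 * kappa)) =
   expR delta * expR (- (k%:R * (2 * kappa))) * expR (k%:R * (4 * theta ^+ 2)).
  by rewrite -!expRD; congr expR; ring.
have EE : expR (k%:R * (4 * theta ^+ 2)) * (E * E) = 1.
  by rewrite /E -!expRD -expR0; congr expR; ring.
move: EE W3; move: (expR (k%:R * (4 * _))) (expR delta) (expR (- (k%:R * (2 * kappa)))) => e1 e2 e3 EE W3.
have -> : peak k a * peak k b * (4 * (e2 * e3 * e1)) * (E * E) =
   4 * (e2 * (peak k a * peak k b * e3)) * (e1 * (E * E)) by ring.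
rewrite EE mulr1; lra.
Qed.

Section cells.
Variable N0 : nat.
Hypothesis N0_gt0 : (0 < N0)%N.
Let h : R := N0%:R^-1.
Let node (i : nat) : R := 1 + i%:R * h.
(** Cells of equal width in sqrt s, since s is detected at a = sqrt s, where the envelope [peak] is
    attained. *)
Let cell (i : nat) : set T := [set x | node i ^+ 2 <= s x] `&` [set x | s x < (node i + h) ^+ 2].

Let h_gt0 : 0 < h. Proof. by rewrite invr_gt0 ltr0n. Qed.
Let h_le1 : h <= 1. Proof. by rewrite invf_le1 ?ltr0n// ler1n. Qed.
Let node_ge1 i : 1 <= node i. Proof. by rewrite lerDl mulr_ge0// ltW. Qed.
Let nodeS i : node i.+1 = node i + h. Proof. by rewrite /node -natr1; ring. Qed.

Let mcell i : measurable (cell i).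
Proof.
apply: measurableI.
  have -> : [set x | node i ^+ 2 <= s x] = ~` [set x | - node i ^+ 2 < - s x].
    by apply/seteqP; split => x /=; rewrite ltrN2 leNgt => /negP.
  by apply: measurableC; apply: measurable_superlevel; exact: measurable_funN.
have -> : [set x | s x < (node i + h) ^+ 2] = [set x | - (node i + h) ^+ 2 < - s x].
  by apply/seteqP; split => x /=; rewrite ltrN2.
by apply: measurable_superlevel; exact: measurable_funN.
Qed.

Let cell_close i x : cell i x -> `|node i ^+ 2 / s x - 1| <= 3 * h.
Proof.
move=> [/= l1 l2]; have n1 := node_ge1 i; have n0 : 0 < node i by lra.
have sx := s_gt0 x.
have r1 : node i ^+ 2 / s x <= 1 by rewrite ler_pdivrMr// mul1r.
rewrite ler0_norm; last by lra.
rewrite opprB lerBlDr -lerBlDl ler_pdivlMr//.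
have : (1 - 3 * h) * s x <= node i ^+ 2 - 0.
  rewrite subr0; have [H|H] := leP (1 - 3 * h) 0.
    have : (1 - 3 * h) * s x <= 0 by rewrite mulr_le0_ge0// ltW.
    by have := sqr_ge0 (node i); lra.
  apply: (@le_trans _ _ ((1 - 3 * h) * (node i + h) ^+ 2)).
    by rewrite ler_wpM2l ?ltW.
  move: (node i) n1 h h_gt0 h_le1 => a a1 e e0 e1.
  have A1 : 0 <= e * (3 * (a * a) - 2 * a - e) by apply: mulr_ge0; [exact: ltW|nra].
  have A2 : 0 <= e * e * (6 * a + 3 * e) by apply: mulr_ge0; [rewrite mulr_ge0 ?(ltW e0)|lra].
  rewrite !expr2; lra.
lra.
Qed.

Let cell_cover N x : s x < node N ^+ 2 -> exists2 i, (i < N)%N & cell i x.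
Proof.
elim: N => [|N IH] sN.
  by move: sN; rewrite /node mul0r addr0 expr1n ltNge s_ge1.
have [H|H] := ltP (s x) (node N ^+ 2).
  by have [i iN ci] := IH H; exists i => //; rewrite ltnW.
by exists N => //; split => //=; rewrite -nodeS.
Qed.

(** By Markov, E s = 2 gives s < 4 with probability at least 1/2, and the first [N0] cells cover [1,
    4). *)
Let typical_cell : exists2 i, (i < N0)%N & (2 * N0%:R)^-1 <= p (cell i).
Proof.
apply: contrapT => H.
have lt_p (i : 'I_N0) : p (cell i) < (2 * N0%:R)^-1.
  by rewrite ltNge; apply/negP => Hi; apply: H; exists i.
have mI i : measurable_fun setT (\1_(cell i) : T -> R) by exact: measurable_indic.
have mS : measurable_fun setT (fun x => \sum_(i < N0) \1_(cell i) x : R).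
  by apply: measurable_sum.
have S0 x : 0 <= \sum_(i < N0) \1_(cell i) x :> R by exact: sumr_ge0.
have m4 : measurable_fun setT (fun x => 4^-1 * s x) by exact: measurable_funM.
have s40 x : 0 <= 4^-1 * s x by rewrite mulr_ge0 ?ltW ?invr_gt0.
have : (1%:E <= (\sum_(i < N0) p (cell i) + 4^-1 * 2)%:E)%E.
  rewrite EFinD EFinM -Es -sumEFin.
  under eq_bigr do rewrite -pE// -Ex_indic//.
  rewrite -Ex_sum// -ExZ//; last by move=> x; exact: ltW.
  rewrite -ExD// -(Ex_cst P); apply: Ex_le => // [|x].
  - exact: measurable_funD.
  - have [H4|H4] := leP 4 (s x); first by rewrite /cst; have := S0 x; lra.
    have [|i iN ci] := cell_cover N0 x.
      by rewrite /node divff ?gt_eqF ?ltr0n//; rewrite expr2; lra.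
    rewrite /cst (bigD1 (Ordinal iN))//= indicE mem_set//= mulr1n.
    have : 0 <= \sum_(i0 < N0 | i0 != Ordinal iN) \1_(cell i0) x :> R by exact: sumr_ge0.
    by have := s40 x; lra.
rewrite lee_fin.
have : \sum_(i < N0) p (cell i) < \sum_(i < N0) (2 * N0%:R)^-1.
  apply: ltr_sum => //; by apply/hasP; exists (Ordinal N0_gt0); rewrite ?mem_index_enum.
rewrite sumr_const card_ord -[X in _ < X]mulr_natl => H1 H2.
have E : N0%:R * (2 * N0%:R)^-1 = 1 / 2 :> R by field; rewrite gt_eqF// ltr0n.
by rewrite E in H1; lra.
Qed.

(** [pc] bounds the probability of each cell at distance at least [kap] from the typical one, [pb]
    that of s between about 4^m and [S], and [zeta] the mean of s above [S]; [r] is the decay ratio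
    of [W] under doubling. *)
Variables (m : nat) (r kap pc pb S zeta : R).
Let theta : R := 3 * h.
Let E : R := expR (- (k%:R * (2 * theta ^+ 2))).
Hypotheses (theta_le : theta <= 1 / 2) (alpha_ge : 3 + 2 ^+ m.+1 <= alpha)
  (S_ge : alpha ^+ 2 <= S) (kap_gt0 : 0 < kap) (kap_le : kap <= 1 / 2) (r_ge0 : 0 <= r).
Hypothesis pc_tau : 2 * tau <= pc * (peak k alpha * E).
Hypothesis pc_exp : 8 * N0%:R * expR (delta + k%:R * (4 * theta ^+ 2 - 2 * (kap / 5) ^+ 2)) <= pc.
Hypothesis tau_typical : 2 * tau <= (2 * N0%:R)^-1 * (peak k 2 * E).
Hypothesis r_ge : expR delta * (1 / 4) ^+ k <= r * ((2 * N0%:R)^-1 * E / 2).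
Hypothesis pb_ge : r ^+ (2 ^ m) + tau <= pb * (expR (- 1) / S) ^+ k.
Hypothesis zeta_ge : (Ex P (fun x => s x * \1_[set x | S < s x] x)%R <= zeta%:E)%E.

Let E_gt0 : 0 < E. Proof. exact: expR_gt0. Qed.
Let N0R : 0 < N0%:R :> R. Proof. by rewrite ltr0n. Qed.
Let q : R := (2 * N0%:R)^-1.
Let q_gt0 : 0 < q. Proof. by rewrite invr_gt0 mulr_gt0. Qed.

Let peak_anti (a b : R) : 0 < a -> a <= b -> peak k b <= peak k a.
Proof.
move=> a0 ab; have b0 : 0 < b by exact: lt_le_trans ab.
apply: lerXn2r; rewrite ?nnegrE ?divr_ge0 ?expR_ge0 ?exprn_ge0 ?(ltW a0) ?(ltW b0)//.
rewrite ler_pM2l ?expR_gt0// lef_pV2 ?posrE ?exprn_gt0//.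
by rewrite ler_pXn2r// nnegrE ltW.
Qed.

Let alpha_ge5 : 5 <= alpha.
Proof.
apply: le_trans alpha_ge; have : (1 : R) <= 2 ^+ m by rewrite exprn_ege1//; lra.
rewrite exprS; lra.
Qed.

Let pc_ge0 : 0 <= pc.
Proof. by apply: le_trans pc_exp; rewrite !mulr_ge0 ?expR_ge0. Qed.

(** Bounds the mean of s over the exceptional set, as required to compare the typical value with E s
    = 2. The weight [S] dominates s there, and since s >= 1 the probability is bounded as well. *)
Definition exceptional_bound : R := S * ((N0 * (2 + 2 ^ m.+1))%N%:R * pc + pb) + zeta.

Section typical_node.
Variable (i0 : nat).
Hypotheses (i0_lt : (i0 < N0)%N) (i0_p : q <= p (cell i0)).
Let b : R := node i0.

Let b_ge1 : 1 <= b. Proof. exact: node_ge1. Qed.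
Let b_gt0 : 0 < b. Proof. exact: lt_le_trans b_ge1. Qed.
Let b_le2 : b <= 2.
Proof.
have : i0%:R * h <= 1 by rewrite ler_pdivrMr// mul1r ler_nat ltnW.
rewrite /b /node; lra.
Qed.

Let Wb_ge : q * (peak k b * E) / 2 <= W b.
Proof.
have pk := peak_anti b 2 b_gt0 b_le2.
have g0 : 0 <= peak k b * E by rewrite mulr_ge0 ?(ltW E_gt0)// ltW// peak_gt0.
have H : q * (peak k b * E) <= p (cell i0) * (peak k b * E) by rewrite ler_wpM2r.
have T2 : 2 * tau <= p (cell i0) * (peak k b * E).
  apply: le_trans tau_typical _; apply: le_trans H.
  by rewrite ler_pM2l// ler_pM2r.
have := W_ge_cell b theta _ (mcell i0) b_gt0 theta_le (cell_close i0) T2.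
by apply: le_trans; rewrite ler_pM2r.
Qed.

Let Wb_gt0 : 0 < W b.
Proof.
have pk := peak_gt0 k b b_gt0.
by apply: lt_le_trans Wb_ge; rewrite divr_gt0// mulr_gt0// mulr_gt0.
Qed.

Let Wb_le1 : W b <= 1.
Proof.
apply: le_trans (W_le b) _; apply: le_trans (V_le_peak _ b_gt0) _.
have e1 : expR (- 1) <= 1 :> R by rewrite -[leRHS]expR0 ler_expR; lra.
have b21 : 1 <= b ^+ 2 by exact: exprn_ege1.
apply: exprn_ile1; first by rewrite divr_ge0 ?expR_ge0// exprn_ge0// ltW.
by rewrite ler_pdivrMr ?exprn_gt0// mul1r; lra.
Qed.

Let atypical_cell i : node i <= alpha -> kap <= `|node i - b| -> p (cell i) <= pc.
Proof.
move=> ia ki; have bl2 := b_le2; have al5 := alpha_ge5; have n1 := node_ge1 i; have n0 : 0 < node i by exact: lt_le_trans n1.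
have gn : 0 < peak k (node i) * E by rewrite mulr_gt0// peak_gt0.
(* A cell too light to show above the truncation loss is already below [pc]; otherwise [far_cells]
   applies. *)
have [H|H] := leP (2 * tau) (p (cell i) * (peak k (node i) * E)); last first.
  rewrite -(ler_pM2r gn); apply/ltW/(lt_le_trans H)/(le_trans pc_tau).
  by rewrite ler_wpM2l// ler_pM2r// peak_anti.
have nb0 : 0 < node i + b by rewrite addr_gt0.
(* As b <= 2, node i + b <= 4 + |node i - b|; with |node i - b| >= kap and kap <= 1 the quotient is
   at least kap / 5. *)
have ku : (kap / 5) ^+ 2 <= ((node i - b) / (node i + b)) ^+ 2.
  rewrite -[leRHS]real_normK ?num_real//.
  have : kap / 5 <= `|(node i - b) / (node i + b)|.
    rewrite normrM normfV (gtr0_norm nb0) ler_pdivlMr// mulrAC ler_pdivrMr//.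
    have : node i + b <= 4 + `|node i - b| by have := ler_norm (node i - b); lra.
    have : 0 <= (1 - kap) * `|node i - b| by rewrite mulr_ge0//; have := kap_le; lra.
    move=> A1 /(ler_wpM2l (ltW kap_gt0)) A2; lra.
  by move=> H2; rewrite ler_pXn2r// nnegrE ?divr_ge0// ltW.
have nal : 0 < node i <= alpha by rewrite n0.
have bal : 0 < b <= alpha by rewrite b_gt0; lra.
have := far_cells _ _ theta _ q _ (mcell i) nal bal theta_le q_gt0 (cell_close i) Wb_ge ku H.
move=> F; apply: le_trans pc_exp.
rewrite -ler_pdivlMr// invrK in F; apply: le_trans F _.
by rewrite le_eqVlt; apply/orP; left; apply/eqP; ring.
Qed.

(** b (1 + 2^j) is the midpoint of b and b (1 + 2^(j+1)), so each doubling squares the ratio to W b.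
    It starts from the envelope, which drops by 4^-k between b and 2 b while W b nearly attains it.
    The factor exp(delta) on the left makes the defect reproduce itself. *)
Let dyadic j : b * (1 + 2 ^+ j) <= alpha -> expR delta * W (b * (1 + 2 ^+ j)) <= W b * r ^+ (2 ^ j).
Proof.
have bl2 := b_le2; have al5 := alpha_ge5.
elim: j => [|j IH] jal.
  rewrite expr0 expn0 expr1 (_ : b * (1 + 1) = 2 * b); last by ring.
  have b20 : 0 < 2 * b by rewrite mulr_gt0.
  have V2 := le_trans (W_le (2 * b)) (V_le_peak _ b20).
  rewrite peak_double// in V2.
  apply: (@le_trans _ _ (peak k b * (expR delta * (1 / 4) ^+ k))).
    by rewrite [leRHS]mulrCA ler_pM2l ?expR_gt0.
  apply: (@le_trans _ _ (peak k b * (r * (q * E / 2)))).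
    by rewrite ler_pM2l ?peak_gt0.
  have -> : peak k b * (r * (q * E / 2)) = q * (peak k b * E) / 2 * r by ring.
  exact: ler_wpM2r r_ge0 _ _ Wb_ge.
have p2 : (1 : R) <= 2 ^+ j by rewrite exprn_ege1//; lra.
have jal' : b * (1 + 2 ^+ j) <= alpha.
  by apply: le_trans jal; rewrite ler_pM2l// exprS; lra.
have bj0 : 0 <= b * (1 + 2 ^+ j.+1).
  by rewrite mulr_ge0 ?(ltW b_gt0)// addr_ge0// exprn_ge0.
have bal : 0 <= b <= alpha by rewrite (ltW b_gt0)/=; lra.
have := W_mid (b * (1 + 2 ^+ j.+1)) b _ bal; rewrite bj0 jal => /(_ isT).
rewrite (_ : (b * (1 + 2 ^+ j.+1) + b) / 2 = b * (1 + 2 ^+ j)); last first.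
  by rewrite exprS; field.
have {IH}IH := IH jal'.
move: IH; set w := W (b * (1 + 2 ^+ j)); set w' := W (b * (1 + 2 ^+ j.+1)) => IH M.
have e0 : 0 <= expR delta by exact: expR_ge0.
have sq : (expR delta * w) ^+ 2 <= (W b * r ^+ (2 ^ j)) ^+ 2.
  rewrite ler_pXn2r// nnegrE mulr_ge0//; first exact: W_ge0.
  by rewrite exprn_ge0.
have M' := ler_wpM2l e0 M.
rewrite -(ler_pM2r Wb_gt0) expnS mulnC exprM.
have -> : W b * (r ^+ (2 ^ j)) ^+ 2 * W b = (W b * r ^+ (2 ^ j)) ^+ 2 by ring.
by apply: le_trans sq; rewrite -mulrA exprMn expr2 -mulrA.
Qed.

Let b' : R := b * (1 + 2 ^+ m).

Let b'_le : b' <= 2 + 2 ^+ m.+1.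
Proof.
have bl2 := b_le2.
have : (0 : R) <= 2 ^+ m by rewrite exprn_ge0.
by move=> p2; have : b' <= 2 * (1 + 2 ^+ m) by [rewrite ler_wpM2r//; lra]; rewrite exprS; lra.
Qed.

Let far : set T := [set x | b' ^+ 2 <= s x] `&` [set x | s x <= S].

Let mfar : measurable far.
Proof.
apply: measurableI.
  have -> : [set x | b' ^+ 2 <= s x] = ~` [set x | - b' ^+ 2 < - s x].
    by apply/seteqP; split => x /=; rewrite ltrN2 leNgt => /negP.
  by apply: measurableC; apply: measurable_superlevel; exact: measurable_funN.
have -> : [set x | s x <= S] = ~` [set x | S < s x].
  by apply/seteqP; split => x /=; rewrite leNgt => /negP.
by apply: measurableC; exact: measurable_superlevel.
Qed.

Let S_gt0 : 0 < S.
Proof. have al5 := alpha_ge5; by apply: lt_le_trans S_ge; rewrite exprn_gt0//; lra. Qed.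

(** Mass in this region would keep V at b' above (exp(- 1) / S)^k times that mass, but W b' has
    decayed to r^(2^m). *)
Let far_small : p far <= pb.
Proof.
have eS : 0 < (expR (- 1) / S) ^+ k by rewrite exprn_gt0// divr_gt0 ?expR_gt0.
rewrite -(ler_pM2r eS); apply: le_trans pb_ge.
have F : forall x, far x -> b' ^+ 2 <= s x <= S by move=> x [/= -> ->].
apply: le_trans (V_ge_far b' S far mfar S_gt0 F) _.
have : W b' <= r ^+ (2 ^ m).
  have H := dyadic m (le_trans b'_le _); have {}H := H (le_trans _ alpha_ge).
  have {H}H : expR delta * W b' <= W b * r ^+ (2 ^ m) by apply: H; lra.
  apply: (@le_trans _ _ (expR delta * W b')).
    by rewrite ler_peMl ?W_ge0// -expR0 ler_expR.
  by apply: le_trans H _; rewrite ler_piMl// exprn_ge0.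
have := W_ge b'; lra.
Qed.

Let N : nat := (N0 * (2 + 2 ^ m.+1))%N.

Let nodeN : node N = 3 + 2 ^+ m.+1.
Proof.
rewrite /node /N natrM natrD natrX mulrAC divff ?mul1r; last by rewrite gt_eqF.
ring.
Qed.

Let node_le i j : (i <= j)%N -> node i <= node j.
Proof. by move=> ij; rewrite lerD2l ler_pM2r// ler_nat. Qed.

(** A majorant of s wherever s is not close to b^2: distant cells, the intermediate region up to
    [S], and s itself above [S]. *)
Let Z (x : T) : R := \sum_(i < N) (S * (kap <= `|node i - b|)%R%:R) * \1_(cell i) x +
  (S * \1_far x + s x * \1_[set x | S < s x] x).

Let mlargeI : measurable_fun setT (\1_[set x | S < s x] : T -> R).
Proof. by apply: measurable_indic; exact: measurable_superlevel. Qed.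

Let w_ge0 i : 0 <= S * (kap <= `|node i - b|)%R%:R.
Proof. by rewrite mulr_ge0// ltW. Qed.

Let mterm i : measurable_fun setT (fun x => (S * (kap <= `|node i - b|)%R%:R) * \1_(cell i) x).
Proof. exact: measurable_funM. Qed.

Let term_ge0 i x : 0 <= (S * (kap <= `|node i - b|)%R%:R) * \1_(cell i) x.
Proof. by rewrite mulr_ge0. Qed.

Let mZ : measurable_fun setT Z.
Proof.
apply: measurable_funD; first by apply: measurable_sum.
by apply: measurable_funD; exact: measurable_funM.
Qed.

Let Z_ge0 x : 0 <= Z x.
Proof.
apply: addr_ge0; first by apply: sumr_ge0.
by apply: addr_ge0; rewrite mulr_ge0// ltW.
Qed.

Let EZ : (Ex P Z <= exceptional_bound%:E)%E.
Proof.
rewrite /Z ExD; last 4 first.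
- by apply: measurable_sum.
- by apply: measurable_funD; exact: measurable_funM.
- by move=> x; apply: sumr_ge0.
- by move=> x; apply: addr_ge0; rewrite mulr_ge0// ltW.
rewrite ExD; last 4 first.
- exact: measurable_funM.
- exact: measurable_funM.
- by move=> x; rewrite mulr_ge0// ltW.
- by move=> x; rewrite mulr_ge0// ltW.
rewrite Ex_sum// /exceptional_bound.
rewrite -/N.
have -> : S * (N%:R * pc + pb) + zeta = S * (N%:R * pc) + (S * pb + zeta) by ring.
rewrite EFinD; apply: leeD.
  have -> : S * (N%:R * pc) = \sum_(i < N) S * pc.
    by rewrite sumr_const card_ord -[RHS]mulr_natl; ring.
  rewrite -sumEFin; apply: lee_sum => i _.
  rewrite ExZ// Ex_indic// pE// -EFinM lee_fin -mulrA ler_pM2l//.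
  case: (leP kap `|node i - b|) => [ki|_]; last by rewrite mul0r.
  rewrite mul1r; apply: atypical_cell => //.
  apply: le_trans alpha_ge; rewrite -nodeN; apply: node_le; exact: ltnW.
rewrite EFinD; apply: leeD => //.
rewrite ExZ ?(ltW S_gt0)// Ex_indic// pE// -EFinM lee_fin ler_pM2l//.
Qed.

Let dichotomy x : `|s x - b ^+ 2| <= 5 * (kap + h) \/ s x <= Z x.
Proof.
have Z3 : 0 <= s x * \1_[set x | S < s x] x by rewrite mulr_ge0// ltW.
have Z2 : 0 <= S * \1_far x by rewrite mulr_ge0// ltW.
have Z1 : 0 <= \sum_(i < N) (S * (kap <= `|node i - b|)%R%:R) * \1_(cell i) x by apply: sumr_ge0.
have [Ss|sS] := ltP S (s x).
  right; rewrite /Z [X in _ + (_ + _ * X)]indicE mem_set//= mulr1n mulr1; lra.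
have [bs|sb] := leP (b' ^+ 2) (s x).
  right; rewrite /Z [X in _ + (_ * X + _)]indicE mem_set//= mulr1n mulr1; lra.
have sN : s x < node N ^+ 2.
  apply: lt_le_trans sb _; rewrite nodeN ler_pXn2r// ?nnegrE.
  - by have := b'_le; lra.
  - by rewrite mulr_ge0 ?(ltW b_gt0)// addr_ge0// exprn_ge0.
  - by rewrite addr_ge0// exprn_ge0.
have [i iN ci] := cell_cover N x sN.
have [ki|ik] := leP kap `|node i - b|.
  right; rewrite /Z (bigD1 (Ordinal iN))//= ki indicE mem_set//= !mulr1n !mulr1.
  have : 0 <= \sum_(i0 < N | i0 != Ordinal iN) (S * (kap <= `|node i0 - b|)%R%:R) * \1_(cell i0) x.
    by apply: sumr_ge0.
  lra.
left; move: ci => [/= c1 c2].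
have bl2 := b_le2; have bg1 := b_ge1.
have n1 := node_ge1 i.
move: ik; rewrite ltr_norml => /andP[k1 k2].
have e0 := h_gt0; have e1 := h_le1.
have p1 := kap_gt0; have p2 := kap_le.
(* The constant 5 comes from (b + e)^2 - b^2 = e (2 b + e) with e = kap + h <= 1 and b <= 2. *)
rewrite ler_norml; apply/andP; split.
  have : (b - kap) ^+ 2 <= node i ^+ 2 by rewrite ler_pXn2r// ?nnegrE; lra.
  have : 0 <= kap * (2 - b) by rewrite mulr_ge0//; lra.
  have : 0 <= kap * kap by rewrite mulr_ge0//; lra.
  rewrite !expr2 in c1 *; lra.
have : (node i + h) ^+ 2 <= (b + kap + h) ^+ 2 by rewrite ler_pXn2r// ?nnegrE; lra.
have t1 : 0 <= (kap + h) * (2 - b) by rewrite mulr_ge0//; lra.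
have t4 : h <= 1 / 6 by move: theta_le; rewrite /theta; lra.
have t5 : 0 <= (kap + h) * (1 - (kap + h)) by rewrite mulr_ge0//; lra.
move=> t3; rewrite !expr2 in c2 t3 *; lra.
Qed.

Let center_le : 2 <= b ^+ 2 + 5 * (kap + h) + exceptional_bound.
Proof.
rewrite -lee_fin -Es EFinD; apply: le_trans (leeD2l _ EZ).
rewrite -(Ex_cst P) -ExD//; last by move=> x; rewrite /cst addr_ge0 ?sqr_ge0// mulr_ge0// addr_ge0// ltW.
apply: Ex_le => // [|x|x]; first exact: measurable_funD.
  exact: ltW.
have := Z_ge0 x; rewrite /cst.
have [H|H] := dichotomy x; first by have := ler_norm (s x - b ^+ 2); lra.
have := sqr_ge0 b; have := h_gt0; have := kap_gt0; lra.
Qed.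

(** The mean of b^2 <= s + 5 (kap + h) + 4 Z. Off the good set Z >= s >= 1 while b^2 <= 4, whence
    the factor 4. *)
Let center_ge : b ^+ 2 <= 2 + 5 * (kap + h) + 4 * exceptional_bound.
Proof.
have c0 : 0 <= 5 * (kap + h) by have := h_gt0; have := kap_gt0; lra.
have m4 : measurable_fun setT (fun x => 4 * Z x) by exact: measurable_funM.
have m1 : measurable_fun setT (fun x => s x + cst (5 * (kap + h)) x) by exact: measurable_funD.
have E4 : (4%:E * Ex P Z <= (4 * exceptional_bound)%:E)%E by rewrite EFinM lee_pmul2l// lte_fin.
rewrite -lee_fin [leRHS]EFinD; apply: le_trans (leeD2l _ E4).
rewrite EFinD -Es -(Ex_cst P (b ^+ 2)) -(Ex_cst P (5 * (kap + h))) -ExZ// -ExD//; last by move=> x; exact: ltW.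
rewrite -ExD//; last 2 first.
- by move=> x; rewrite addr_ge0// ltW.
- by move=> x; rewrite mulr_ge0.
apply: Ex_le => // [|x|x]; first exact: measurable_funD.
  exact: sqr_ge0.
have := Z_ge0 x; have := s_ge1 x; rewrite /cst.
have [H|H] := dichotomy x.
  by have := ler_norm (b ^+ 2 - s x); rewrite distrC; lra.
have : b ^+ 2 <= 4.
  rewrite (_ : 4 = 2 ^+ 2); last by rewrite expr2; lra.
  by rewrite ler_pXn2r// nnegrE; have := b_le2; have := b_ge1; lra.
lra.
Qed.

(** Near b^2 the triangle inequality keeps |s - 2| below eps, since b^2 is close to the mean 2.
    Elsewhere Z >= s >= 1, so the indicator of the deviation is at most Z. *)
Lemma deviation_from_typical (eps : R) : 10 * (kap + h) + 4 * exceptional_bound < eps ->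
  (P [set x | (eps <= `|s x - 2|)%R] <= exceptional_bound%:E)%E.
Proof.
move=> He.
have mD : measurable [set x | eps <= `|s x - 2|].
  have -> : [set x | eps <= `|s x - 2|] = ~` [set x | - eps < - `|s x - 2|].
    by apply/seteqP; split => x /=; rewrite ltrN2 leNgt => /negP.
  apply: measurableC; apply: measurable_superlevel; apply: measurable_funN.
  by apply: measurableT_comp => //; exact: measurable_funB.
have mDI : measurable_fun setT (\1_[set x | eps <= `|s x - 2|] : T -> R) by exact: measurable_indic.
apply: le_trans EZ; rewrite -Ex_indic//; apply: Ex_le => // x.
rewrite indicE; case: (boolP (_ \in _)) => [/[!inE]/= D|_]; last exact: Z_ge0.
rewrite mulr1n; have [H|H] := dichotomy x; last by have := s_ge1 x; lra.
have := center_le; have := center_ge => c1 c2.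
exfalso; move: D; rewrite leNgt => /negP; apply; apply: le_lt_trans He.
have eb : 0 <= exceptional_bound.
  by rewrite -lee_fin; apply: le_trans EZ; exact: Ex_ge0.
move: H; rewrite !ler_norml => /andP[h1 h2]; apply/andP; split; lra.
Qed.

End typical_node.

Theorem concentration_from_midpoint (eps : R) :
  10 * (kap + N0%:R^-1) + 4 * exceptional_bound < eps ->
  (P [set x | (eps <= `|s x - 2|)%R] <= exceptional_bound%:E)%E.
Proof. by have [i0 i0N i0p] := typical_cell; exact: (deviation_from_typical i0). Qed.

End cells.
End concentration.

(** * Choice of parameters *)

Section moments.
Context {R : realType} {n : nat} (P : probability (n.-tuple R) R).
Hypotheses (n_gt0 : (0 < n)%N) (Plc : log_concave_prob P) (Piso : isotropic_prob P).

Let unit_vec (i : 'I_n) : 'I_n -> R := fun j => (j == i)%:R.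

Let dot_unit i x : dot (unit_vec i) x = tnth x i.
Proof.
rewrite /dot (bigD1 i)//= big1 => [|j ji]; first by rewrite /unit_vec eqxx mul1r addr0.
by rewrite /unit_vec (negbTE ji) mul0r.
Qed.

Let sqnorm_unit i : \sum_(j < n) unit_vec i j ^+ 2 = 1.
Proof.
rewrite (bigD1 i)//= big1 => [|j ji]; first by rewrite /unit_vec eqxx expr1n addr0.
by rewrite /unit_vec (negbTE ji) expr0n.
Qed.

Let n0 : 0 < n%:R :> R. Proof. by rewrite ltr0n. Qed.

Lemma Ex_noisy_sqnorm : Ex P noisy_sqnorm = 2%:E.
Proof.
have mi (i : 'I_n) : measurable_fun setT (fun x : n.-tuple R => tnth x i ^+ 2).
  by apply: measurable_funX; exact: measurable_tnth.
have mS : measurable_fun setT (fun x : n.-tuple R => \sum_(i < n) tnth x i ^+ 2).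
  by apply: measurable_sum.
have S0 (x : n.-tuple R) : 0 <= \sum_(i < n) tnth x i ^+ 2 by apply: sumr_ge0 => i _; exact: sqr_ge0.
have -> : noisy_sqnorm = (fun x : n.-tuple R => cst 1 x + n%:R^-1 * \sum_(i < n) tnth x i ^+ 2).
  by apply/funext => x; rewrite /noisy_sqnorm mulrC.
have ni0 : (0 : R) <= n%:R^-1 by rewrite invr_ge0 ltW.
rewrite ExD//; last 2 first.
- exact: measurable_funM.
- by move=> x; rewrite mulr_ge0.
rewrite Ex_cst (ExZ P mS S0 ni0) Ex_sum//; last by move=> i x; exact: sqr_ge0.
have E1 i : Ex P (fun x => tnth x i ^+ 2) = 1%:E.
  by rewrite -(sqnorm_unit i) -Piso; congr Ex; apply/funext => x; rewrite dot_unit.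
under eq_bigr do rewrite E1.
rewrite sumEFin sumr_const card_ord -EFinM -EFinD mulVf ?gt_eqF//.
Qed.

(** Where the left side is positive, |y| >= t / 2. Half of the rate 1/8 absorbs the square, and the
    other half yields exp(- t / 32). *)
Let coordinate_excess (y t : R) : 1 <= t ->
  y ^+ 2 - t ^+ 2 / 2 <= 32 ^+ 2 * expR (- (t / 32)) * expR (`|y| / 8).
Proof.
move=> t1; have [H|H] := leP (y ^+ 2) (t ^+ 2 / 2).
  apply: (@le_trans _ _ 0); first lra.
  apply: mulr_ge0; last exact: expR_ge0.
  by apply: mulr_ge0; [exact: sqr_ge0|exact: expR_ge0].
have u0 : 0 <= `|y| by [].
have y2 : y ^+ 2 = `|y| ^+ 2 by rewrite real_normK ?num_real.
rewrite y2 in H *; move: (`|y|) u0 H => u u0 H.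
have tu : t / 2 <= u.
  rewrite leNgt; apply/negP => ut.
  have : u ^+ 2 < (t / 2) ^+ 2 by rewrite ltr_pXn2r// nnegrE; lra.
  rewrite exprMn exprVn; have := sqr_ge0 t.
  rewrite (_ : (2 ^+ 2)^-1 = 1 / 4 :> R); last by field.
  lra.
have e1 : u ^+ 2 <= 32 ^+ 2 * expR (u / 16).
  have := expR_ge1Dx (u / 32); have -> : expR (u / 16) = expR (u / 32) ^+ 2.
    by rewrite -expRM_natl; congr expR; field.
  move=> H1; have : (1 + u / 32) ^+ 2 <= expR (u / 32) ^+ 2.
    by rewrite ler_pXn2r// ?nnegrE ?expR_ge0//; lra.
  rewrite !expr2; nra.
have e2 : expR (u / 16) <= expR (- (t / 32)) * expR (u / 8).
  by rewrite -expRD ler_expR; lra.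
have := sqr_ge0 t; rewrite -mulrA; lra.
Qed.

(** On the event the mean of the squared coordinates exceeds t^2 >= 1, so s is at most 4 times the
    mean of x_i^2 - t^2 / 2, and exponential moments are used coordinatewise. The constant is 32^3 =
    4 * 32^2 * 8. *)
Lemma Ex_large_noisy_sqnorm (t : R) : 1 <= t ->
  (Ex P (fun x => noisy_sqnorm x * \1_[set x | (1 + t ^+ 2 < noisy_sqnorm x)%R] x)%R
    <= (32 ^+ 3 * expR (- (t / 32)))%:E)%E.
Proof.
move=> t1; set A := [set x | _].
have mA : measurable A by apply: measurable_superlevel; exact: measurable_noisy_sqnorm.
have mI : measurable_fun setT (\1_A : _ -> R) by exact: measurable_indic.
have mx (i : 'I_n) : measurable_fun setT (fun x : n.-tuple R => expR (`|tnth x i| / 8)).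
  apply: (measurableT_comp (@measurable_expR R)); apply: measurable_funM => //.
  by apply: measurableT_comp => //; exact: measurable_tnth.
have [K KE] : {K : R | K = 32 ^+ 2} by eexists.
have K0 : 0 <= K by rewrite KE sqr_ge0.
pose c := 4 * K * expR (- (t / 32)) / n%:R.
have c0 : 0 <= c.
  by apply: divr_ge0; rewrite ?ler0n//; apply: mulr_ge0; [exact: mulr_ge0|exact: expR_ge0].
have mS : measurable_fun setT (fun x : n.-tuple R => \sum_(i < n) expR (`|tnth x i| / 8)).
  by apply: measurable_sum.
have S0 (x : n.-tuple R) : 0 <= \sum_(i < n) expR (`|tnth x i| / 8).
  by apply: sumr_ge0 => i _; exact: expR_ge0.
have s1 x := @noisy_sqnorm_ge1 R n x.
apply: (@le_trans _ _ (Ex P (fun x => c * \sum_(i < n) expR (`|tnth x i| / 8)))).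
  apply: Ex_le => [|||x].
  - by apply: measurable_funM => //; exact: measurable_noisy_sqnorm.
  - exact: measurable_funM.
  - by move=> x; rewrite mulr_ge0// (le_trans _ (s1 x)).
  - rewrite indicE; case: (boolP (x \in A)) => xA; last by rewrite mulr0 mulr_ge0.
    rewrite mulr1n mulr1; move: xA; rewrite inE /A/= /noisy_sqnorm => xA.
    have H : \sum_(i < n) (tnth x i ^+ 2 - t ^+ 2 / 2) <=
        \sum_(i < n) K * expR (- (t / 32)) * expR (`|tnth x i| / 8).
      by apply: ler_sum => i _; rewrite KE; exact: coordinate_excess.
    rewrite sumrB sumr_const card_ord -mulr_sumr -[X in _ - X]mulr_natl in H.
    have t2 : 1 <= t ^+ 2 by rewrite exprn_ege1.
    move: xA H; rewrite /c.
    set q := \sum_(i < n) tnth x i ^+ 2; set w := \sum_(i < n) expR _.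
    move: (expR (- (t / 32))) => e xA H.
    have nn : (n%:R : R) != 0 by rewrite gt_eqF.
    have H2 : q / n%:R - t ^+ 2 / 2 <= K * e / n%:R * w.
      rewrite -(ler_pM2l n0).
      have -> : n%:R * (q / n%:R - t ^+ 2 / 2) = q - n%:R * (t ^+ 2 / 2) by field.
      by have -> : n%:R * (K * e / n%:R * w) = K * e * w by field.
    have -> : 4 * K * e / n%:R * w = 4 * (K * e / n%:R * w) by field.
    lra.
rewrite (ExZ P mS S0 c0) Ex_sum//.
have E8 i : (Ex P (fun x => expR (`|tnth x i| / 8))%R <= 8%:E)%E.
  have -> : (fun x => expR (`|tnth x i| / 8)) = (fun x => expR (`|dot (unit_vec i) x| / 8)).
    by apply/funext => x; rewrite dot_unit.
  by apply: (exp_moment P Plc Piso); rewrite sqnorm_unit.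
apply: (@le_trans _ _ (c%:E * \sum_(i < n) 8%:E)%E).
  by rewrite lee_wpmul2l ?lee_fin//; apply: lee_sum => i _; exact: E8.
rewrite sumEFin sumr_const card_ord -EFinM lee_fin -[X in _ * X]mulr_natl /c.
rewrite KE [leLHS](_ : _ = 32 ^+ 3 * expR (- (t / 32)))//.
have nn : (n%:R : R) != 0 by rewrite gt_eqF.
by move: (expR _) => e; field.
Qed.

End moments.

Section parameters.
Context {R : realType}.

(** exp(c x) = exp(x / a)^(p+1) >= (x / a)^(p+1) with a = (p + 1) / c, and one factor x absorbs
    a^(p+1). *)
Lemma expR_dominates_pow (p : nat) (c M : R) : 0 < c ->
  exists x0, M <= x0 /\ forall x, x0 <= x -> x ^+ p <= expR (c * x).
Proof.
move=> c0; pose a := p.+1%:R / c; have a0 : 0 < a by rewrite divr_gt0.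
exists (Num.max M (a ^+ p.+1)); split; first by rewrite le_max lexx.
move=> x; rewrite ge_max => /andP[_ ax].
have x0 : 0 < x by apply: lt_le_trans ax; rewrite exprn_gt0.
have -> : expR (c * x) = expR (x / a) ^+ p.+1.
  rewrite -expRM_natl; congr expR; rewrite /a; field.
  by rewrite gt_eqF//= addrC natr1 pnatr_eq0.
apply: (@le_trans _ _ ((x / a) ^+ p.+1)).
  rewrite expr_div_n ler_pdivlMr ?exprn_gt0// (exprS x) [x * _]mulrC.
  by rewrite ler_pM2l// exprn_gt0.
have xa : 0 <= x / a by rewrite divr_ge0// ltW.
by rewrite ler_pXn2r// ?nnegrE ?expR_ge0//; have := expR_ge1Dx (x / a); lra.
Qed.

(* With n = x^100 and about x^35 / 2 <= k <= x^35 pairs of rows, the midpoint defect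
   delta ~ k^3 x^6 / n = O(x^11) is negligible against the gain k eps^2 >= x^15 / 2, and
   k eps^2 exceeds the exponent eps^2 x^33 to be reached by a factor of order x^2. *)
Section scale.
Variables (x eps : R) (n k : nat).
Hypotheses (x_ge : 1000 * (1000 * 1000) <= x) (x_pow : x ^+ 100 <= expR (x / 64)).
Hypotheses (eps_le : eps <= 1) (eps_gt0 : 0 < eps) (eps_ge : 1 <= eps * x ^+ 10).
Hypotheses (nE : n%:R = x ^+ 100) (k_ge : x ^+ 35 / 2 <= k%:R) (k_le : k%:R <= x ^+ 35).

Let x1 : 1 <= x. Proof. by apply: le_trans x_ge; lra. Qed.
Let x0 : 0 < x. Proof. by rewrite (lt_le_trans _ x1). Qed.
Let xp i : 1 <= x ^+ i. Proof. exact: exprn_ege1. Qed.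
(** One spare power of x, which is at least 10^9, absorbs any numerical constant in what follows. *)
Let xS (M : R) i j : (i < j)%N -> M <= 1000 * (1000 * 1000) -> M * x ^+ i <= x ^+ j.
Proof.
move=> ij HM; apply: (@le_trans _ _ (x ^+ i.+1)); last by rewrite ler_weXn2l.
by rewrite exprS ler_pM2r ?exprn_gt0// (le_trans HM).
Qed.
Let xe : x ^+ 100 <= expR x.
Proof. by apply: le_trans x_pow _; rewrite ler_expR ler_pdivrMr//; have := x1; lra. Qed.

Let D : R := (2 * k)%:R * x ^+ 2 + 8 * (2 * k)%:R.
Let Q : R := weighted_moment_cst D / n%:R.
Let delta : R := 4 * Q * (D + 1).

Let k0 : 0 < k%:R :> R.
Proof. by apply: lt_le_trans k_ge; rewrite divr_gt0// exprn_gt0. Qed.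

Let D_bound : 0 <= D <= 3 * x ^+ 37.
Proof.
rewrite /D natrM; apply/andP; split.
  by rewrite addr_ge0// mulr_ge0 ?mulr_ge0 ?sqr_ge0// ltW.
have h1 : k%:R * x ^+ 2 <= x ^+ 37.
  by rewrite [x ^+ 37](exprD x 35 2) ler_pM2r// exprn_gt0.
have : 16 * x ^+ 35 <= x ^+ 37 by apply: xS => //; lra.
move: k_le h1; set u := k%:R * _; rewrite -mulrA -/u; lra.
Qed.

Let Q_bound : 0 <= Q /\ Q * x ^+ 25 <= 1.
Proof.
have /andP[D0 D1] := D_bound.
have D2 : D ^+ 2 <= 9 * x ^+ 74.
  apply: (@le_trans _ _ ((3 * x ^+ 37) ^+ 2)).
    by rewrite ler_pXn2r// nnegrE mulr_ge0// exprn_ge0// ltW.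
  by rewrite exprMn -exprM (_ : 3 ^+ 2 = 9)//; lra.
have W : 0 <= weighted_moment_cst D <= x ^+ 75.
  rewrite /weighted_moment_cst.
  have -> : 4096 = 4 * (32 * 32) :> R by ring.
  have h : (128 * 9 + 4 * (32 * 32)) * x ^+ 74 <= x ^+ 75 by apply: xS => //; lra.
  have := sqr_ge0 D; have := xp 74; move: D2 h.
  move: (D ^+ 2) (x ^+ 74) (x ^+ 75) => a b c; lra.
move: W => /andP[W0 W1]; rewrite /Q nE; split; first by rewrite divr_ge0// exprn_ge0// ltW.
by rewrite mulrAC ler_pdivrMr ?exprn_gt0// mul1r [x ^+ 100](exprD x 75 25) ler_pM2r// exprn_gt0.
Qed.

Lemma scale_Q_le : Q <= 1 / 2.
Proof.
have [Q0 Q1] := Q_bound.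
have : Q * 2 <= Q * x ^+ 25 by rewrite ler_wpM2l//; have := xS 2 0 25 isT; rewrite expr0 mulr1; apply; lra.
lra.
Qed.

Lemma scale_delta_ge0 : 0 <= delta.
Proof. by have [Q0 _] := Q_bound; have /andP[D0 _] := D_bound; rewrite /delta; nra. Qed.

Let delta_le : delta <= x ^+ 13.
Proof.
have [Q0 Q1] := Q_bound; have /andP[D0 D1] := D_bound.
have h : D + 1 <= 4 * x ^+ 37 by have := xp 37; lra.
have : delta <= 16 * (Q * x ^+ 37) by rewrite /delta; nra.
have : Q * x ^+ 37 <= x ^+ 12.
  by rewrite (exprD x 25 12) mulrA ler_piMl// exprn_ge0// ltW.
have : 16 * x ^+ 12 <= x ^+ 13 by apply: xS => //; lra.
lra.
Qed.


(** exp(- A) will bound each distant cell and exp(- B) is the target. The spare factor x in A >= x B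
    absorbs the number of cells, the weight [S] and [delta]. *)
Let A : R := k%:R * eps ^+ 2 / (1000 * 1000).
Let B : R := eps ^+ 2 * x ^+ 33.

Let epsx i j : j = (i + 20)%N -> x ^+ i <= eps ^+ 2 * x ^+ j.
Proof.
move=> ->; rewrite addnC exprD mulrA ler_peMl ?exprn_ge0 ?(ltW x0)//.
by rewrite (exprM x 10 2) -exprMn exprn_ege1.
Qed.

Let B_ge : x ^+ 13 <= B. Proof. exact: epsx. Qed.

Let B_le : B <= x ^+ 33.
Proof. by rewrite /B ler_piMl ?exprn_ge0 ?(ltW x0)// exprn_ile1// ltW. Qed.

Let A_ge : x * B <= A.
Proof.
rewrite /A ler_pdivlMr; last by lra.
apply: (@le_trans _ _ (eps ^+ 2 * (x ^+ 35 / 2))); last first.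
  by rewrite [leRHS]mulrC ler_pM2l// exprn_gt0.
have h : 2 * (1000 * 1000) * x ^+ 34 <= x ^+ 35 by apply: xS => //; lra.
have -> : x * B * (1000 * 1000) = eps ^+ 2 * (1000 * 1000 * x ^+ 34).
  by rewrite /B (exprS x 33); move: (x ^+ 33) => y; ring.
by rewrite ler_pM2l ?exprn_gt0//; lra.
Qed.

Let delta_le_A : delta <= A.
Proof.
apply: le_trans A_ge; apply: (le_trans delta_le); apply: (le_trans B_ge).
by rewrite ler_peMl// (le_trans _ B_ge)// (le_trans _ (xp 13)).
Qed.

Let mono_expR (M : R) i : (i < 100)%N -> M <= 1000 * (1000 * 1000) -> M * x ^+ i <= expR x.
Proof. by move=> i100 HM; apply: le_trans xe; exact: xS. Qed.

Variables (N0 m : nat).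
Hypotheses (N0_gt0 : (0 < N0)%N) (N0_ge : 6 * 1000 <= N0%:R * eps) (N0_le : N0%:R * eps <= 7 * 1000).
Hypotheses (m_ge : x / 8 <= 2 ^+ m) (m_le : 3 + 2 ^+ m.+1 <= x).

Let n0 : 0 < N0%:R :> R. Proof. by rewrite ltr0n. Qed.

Let N0_bound : N0%:R <= (7 * 1000) * x ^+ 10.
Proof.
apply: (@le_trans _ _ (N0%:R * eps * x ^+ 10)).
  by rewrite -mulrA ler_peMr// ltW.
by rewrite ler_pM2r// exprn_gt0.
Qed.

Let N0_expR (M : R) : 0 <= M -> M <= 1000 -> M * N0%:R <= expR x.
Proof.
move=> M0 M1; apply: (@le_trans _ _ (M * (7 * 1000) * x ^+ 10)).
  by rewrite -mulrA ler_wpM2l.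
apply: mono_expR => //; lra.
Qed.

Let theta : R := 3 / N0%:R.
Let theta_ge0 : 0 <= theta. Proof. by rewrite divr_ge0// ltW. Qed.
Let theta_le : theta <= eps / (2 * 1000).
Proof.
rewrite /theta ler_pdivrMr// mulrAC ler_pdivlMr; last by lra.
rewrite [eps * _]mulrC; have := N0_ge; lra.
Qed.

Lemma scale_theta_le : theta <= 1 / 2.
Proof. by have := theta_le; have := eps_le; lra. Qed.

Let theta2 : theta ^+ 2 <= eps ^+ 2 / (4 * (1000 * 1000)).
Proof.
have sq (a b : R) : 0 <= a -> a <= b -> a ^+ 2 <= b ^+ 2.
  by move=> a0 ab; rewrite ler_pXn2r// nnegrE// (le_trans a0).
have := sq _ _ theta_ge0 theta_le; rewrite (exprMn _ eps) exprVn.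
by rewrite (_ : (2 * 1000) ^+ 2 = 4 * (1000 * 1000))//; ring.
Qed.

Let eps2 : eps ^+ 2 <= 1. Proof. by rewrite exprn_ile1// ltW. Qed.

Let k_big : x ^+ 34 <= k%:R.
Proof.
have : 2 * x ^+ 34 <= x ^+ 35 by apply: xS => //; lra.
have := k_ge; lra.
Qed.

Let peak_ge (a y : R) : 0 < a -> a <= expR y -> expR (- (k%:R * (1 + 2 * y))) <= peak k a.
Proof.
move=> a0 ay; have q0 : 0 <= expR (- 1) / a ^+ 2 by rewrite divr_ge0 ?expR_ge0// exprn_ge0// ltW.
rewrite -mulrN expRM_natl /peak; apply: lerXn2r; rewrite ?nnegrE ?expR_ge0//.
rewrite opprD expRD ler_pM2l ?expR_gt0// expRN lef_pV2 ?posrE ?expR_gt0 ?exprn_gt0//.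
have b0 : 0 <= a by rewrite ltW.
by rewrite expRM_natl; apply: lerXn2r; rewrite ?nnegrE ?expR_ge0.
Qed.

Let tau : R := expR (- (2 * k * n)%:R).
Let pc : R := expR (- A).
Let E : R := expR (- (k%:R * (2 * theta ^+ 2))).

Let E_ge : expR (- (k%:R / 8)) <= E.
Proof.
rewrite ler_expR lerN2 ler_pM2l//.
by have := theta2; have := eps2; lra.
Qed.

Let e2 : 2 <= expR 1 :> R. Proof. by have := expR_ge1Dx (1 : R); lra. Qed.

Let e4 : 1 / 4 <= expR (- 1) :> R.
Proof.
rewrite (_ : - 1 = - (1 / 2) + - (1 / 2)); last by lra.
have := expR_ge1Dx (- (1 / 2) : R); rewrite expRD; move: (expR _) => e he.
have : (1 / 2) * (1 / 2) <= e * e by apply: ler_pM; lra.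
lra.
Qed.

Let k1 : 1 <= k%:R :> R. Proof. exact: le_trans k_big. Qed.

Let tauE y : k%:R * (4 + 2 * x) + y <= k%:R * (2 * x ^+ 100) -> tau <= expR (- (k%:R * (4 + 2 * x) + y)).
Proof. by move=> H; rewrite ler_expR lerN2 !natrM nE (mulrC 2 k%:R) -mulrA. Qed.

Let n_big y : y <= x -> k%:R * (4 + 2 * x) + y <= k%:R * (2 * x ^+ 100).
Proof.
move=> yx; apply: (@le_trans _ _ (k%:R * (4 + 2 * x) + k%:R * x)).
  by rewrite lerD2l (le_trans yx)// ler_peMl// ltW.
rewrite -mulrDr ler_pM2l//.
have : 100 * x ^+ 1 <= x ^+ 100 by apply: xS => //; lra.
have := x1; rewrite expr1; lra.
Qed.

Let A_le : A <= k%:R.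
Proof.
rewrite /A ler_pdivrMr; last by lra.
by apply: ler_pM; rewrite ?sqr_ge0// ?(le_trans eps2)//; lra.
Qed.

Lemma scale_pc_tau : 2 * tau <= pc * (peak k x * E).
Proof.
have h : tau <= expR (- (k%:R * (4 + 2 * x) + 1)) by apply/tauE/n_big.
have xx : x <= expR x by have := expR_ge1Dx x; lra.
apply: (@le_trans _ _ (expR 1 * expR (- (k%:R * (4 + 2 * x) + 1)))).
  by apply: ler_pM => //; rewrite ?expR_ge0.
apply: (@le_trans _ _ (pc * (expR (- (k%:R * (1 + 2 * x))) * expR (- (k%:R / 8))))); last first.
  by rewrite ler_pM2l ?expR_gt0//; apply: ler_pM; rewrite ?expR_ge0//; exact: peak_ge.
rewrite -!expRD ler_expR !mulrDr mulr1; have := A_le; have := k1; lra.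
Qed.

Lemma scale_pc_exp :
  8 * N0%:R * expR (delta + k%:R * (4 * theta ^+ 2 - 2 * (eps / 100 / 5) ^+ 2)) <= pc.
Proof.
apply: (@le_trans _ _ (expR x * expR (delta + k%:R * (4 * theta ^+ 2 - 2 * (eps / 100 / 5) ^+ 2)))).
  by rewrite ler_pM2r ?expR_gt0//; apply: N0_expR; lra.
rewrite -expRD ler_expR.
(* In units of A, the separation eps / 500 gains 8 and the cell width loses at most 1; [delta] and
   the factor 8 N0 will take at most 2 of the remaining 7. *)
have h : k%:R * (4 * theta ^+ 2 - 2 * (eps / 100 / 5) ^+ 2) <= - (7 * A).
  have -> : - (7 * A) = k%:R * (4 * (eps ^+ 2 / (4 * (1000 * 1000))) - 2 * (eps / 100 / 5) ^+ 2).
    by rewrite /A; field.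
  by rewrite ler_pM2l// lerD2r ler_pM2l.
have xA : x <= A.
  apply: le_trans A_ge; rewrite ler_peMr ?(ltW x0)//; exact: le_trans B_ge.
apply: (le_trans (lerD xA (lerD delta_le_A h))); have := x0; lra.
Qed.

Let N0_inv (y z : R) : 4 * N0%:R * y <= z -> y <= (2 * N0%:R)^-1 * z / 2.
Proof.
move=> H; rewrite [leRHS](_ : _ = z / (4 * N0%:R)); last by field; rewrite gt_eqF.
by rewrite ler_pdivlMr ?mulr_gt0// mulrC.
Qed.

Lemma scale_tau_typical : 2 * tau <= (2 * N0%:R)^-1 * (peak k 2 * E).
Proof.
have : tau <= (2 * N0%:R)^-1 * (peak k 2 * E) / 2; last by lra.
apply: N0_inv.
have h : tau <= expR (- (k%:R * (4 + 2 * x) + x)) by apply/tauE/n_big.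
apply: (@le_trans _ _ (expR x * expR (- (k%:R * (4 + 2 * x) + x)))).
  by apply: ler_pM; rewrite ?expR_ge0// ?mulr_ge0// ?(ltW n0)//; apply: N0_expR; lra.
apply: (@le_trans _ _ (expR (- (k%:R * (1 + 2 * 1))) * expR (- (k%:R / 8)))); last first.
  by apply: ler_pM; rewrite ?expR_ge0//; exact: peak_ge.
rewrite -!expRD ler_expR !mulrDr mulr1.
have : 0 <= k%:R * (2 * x) by rewrite mulr_ge0 ?mulr_ge0 ?ltW.
have := k1; lra.
Qed.

Let r : R := expR (- (k%:R / 2)).

(** 4^-k <= exp(- k), and [r] claims only exp(- k / 2). The other half pays for [delta], the factor
    4 N0 and the loss [E]. *)
Lemma scale_r : expR delta * (1 / 4) ^+ k <= r * ((2 * N0%:R)^-1 * E / 2).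
Proof.
rewrite [leRHS](_ : _ = (2 * N0%:R)^-1 * (r * E) / 2); last by ring.
apply: N0_inv.
have h4 : (1 / 4) ^+ k <= expR (- k%:R) :> R.
  rewrite (_ : - k%:R = k%:R * - 1); last by rewrite mulrN1.
  by rewrite expRM_natl; apply: lerXn2r; rewrite ?nnegrE ?expR_ge0//; lra.
apply: (@le_trans _ _ (expR x * (expR delta * expR (- k%:R)))).
  apply: ler_pM; rewrite ?mulr_ge0 ?expR_ge0 ?exprn_ge0// ?(ltW n0)//.
  - by apply: N0_expR; lra.
  - by rewrite ler_pM2l ?expR_gt0.
apply: (@le_trans _ _ (r * expR (- (k%:R / 8)))); last by rewrite ler_pM2l ?expR_gt0.
rewrite -!expRD ler_expR.
have : 100 * x ^+ 1 <= x ^+ 34 by apply: xS => //; lra.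
have : 100 * x ^+ 13 <= x ^+ 34 by apply: xS => //; lra.
have := delta_le; have := k_big; have := k0; rewrite expr1; lra.
Qed.

(** This is 1 + t^2 at t = x^34: the tail exp(- t / 32) beats exp(- B), as B <= x^33, while [S]
    stays below exp(x / 64). *)
Let S : R := 1 + (x ^+ 34) ^+ 2.
Let pb : R := 2 * expR (- k%:R).

Lemma scale_S_ge : x ^+ 2 <= S.
Proof.
rewrite /S -exprM (_ : (34 * 2 = 68)%N)//.
have : 1 * x ^+ 2 <= x ^+ 68 by apply: xS => //; lra.
lra.
Qed.

Let S_gt0 : 0 < S. Proof. by rewrite /S; have := sqr_ge0 (x ^+ 34); lra. Qed.

Let S_le : S <= expR (x / 64).
Proof.
apply: le_trans x_pow; rewrite /S -exprM (_ : (34 * 2 = 68)%N)//.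
have : 2 * x ^+ 68 <= x ^+ 100 by apply: xS => //; lra.
have := xp 68; lra.
Qed.

(** Since 2^m >= x / 8, the doubling decay is at most exp(- k x / 16), while S <= exp(x / 64) makes
    (exp(- 1) / S)^k at least exp(- k (1 + x / 64)). *)
Lemma scale_pb : r ^+ (2 ^ m) + tau <= pb * (expR (- 1) / S) ^+ k.
Proof.
have hS : expR (- (k%:R * (1 + x / 64))) <= (expR (- 1) / S) ^+ k.
  rewrite -mulrN expRM_natl; apply: lerXn2r; rewrite ?nnegrE ?divr_ge0 ?expR_ge0 ?(ltW S_gt0)//.
  by rewrite opprD expRD ler_pM2l ?expR_gt0// expRN lef_pV2// posrE expR_gt0.
apply: (@le_trans _ _ (pb * expR (- (k%:R * (1 + x / 64))))); last first.
  by rewrite ler_pM2l// mulr_gt0// expR_gt0.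
rewrite /pb -mulrA -expRD.
have h1 : r ^+ (2 ^ m) <= expR (- k%:R + - (k%:R * (1 + x / 64))).
  rewrite -expRM_natl ler_expR natrX.
  have -> : 2 ^+ m * - (k%:R / 2) = - (k%:R * (2 ^+ m / 2)) :> R by ring.
  rewrite -opprD lerN2 -{1}[k%:R]mulr1 -mulrDr ler_pM2l//.
  have := m_ge; have := x_ge; lra.
have h2 : tau <= expR (- k%:R + - (k%:R * (1 + x / 64))).
  have h : tau <= expR (- (k%:R * (4 + 2 * x) + 0)) by apply/tauE/n_big; exact: ltW.
  apply: (le_trans h); rewrite ler_expR -opprD lerN2 addr0 -{1}[k%:R]mulr1 -mulrDr ler_pM2l//.
  have := x1; lra.
lra.
Qed.

Let zeta : R := 32 ^+ 3 * expR (- (x ^+ 34 / 32)).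

Let third (y : R) : y <= - B - 2 -> expR y <= expR (- B) / 3.
Proof.
move=> H; apply: (@le_trans _ _ (expR (- B) * (expR (- 1) * expR (- 1)))).
  by rewrite -!expRD ler_expR; lra.
rewrite ler_pM2l ?expR_gt0//.
have : 2 * expR (- 1) <= 1 :> R by rewrite expRN ler_pdivrMr ?expR_gt0// mul1r.
by have := expR_gt0 (- 1 : R); move: (expR _) => e; nra.
Qed.

Let beta : R := exceptional_bound N0 m pc pb S zeta.

(** Cells, intermediate region and tail get a third each: their exponents A, k and x^34 / 32 all
    exceed B by more than the prefactors, which are at most exp(2 x + 1). *)
Lemma scale_bound : beta <= expR (- B).
Proof.
have X0 := x0; have X1 := x_ge.
have B1 := B_ge; have B33 := B_le; have kb := k_big.
have x13 : 4 * x ^+ 1 <= x ^+ 13 by apply: xS => //; lra.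
have x34 : 1000 * x ^+ 33 <= x ^+ 34 by apply: xS => //; lra.
have x33 : 4 * x ^+ 1 <= x ^+ 33 by apply: xS => //; lra.
rewrite expr1 in x13 x33.
have Sx : S <= expR x by apply: le_trans S_le _; rewrite ler_expR; lra.
have Nm : (N0 * (2 + 2 ^ m.+1))%N%:R <= expR x.
  rewrite natrM natrD natrX.
  apply: (@le_trans _ _ (7 * 1000 * x ^+ 11)); last by apply: mono_expR => //; lra.
  rewrite [x ^+ 11](exprD x 10 1) expr1 mulrA; apply: ler_pM => //.
  have := m_le; lra.
have t1 : S * ((N0 * (2 + 2 ^ m.+1))%N%:R * pc) <= expR (- B) / 3.
  apply: (@le_trans _ _ (expR x * (expR x * expR (- A)))).
    by apply: ler_pM; rewrite ?(ltW S_gt0) ?mulr_ge0 ?expR_ge0// ler_pM2r// expR_gt0.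
  rewrite -!expRD; apply: third.
  have : (x - 1) * x <= (x - 1) * B by rewrite ler_pM2l; lra.
  have : 1000 * x <= x * x by rewrite ler_pM2r//; lra.
  have := A_ge; nra.
have t2 : S * pb <= expR (- B) / 3.
  apply: (@le_trans _ _ (expR x * (expR 1 * expR (- k%:R)))).
    by apply: ler_pM; rewrite ?(ltW S_gt0) ?mulr_ge0 ?expR_ge0// ler_pM2r// expR_gt0.
  rewrite -!expRD; apply: third; lra.
have t3 : zeta <= expR (- B) / 3.
  apply: (@le_trans _ _ (expR x * expR (- (x ^+ 34 / 32)))).
    rewrite ler_pM2r ?expR_gt0// -[leLHS]mulr1 -(expr0 x); apply: mono_expR => //.
    by rewrite (_ : 32 ^+ 3 = 32 * (32 * 32)); [lra|ring].
  rewrite -!expRD; apply: third; lra.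
by rewrite /beta /exceptional_bound mulrDr; lra.
Qed.

Lemma scale_eps : 10 * (eps / 100 + N0%:R^-1) + 4 * beta < eps.
Proof.
have b1 := scale_bound.
have Ni : N0%:R^-1 <= eps / 1000.
  by rewrite -[leLHS]mul1r ler_pdivrMr//; have := N0_ge; lra.
have be : beta * 9 <= eps.
  have xB : expR x <= expR B.
    rewrite ler_expR; apply: le_trans B_ge.
    by have : 1 * x ^+ 1 <= x ^+ 13; [apply: xS => //; lra|rewrite expr1 mul1r].
  have h9 : 9 * x ^+ 10 <= expR B by apply: le_trans xB; apply: mono_expR => //; lra.
  apply: (@le_trans _ _ (expR (- B) * 9)); first by rewrite ler_pM2r.
  rewrite expRN mulrC ler_pdivrMr ?expR_gt0//.
  apply: (@le_trans _ _ (eps * (9 * x ^+ 10))); last by rewrite ler_pM2l.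
  by have := eps_ge; lra.
have := eps_gt0; lra.
Qed.

End scale.
End parameters.

(** * The thin-shell estimate *)

Section thin_shell.
Context {R : realType}.

Lemma scale_existence (x eps : R) : 1000 * (1000 * 1000) <= x -> 0 < eps <= 1 ->
  exists k N0 m : nat, [/\ x ^+ 35 / 2 <= k%:R, k%:R <= x ^+ 35, (0 < N0)%N &
    [/\ 6 * 1000 <= N0%:R * eps, N0%:R * eps <= 7 * 1000, x / 8 <= 2 ^+ m & 3 + 2 ^+ m.+1 <= x]].
Proof.
move=> hx /andP[e0 e1].
have nat_floor (y : R) : 0 <= y -> exists t : nat, t%:R <= y < t%:R + 1.
  by move=> y0; exists (Num.trunc y); rewrite natr1; exact: truncn_itv.
have x8 : 8 <= x by apply: le_trans hx; lra.
move: hx => _.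
have x35 : 8 <= x ^+ 35 by rewrite exprS (le_trans x8)// ler_peMr ?exprn_ege1//; lra.
have [k /andP[k1 k2]] : exists k : nat, k%:R <= x ^+ 35 < k%:R + 1 by apply: nat_floor; lra.
have [N /andP[N1 N2]] : exists N : nat, N%:R <= 6 * 1000 / eps < N%:R + 1.
  by apply: nat_floor; apply: divr_ge0; [lra|exact: ltW].
have [j /andP[j1 j2]] : exists j : nat, j%:R <= x / 4 < j%:R + 1 by apply: nat_floor; lra.
have j0 : (0 < j)%N by rewrite lt0n -(eqr_nat R); apply/eqP => j0; move: j2; rewrite j0; lra.
have h1 : j.+1%:R <= (2 ^ (trunc_log 2 j).+1)%:R :> R by rewrite ler_nat; exact: trunc_log_ltn.
have h2 : (2 ^ trunc_log 2 j)%:R <= j%:R :> R by rewrite ler_nat; exact: trunc_logP.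
(* The successor pushes N0 eps above 6000, and the binary logarithm of the integer part of x / 4
   puts 2^m between x / 8 and x / 4. *)
exists k, N.+1, (trunc_log 2 j).
move: h1 h2; rewrite -[j.+1%:R]natr1 -[N.+1%:R]natr1 !natrX exprS => h1 h2.
move: (x ^+ 35) x35 k1 k2 => y y8 k1 k2.
split => //; first lra.
split; [|rewrite mulrDl mul1r|lra|lra].
- by rewrite -ler_pdivrMr// ltW.
- by move: N1; rewrite ler_pdivlMr//; lra.
Qed.

Lemma noisy_sqnorm_deviation {n : nat} (P : probability (n.-tuple R) R) (x eps : R) :
  (0 < n)%N -> log_concave_prob P -> isotropic_prob P ->
  1000 * (1000 * 1000) <= x -> x ^+ 100 <= expR (x / 64) -> n%:R = x ^+ 100 ->
  0 < eps -> eps <= 1 -> 1 <= eps * x ^+ 10 ->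
  (P [set y | (eps <= `|noisy_sqnorm y - 2|)%R] <= (expR (- (eps ^+ 2 * x ^+ 33)))%:E)%E.
Proof.
move=> n0 Plc Piso hx hexp nE e0 e1 ex.
have [|k [N0 [m [k1 k2 N00 [N1 N2 m1 m2]]]]] := scale_existence x eps hx; first by rewrite e0.
have B := scale_bound x eps k hx hexp e1 e0 ex k1 N0 m N2 m2.
apply: (@le_trans _ _ (exceptional_bound N0 m (expR (- (k%:R * eps ^+ 2 / (1000 * 1000))))
  (2 * expR (- k%:R)) (1 + (x ^+ 34) ^+ 2) (32 ^+ 3 * expR (- (x ^+ 34 / 32))))%:E); last first.
  by rewrite lee_fin.
have x1 : 1 <= x by apply: le_trans hx; lra.
apply: (@concentration_from_midpoint _ _ R P noisy_sqnorm k (@profile R n (2 * k) P)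
  (@truncated_profile R n (2 * k) P) (expR (- (2 * k * n)%:R)) _ x measurable_noisy_sqnorm
  noisy_sqnorm_ge1 (Ex_noisy_sqnorm P n0 Piso) (fun a => measurable_profile_kernel a)
  (fun a => profileE P a) _ (fun a => truncated_profile_le P a)
  (fun a => truncated_profile_ge P a)
  (truncated_profile_midpoint P n0 Plc Piso x (scale_Q_le x n k hx nE k2))
  _ N0 N00 m (expR (- (k%:R / 2))) (eps / 100) _ _ _ _
  (scale_theta_le eps e1 N0 N00 N1) m2 (scale_S_ge x hx) _ _ (expR_ge0 _)
  (scale_pc_tau x eps n k hx e1 e0 nE k1 N0 N00 N1)
  (scale_pc_exp x eps n k hx hexp e0 ex nE k1 k2 N0 N00 N1 N2)
  (scale_tau_typical x eps n k hx hexp e1 e0 ex nE k1 N0 N00 N1 N2)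
  (scale_r x eps n k hx hexp e1 e0 ex nE k1 k2 N0 N00 N1 N2)
  (scale_pb x n k hx hexp nE k1 m m1)
  (Ex_large_noisy_sqnorm P n0 Plc Piso _ _)
  eps (scale_eps x eps k hx hexp e1 e0 ex k1 N0 m N00 N1 N2 m2)).
- by move=> a; apply: fine_ge0; apply: Ex_ge0 => t; rewrite mulr_ge0// smoothed_ge0.
- exact: scale_delta_ge0.
- lra.
- lra.
- exact: exprn_ege1.
Qed.

End thin_shell.

Lemma measurable_enorm (R : realType) (n : nat) : measurable_fun setT (@enorm R n).
Proof.
have mS : measurable_fun setT (fun x : n.-tuple R => \sum_(i < n) tnth x i ^+ 2).
  by apply: measurable_sum => i; apply: measurable_funX; exact: measurable_tnth.
rewrite (_ : @enorm R n = fun x => (\sum_(i < n) tnth x i ^+ 2) `^ 2^-1).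
  exact: (measurableT_comp (@measurable_powR R _)).
by apply/funext => x; rewrite powR12_sqrt// sumr_ge0// => i _; exact: sqr_ge0.
Qed.

Lemma density_log_concave_prob {R : realType} {n : nat} (f : n.-tuple R -> R) :
  isotropic_density f -> log_concave f ->
  exists P : probability (n.-tuple R) R, [/\ log_concave_prob P, isotropic_prob P &
    forall A, measurable A -> prob_dens f A = P A].
Proof.
move=> iso lc; have [mf [f0 [f1 _]]] := iso.
have [|P EP] := density_probability (lebn n) f mf f0.
  by rewrite -iintE//; exact/measurable_EFinP.
have E (g : n.-tuple R -> R) : measurable_fun setT g -> (forall x, 0 <= g x) ->
    Ex P g = iint (fun x => (g x * f x)%:E).
  move=> mg g0; rewrite /Ex EP; [|exact/measurable_EFinP|by move=> x; rewrite lee_fin].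
  rewrite iintE// => [|x]; last by rewrite lee_fin mulr_ge0.
  by apply/measurable_EFinP; exact: measurable_funM.
exists P; split.
- exact: log_concave_prob_density mf lc E.
- exact: isotropic_prob_density iso E.
- by move=> A mA; rewrite -Ex_indic// E.
Qed.

(** With e = |y| / sqrt n, the right side is |e^2 - 1| = |e - 1| (e + 1). *)
Lemma sqnorm_deviation {R : realType} (n : nat) (y : n.-tuple R) : (0 < n)%N ->
  `| enorm y / Num.sqrt n%:R - 1 | <= `| noisy_sqnorm y - 2 |.
Proof.
move=> n0; set e := enorm y / _.
have e0 : 0 <= e by rewrite divr_ge0 ?sqrtr_ge0.
have -> : noisy_sqnorm y - 2 = (e - 1) * (e + 1).
  rewrite -subr_sqr expr1n /e expr_div_n /enorm !sqr_sqrtr//; last first.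
    by apply: sumr_ge0 => i _; exact: sqr_ge0.
  by rewrite /noisy_sqnorm; lra.
rewrite normrM ler_peMr// ger0_norm; lra.
Qed.

(** Hundredth roots of n and eps turn all real exponents of the statement into natural ones. *)
Lemma natural_root {R : realType} (a : R) (m : nat) : 0 <= a ->
  exists2 z, 0 <= z & forall i : nat, a `^ (i%:R / m.+1%:R) = z ^+ i.
Proof.
move=> a0; exists (a `^ m.+1%:R^-1) => [|i]; first exact: powR_ge0.
by rewrite mulrC powRrM powR_mulrn// powR_ge0.
Qed.

Theorem theorem4p4 (R : realType) :
  exists c C : R, 0 < c /\ 0 < C /\
  forall (n : nat), (0 < n)%N ->
  forall f : n.-tuple R -> R,
    isotropic_density f -> log_concave f ->
  forall eps : R, 0 <= eps <= 1 ->
    (prob_dens f [set x | eps <= `| enorm x / Num.sqrt (n%:R) - 1 |]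
     <= (C * expR (- c * (eps `^ (333%:R / 100%:R)) * (n%:R `^ (33%:R / 100%:R))))%:E)%O.
Proof.
have [|x0 [x0M x0P]] := @expR_dominates_pow R 100 (1 / 64) (1000 * (1000 * 1000)); first lra.
have x01 : 1 <= x0 by apply: le_trans x0M; lra.
(* With this C the bound exceeds 1, hence is trivial, whenever eps^3.33 n^0.33 <= x0^33. *)
exists 1, (expR (x0 ^+ 33)); split => //; split; first exact: expR_gt0.
move=> n n0 f iso lc eps /andP[eps0 eps1].
have [P [Plc Piso Pf]] := density_log_concave_prob f iso lc.
have mA : measurable [set x | eps <= `| @enorm R n x / Num.sqrt n%:R - 1 |].
  have -> : [set x | eps <= `| @enorm R n x / Num.sqrt n%:R - 1 |] =
      ~` [set x | - eps < - `| enorm x / Num.sqrt n%:R - 1 |].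
    by apply/seteqP; split => x /=; rewrite ltrN2 leNgt => /negP.
  apply: measurableC; apply: measurable_superlevel; apply: measurable_funN.
  apply: measurableT_comp => //; apply: measurable_funB => //.
  by apply: measurable_funM => //; exact: measurable_enorm.
rewrite Pf// mulN1r.
have [x x_ge0 xE] := @natural_root R n%:R 99 (ler0n _ _).
have [z z_ge0 zE] := @natural_root R eps 99 eps0.
rewrite xE zE.
have nE : n%:R = x ^+ 100 by rewrite -xE divff// powRr1.
have eE : eps = z ^+ 100 by rewrite -zE divff// powRr1.
have z1 : z <= 1 by rewrite -(@expr_le1 _ 100)// -eE.
have zpow (i j : nat) : (i <= j)%N -> z ^+ j <= z ^+ i by exact: ler_wiXn2l.
have trivial_bound : z ^+ 333 * x ^+ 33 <= x0 ^+ 33 ->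
    (P [set x | (eps <= `| enorm x / Num.sqrt n%:R - 1 |)%R] <=
    (expR (x0 ^+ 33) * expR (- z ^+ 333 * x ^+ 33))%:E)%E.
  move=> H; apply: (@le_trans _ _ 1%E); first exact: probability_le1.
  by rewrite lee_fin -expRD -[leLHS]expR0 ler_expR mulNr subr_ge0.
have [xx0|xx0] := ltP x x0.
  apply: trivial_bound; apply: (@le_trans _ _ (x ^+ 33)).
    by rewrite ler_piMl ?exprn_ge0// exprn_ile1.
  by rewrite lerXn2r ?nnegrE// ?(le_trans x_ge0)// ltW.
have x1 : 1 <= x by exact: le_trans xx0.
(* For eps < n^-0.1 the exponent is at most (z^10 x)^33 <= 1, since (z^10 x)^10 = eps x^10 < 1. *)
have [ex|ex] := ltP (eps * x ^+ 10) 1.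
  apply: trivial_bound; apply: (@le_trans _ _ ((z ^+ 10 * x) ^+ 33)).
    by rewrite exprMn -exprM ler_pM2r ?exprn_gt0 ?(lt_le_trans _ x1)// zpow.
  apply: (@le_trans _ _ 1); last exact: exprn_ege1.
  apply: exprn_ile1; first by rewrite mulr_ge0// exprn_ge0.
  by rewrite -(@expr_le1 _ 10) ?mulr_ge0 ?exprn_ge0// exprMn -exprM -eE ltW.
have eps_gt0 : 0 < eps.
  rewrite lt_neqAle eps0 andbT eq_sym; apply/eqP => H.
  by move: ex; rewrite H mul0r ler10.
have hexp : x ^+ 100 <= expR (x / 64) by rewrite mulrC -[64^-1]mul1r x0P.
have x_ge : 1000 * (1000 * 1000) <= x by exact: le_trans xx0.
have := noisy_sqnorm_deviation P x eps n0 Plc Piso x_ge hexp nE eps_gt0 eps1 ex.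
have mB : measurable [set y | eps <= `| @noisy_sqnorm R n y - 2 |].
  have -> : [set x | eps <= `| @noisy_sqnorm R n x - 2 |] =
      ~` [set x | - eps < - `| noisy_sqnorm x - 2 |].
    by apply/seteqP; split => y /=; rewrite ltrN2 leNgt => /negP.
  apply: measurableC; apply: measurable_superlevel; apply: measurable_funN.
  apply: measurableT_comp => //; apply: measurable_funB => //; exact: measurable_noisy_sqnorm.
move=> H; apply: (@le_trans _ _ (P [set y | (eps <= `|noisy_sqnorm y - 2|)%R])).
  apply: le_measure; rewrite ?inE// => y /= /le_trans; apply; exact: sqnorm_deviation.
apply: (le_trans H); rewrite lee_fin.
(* The exponent obtained has eps^2 = z^200, which is stronger than z^333 because z <= 1. *)
apply: (@le_trans _ _ (expR (- z ^+ 333 * x ^+ 33))).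
  rewrite ler_expR mulNr lerN2 ler_pM2r ?exprn_gt0 ?(lt_le_trans _ x1)//.
  by rewrite eE -exprM zpow.
by rewrite ler_peMl ?expR_ge0// -[leLHS]expR0 ler_expR exprn_ge0// (le_trans _ x01).
Qed.
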